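(* Let $p\in\mathbb C\langle Z_1,\dots,Z_n\rangle$ be a positive regular noncommutative polynomial and let $X=(X_1,\dots,X_n)\in B(\mathcal H)^n$ be an $n$-tuple of operators with $r(R_{\tilde p,X})<1$. If $$G:=\sum_{|\alpha|\ge1}d_\alpha Z_\alpha^*+\sum_{\alpha\in\mathbb F_n^+}c_\alpha Z_\alpha$$ is a free pluriharmonic function (with scalar coefficients $c_\alpha,d_\alpha\in\mathbb C$) on the noncommutative domain ${\bf D}_{p,rad}^m$, then $$G(X):=\sum_{s=1}^\infty\sum_{|\alpha|=s}d_\alpha X_\alpha^*+\sum_{s=0}^\infty\sum_{|\alpha|=s}c_\alpha X_\alpha$$ is convergent in the operator norm of $B(\mathcal H)$, and the map $$\Psi_{p,X}:(Har({\bf D}_{p,rad}^m),\rho)\to(B(\mathcal H),\|\cdot\|),\qquad\Psi_{p,X}(G):=G(X),$$ is continuous. In particular, $\Psi_{p,X}|_{Hol({\bf D}_{p,rad}^m)}$ is a continuous unital algebra homomorphism. Moreover, the free analytic functional calculus on $Hol({\bf D}_{p,rad}^m)$ is uniquely determined by the map $Z_i\mapsto X_i$, $i\in\{1,\dots,n\}$; that is, every continuous unital algebra homomorphism $\Phi:(Hol({\bf D}_{p,rad}^m),\rho)\to(B(\mathcal H),\|\cdot\|)$ with $\Phi(Z_i)=X_i$ for all $i$ equals $\Psi_{p,X}|_{Hol({\bf D}_{p,rad}^m)}$.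
   Context: Fix integers $n,m\ge1$; $\mathcal H$ is a Hilbert space. $\mathbb F_n^+$ is the free monoid on generators $g_1,\dots,g_n$ with identity $g_0$; $|\alpha|$ is the word length; $\tilde\alpha:=g_{i_k}\cdots g_{i_1}$ is the reverse of $\alpha=g_{i_1}\cdots g_{i_k}$. For operators (or indeterminates) put $X_\alpha:=X_{i_1}\cdots X_{i_k}$, $X_{g_0}:=I$. A noncommutative polynomial $p=\sum_\alpha a_\alpha Z_\alpha$ is positive regular if $a_\alpha\ge0$ for all $\alpha$, $a_{g_0}=0$ and $a_{g_i}>0$ for $1\le i\le n$. Put $b^{(m)}_{g_0}:=1$ and, for $|\alpha|\ge1$, $b^{(m)}_\alpha:=\sum_{j=1}^{|\alpha|}\sum_{\gamma_1\cdots\gamma_j=\alpha,\,|\gamma_i|\ge1}a_{\gamma_1}\cdots a_{\gamma_j}\binom{j+m-1}{m-1}$. For a Hilbert space $\mathcal K$ and $Y\in B(\mathcal K)^n$, $\Phi_{p,Y}(D):=\sum_{\alpha}a_\alpha Y_\alpha DY_\alpha^*$; ${\bf D}_p^m(\mathcal K):=\{Y\in B(\mathcal K)^n:(id-\Phi_{p,Y})^k(I)\ge0,\ 1\le k\le m\}$; ${\bf D}_{p,rad}^m(\mathcal K):=\bigcup_{0\le t<1}t{\bf D}_p^m(\mathcal K)$ (the interior of ${\bf D}_p^m(\mathcal K)$). $F^2(H_n)$ is the Hilbert space with orthonormal basis $\{e_\alpha\}_{\alpha\in\mathbb F_n^+}$. Weighted left creation operators: $W_ie_\alpha=\sqrt{b^{(m)}_\alpha/b^{(m)}_{g_i\alpha}}\,e_{g_i\alpha}$,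 $W=(W_1,\dots,W_n)\in{\bf D}_p^m(F^2(H_n))$. Weighted right creation operators: $\Lambda_ie_\alpha=\sqrt{b^{(m)}_\alpha/b^{(m)}_{\alpha g_i}}\,e_{\alpha g_i}$. The reconstruction operator is $R_{\tilde p,X}:=\sum_{|\alpha|\ge1}a_{\tilde\alpha}\Lambda_\alpha\otimes X_{\tilde\alpha}^*\in B(F^2(H_n)\otimes\mathcal H)$, and $r(\cdot)$ is the usual spectral radius. $Hol({\bf D}_{p,rad}^m)$ is the algebra of formal power series $F=\sum_\alpha c_\alpha Z_\alpha$, $c_\alpha\in\mathbb C$, such that $F(Y)=\sum_{k=0}^\infty\sum_{|\alpha|=k}c_\alpha Y_\alpha$ converges in operator norm for every Hilbert space $\mathcal K$ and $Y\in{\bf D}_{p,rad}^m(\mathcal K)$ (free holomorphic functions), with the usual product of noncommutative power series. A self-adjoint free pluriharmonic function is one of the form $\Re F=\frac12(F+F^* )$, $F\in Hol({\bf D}_{p,rad}^m)$; a free pluriharmonic function is a linear combination of self-adjoint ones; equivalently, $G(Y)=\sum_{k\ge1}\sum_{|\alpha|=k}d_\alpha Y_\alpha^*+\sum_{k\ge0}\sum_{|\alpha|=k}c_\alpha Y_\alpha$ with both series norm convergent for all $Y\in{\bf D}_{p,rad}^m(\mathcal K)$ and all $\mathcal K$ (the coefficients are unique). $Har({\bf D}_{p,rad}^m)\supset Hol({\bf D}_{p,rad}^m)$ is the set of all of them, with metric $\rho(F,G):=\sum_{k\ge1}2^{-k}\frac{d_{r_k}(F,G)}{1+d_{r_k}(F,G)}$,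 where $d_r(F,G):=\|F(rW)-G(rW)\|$ and $\{r_k\}\subset(0,1)$ is a fixed increasing sequence converging to $1$. *)

(* Defs.v *)
From HB Require Import structures.
From mathcomp Require Import all_boot all_order all_algebra.
From mathcomp Require Import complex.
From mathcomp Require Import boolp classical_sets functions cardinality fsbigop reals.
From mathcomp Require Import topology normedtype sequences.
From mathcomp Require Import ring lra.

Set Implicit Arguments.
Unset Strict Implicit.
Unset Printing Implicit Defensive.

Import Order.TTheory GRing.Theory Num.Theory.
Import numFieldNormedType.Exports.

Local Open Scope classical_set_scope.
Local Open Scope ring_scope.

Local Notation Re := complex.Re.
Local Notation Im := complex.Im.

(* As for any normed module over R[i], the norm is R[i]-valued (and real).  The
   inner product is linear in its first argument. *)
HB.mixin Record CompleteNormedModule_isHilbert (R : realType) H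
    & CompleteNormedModule R[i] H := {
  hdot : {dot H for (@Num.conj R[i])} ;
  hdot_norm : forall x : H, hdot x x = `|x| ^+ 2
}.

#[short(type="hilbertType")]
HB.structure Definition Hilbert (R : realType) :=
  {H of CompleteNormedModule_isHilbert R H & CompleteNormedModule R[i] H}.

Section complex_hilbert.
Variable R : realType.
Local Notation C := (R[i]).

Lemma normc_ReIm (z : C) : `|z| = (Num.sqrt (Re z ^+ 2 + Im z ^+ 2))%:C%C.
Proof. by case: z. Qed.

Lemma Re_norm_le (z : C) : `|(Re z)%:C%C| <= `|z| :> C.
Proof.
rewrite !normc_ReIm lecR ler_sqrt ?addr_ge0 ?sqr_ge0//=.
by rewrite expr0n/= addr0 lerDl sqr_ge0.
Qed.

Lemma Im_norm_le (z : C) : `|(Im z)%:C%C| <= `|z| :> C.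
Proof.
rewrite !normc_ReIm lecR ler_sqrt ?addr_ge0 ?sqr_ge0//=.
by rewrite expr0n/= addr0 lerDr sqr_ge0.
Qed.

Lemma normc_real (x : R) : `|x%:C%C| = (`|x|)%:C%C :> C.
Proof. by rewrite normc_ReIm/= expr0n/= addr0 sqrtr_sqr. Qed.

Lemma normc_le_ReIm (z : C) : `|z| <= (`|Re z| + `|Im z|)%:C%C.
Proof.
case: z => a b; rewrite (_ : a +i* b = a%:C + (0 +i* b))%C; last first.
  by congr Complex; rewrite ?addr0 ?add0r.
rewrite (le_trans (ler_normD _ _))// !normc_ReIm/= expr0n/= addr0 add0r.
by rewrite !sqrtr_sqr rmorphD lerD//= ?addr0 ?add0r lecR.
Qed.

Lemma C_complete (F : set_system C^o) : ProperFilter F -> cauchy F -> cvg F.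
Proof.
move=> FF Fc.
have key (g : C -> R) : (forall z w, g (z - w) = g z - g w) ->
    (forall z, `|(g z)%:C%C| <= `|z| :> C) -> cvg (g @ F).
  move=> gB gle; apply: R_complete; apply: cauchy_exP => e e0.
  have e0' : 0 < e%:C%C :> C by rewrite ltcR.
  have /cauchyP/(_ _ e0')[z Fz] := Fc; exists (g z).
  rewrite -[_ (ball _ _)]/(F (g @^-1` (ball (g z) e))).
  apply: filterS Fz => w; rewrite -!ball_normE/= => H1.
  suff : (`|g z - g w|)%:C%C < e%:C%C :> C by rewrite ltcR.
  by rewrite -gB -normc_real (le_lt_trans (gle _)).
have /cvg_ex[/= a Fa] : cvg (@Re R @ F).
  apply: key => [z w|]; last exact: Re_norm_le.
  by case: z; case: w.
have /cvg_ex[/= b Fb] : cvg (@Im R @ F).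
  apply: key => [z w|]; last exact: Im_norm_le.
  by case: z; case: w.
apply/cvg_ex; exists (a +i* b)%C.
apply/cvgrPdist_lt => e e0.
have eE : e = (Re e)%:C%C by move: e0; rewrite ltcE/= => /andP[/eqP h _]; rewrite [LHS]complexE h mulr0 addr0.
have e0' : 0 < Re e / 2 by rewrite divr_gt0// -ltcR -eE.
near=> z.
rewrite (le_lt_trans (normc_le_ReIm _))// eE ltcR [ltRHS]splitr ltrD//.
  suff : `|a - Re z| < Re e / 2 by case: (z).
  by near: z; move/cvgrPdist_lt : Fa; exact.
suff : `|b - Im z| < Re e / 2 by case: (z).
by near: z; move/cvgrPdist_lt : Fb; exact.
Unshelve. all: by end_near. Qed.

HB.instance Definition _ := GRing.ComAlgebra.copy C C^o.
HB.instance Definition _ := NormedModule.copy C C^o.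
HB.instance Definition _ := Uniform_isComplete.Build C C_complete.

Definition cdot (x y : C) : C := x * Num.conj y.

Let cdot_is_bilinear : bilinear_for
  (GRing.Scale.Law.clone _ _ ( *%R ) _) (GRing.Scale.Law.clone _ _ (Num.conj \; *%R) _) cdot.
Proof.
split=> [u|u] a x y; rewrite /cdot /=.
  by rewrite mulrDl -mulrA.
by rewrite rmorphD rmorphM mulrDr mulrCA.
Qed.

HB.instance Definition _ := bilinear_isBilinear.Build C C C _ _ _ cdot cdot_is_bilinear.

Let cdot_herm x y : cdot x y = (-1) ^+ false * Num.conj (cdot y x).
Proof. by rewrite /cdot expr0 mul1r rmorphM/= (conjCK x) mulrC. Qed.

HB.instance Definition _ := isHermitianSesquilinear.Build C C _ _ cdot cdot_herm.

Let cdot_pos x : x != 0 -> 0 < cdot x x.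
Proof. by move=> x0; rewrite /cdot -normCK exprn_gt0// normr_gt0. Qed.

HB.instance Definition _ := isDotProduct.Build C C cdot cdot_pos.

Let cdot_norm (x : C) : cdot x x = `|x| ^+ 2.
Proof. by rewrite /cdot -normCK. Qed.

HB.instance Definition _ :=
  CompleteNormedModule_isHilbert.Build R C cdot_norm.

End complex_hilbert.

Section real_complex.
Variable R : realType.

Lemma realCD (x y : R) : (x + y)%:C%C = x%:C%C + y%:C%C :> R[i].
Proof. exact: rmorphD. Qed.

Lemma realCB (x y : R) : (x - y)%:C%C = x%:C%C - y%:C%C :> R[i].
Proof. exact: rmorphB. Qed.

Lemma realCM (x y : R) : (x * y)%:C%C = x%:C%C * y%:C%C :> R[i].
Proof. exact: rmorphM. Qed.

Lemma realCX (x : R) k : (x ^+ k)%:C%C = x%:C%C ^+ k :> R[i].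
Proof. exact: rmorphXn. Qed.

Lemma realC_sum (I : Type) (r : seq I) (P : pred I) (F : I -> R) :
  (\sum_(i <- r | P i) F i)%:C%C = \sum_(i <- r | P i) (F i)%:C%C :> R[i].
Proof. exact: rmorph_sum. Qed.

Lemma ge0_realC (z : R[i]) : 0 <= z -> z = (Re z)%:C%C.
Proof. by move=> z0; rewrite [LHS]complexE (ger0_Im z0) mulr0 addr0. Qed.

Lemma normcE (V : normedModType R[i]) (x : V) : `|x| = (Re `|x|)%:C%C.
Proof. exact: ge0_realC. Qed.

Lemma Re_norm_ge0 (V : normedModType R[i]) (x : V) : 0 <= Re `|x|.
Proof. by rewrite -lecR -normcE normr_ge0. Qed.

End real_complex.

Section bounded_operators.
Variables (R : realType) (H : hilbertType R).

Definition bounded_linear : pred (H -> H) := fun T =>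
  `[< linear T /\ exists M : R[i], forall x, `|T x| <= M * `|x| >].

Lemma bounded_linear_submod : submod_closed bounded_linear.
Proof.
split.
  apply/asboolP; split; first by move=> a x y; rewrite /= scaler0 addr0.
  by exists 0 => x; rewrite normr0 mul0r.
move=> a S T /asboolP[lS [M SM]] /asboolP[lT [N TN]]; apply/asboolP; split.
  move=> b x y; rewrite /= !fctE lS lT !scalerDr !scalerA (mulrC b) addrACA.
  by rewrite -!addrA.
exists (`|a| * M + N) => x; rewrite /= fctE mulrDl -mulrA.
by rewrite (le_trans (ler_normD _ _))// lerD// normrZ ler_wpM2l.
Qed.

HB.instance Definition _ :=
  GRing.isSubmodClosed.Build R[i] (H -> H) bounded_linear bounded_linear_submod.

Record bop := Bop { bop_fun :> H -> H ; bopP : bop_fun \in bounded_linear }.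

HB.instance Definition _ := [isSub for bop_fun].
HB.instance Definition _ := [Choice of bop by <:].
HB.instance Definition _ := [SubChoice_isSubLmodule of bop by <:].

Lemma bop_linear (T : bop) : linear T.
Proof. by have /asboolP[] := bopP T. Qed.

HB.instance Definition _ (T : bop) := GRing.isLinear.Build _ _ _ _ T (bop_linear T).

Lemma bop_bounded (T : bop) : exists M : R[i], forall x, `|T x| <= M * `|x|.
Proof. by have /asboolP[] := bopP T. Qed.

Lemma bop_ext (S T : bop) : (forall x, S x = T x) -> S = T.
Proof. by move=> ST; apply/val_inj/funext. Qed.

Lemma bopD (S T : bop) x : (S + T) x = S x + T x. Proof. by []. Qed.
Lemma bopN (T : bop) x : (- T) x = - T x. Proof. by []. Qed.
Lemma bopZ a (T : bop) x : (a *: T) x = a *: T x. Proof. by []. Qed.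
Lemma bop0 x : (0 : bop) x = 0. Proof. by []. Qed.

Let one_bounded : (id : H -> H) \in bounded_linear.
Proof.
apply/asboolP; split; first by [].
by exists 1 => x; rewrite mul1r.
Qed.

Let comp_bounded (S T : bop) : (S \o T : H -> H) \in bounded_linear.
Proof.
apply/asboolP; split; first by move=> a x y; rewrite /= !linearP.
have [M SM] := bop_bounded S; have [N TN] := bop_bounded T.
have [M0|M0] := boolP (0 <= M).
  exists (M * N) => x; rewrite /= (le_trans (SM _))// -mulrA.
  by rewrite ler_wpM2l.
exists 0 => x /=; rewrite mul0r normr_le0; have := SM (T x).
have [->|Tx0 h] := eqVneq (T x) 0; first by rewrite linear0.
exfalso; move/negP: M0; apply; have := le_trans (normr_ge0 _) h.
by rewrite pmulr_lge0// normr_gt0.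
Qed.

Definition bop_one := Bop one_bounded.
Definition bop_mul S T := Bop (comp_bounded S T).

Let mulA : associative bop_mul. Proof. by move=> S T U; apply: bop_ext. Qed.
Let mul1 : left_id bop_one bop_mul. Proof. by move=> S; apply: bop_ext. Qed.
Let mulr1 : right_id bop_one bop_mul. Proof. by move=> S; apply: bop_ext. Qed.
Let mulDl : left_distributive bop_mul +%R.
Proof. by move=> S T U; apply: bop_ext. Qed.
Let mulDr : right_distributive bop_mul +%R.
Proof. by move=> S T U; apply: bop_ext => x; rewrite bopD /= linearD. Qed.

HB.instance Definition _ :=
  GRing.Zmodule_isPzRing.Build bop mulA mul1 mulr1 mulDl mulDr.

Lemma bopM (S T : bop) x : (S * T) x = S (T x). Proof. by []. Qed.
Lemma bop1 x : (1 : bop) x = x. Proof. by []. Qed.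

(* Real-valued; the norm `|T| of B(H) is its image in R[i]. *)
Definition opnorm (T : bop) : R :=
  sup [set Re `|T x| | x in [set x : H | `|x| <= 1]].

Lemma opnorm_has_sup (T : bop) :
  has_sup [set Re `|T x| | x in [set x : H | `|x| <= 1]].
Proof.
split; first by exists (Re `|T 0|), 0 => //=; rewrite normr0.
have [M TM] := bop_bounded T; exists (Re `|M|) => _ [x /= x1 <-].
rewrite -lecR -!normcE (le_trans (TM _))//.
have M0 : 0 <= M * `|x| by apply: le_trans (TM x).
by rewrite -(ger0_norm M0) normrM normr_id ler_piMr.
Qed.

Lemma opnorm_ub (T : bop) x : `|x| <= 1 -> Re `|T x| <= opnorm T.
Proof. by move=> x1; apply: (ub_le_sup (opnorm_has_sup T).2); exists x. Qed.

Lemma opnorm_le (T : bop) M :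
  (forall x, `|x| <= 1 -> Re `|T x| <= M) -> opnorm T <= M.
Proof.
move=> TM; apply: ge_sup => [|_ [x /= x1 <-]]; last exact: TM.
exact: (opnorm_has_sup T).1.
Qed.

Lemma opnorm_ge0 (T : bop) : 0 <= opnorm T.
Proof.
have := @opnorm_ub T 0; rewrite linear0 normr0 => /(_ ler01).
by [].
Qed.

Lemma le_opnorm (T : bop) x : `|T x| <= (opnorm T)%:C%C * `|x|.
Proof.
have [->|x0] := eqVneq x 0; first by rewrite linear0 !normr0 mulr0.
have nx : 0 < `|x| by rewrite normr_gt0.
have := @opnorm_ub T (`|x|^-1 *: x).
rewrite -lecR -normcE linearZ !normrZ normfV normr_id mulVf ?gt_eqF//.
by move=> /(_ (lexx _)); rewrite ler_pdivrMl// mulrC.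
Qed.

Let norm (T : bop) : R[i] := (opnorm T)%:C%C.

Let normD S T : norm (S + T) <= norm S + norm T.
Proof.
rewrite /norm -realCD lecR; apply: opnorm_le => x x1.
rewrite bopD -lecR -normcE (le_trans (ler_normD _ _))//.
by rewrite realCD lerD// normcE lecR; exact: opnorm_ub.
Qed.

Let normZ_le a T : norm (a *: T) <= `|a| * norm T.
Proof.
rewrite /norm normcE -realCM lecR; apply: opnorm_le => x x1.
rewrite bopZ -lecR -normcE normrZ realCM -normcE ler_wpM2l//.
by rewrite normcE lecR; exact: opnorm_ub.
Qed.

Let normZ a T : norm (a *: T) = `|a| * norm T.
Proof.
apply/eqP; rewrite eq_le normZ_le/=.
have [->|a0] := eqVneq a 0.
  by rewrite normr0 mul0r scale0r /norm lecR opnorm_ge0.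
have := normZ_le a^-1 (a *: T).
by rewrite scalerA mulVf// scale1r normfV ler_pdivlMl ?normr_gt0.
Qed.

Let norm0_eq0 T : norm T = 0 -> T = 0.
Proof.
move=> T0; apply: bop_ext => x; apply/eqP; rewrite bop0 -normr_le0.
by have := le_opnorm T x; rewrite [(opnorm T)%:C%C]T0 mul0r.
Qed.

HB.instance Definition _ := Lmodule_isNormed.Build R[i] bop normD normZ norm0_eq0.

Lemma bop_normE (T : bop) : `|T| = (opnorm T)%:C%C. Proof. by []. Qed.

(* The (unique) operator T^* provided by the Riesz representation theorem. *)
Definition adjop (T : bop) : bop :=
  xget 0 [set S : bop | forall x y, hdot (T x) y = hdot x (S y)].

(* In R[i], 0 <= z entails that z is real. *)
Definition psdop (T : bop) := forall x : H, 0 <= hdot (T x) x.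

Definition spectrum (T : bop) : set R[i] :=
  [set l : R[i] | ~ exists S : bop,
    S * (l *: (1 : bop) - T) = 1 /\ (l *: (1 : bop) - T) * S = 1].

(* On the zero space the spectrum is empty and the radius is 0. *)
Definition spectral_radius (T : bop) : R := sup [set Re `|l| | l in spectrum T].

End bounded_operators.
Notation "''B' ( H )" := (bop H) (at level 8, format "''B' ( H )") : type_scope.

Section word_sums.
Variable n : nat.
Definition word := seq 'I_n.

Definition homsum (V : nmodType) (F : word -> V) : nat -> V :=
  fun k => \sum_(w : k.-tuple 'I_n) F w.

End word_sums.

Section complex_limits.
Variable R : realType.
Local Notation C := (R[i]).

Lemma cvg_realC (s : nat -> R) (l : R) :
  s @ \oo --> l -> (fun k => (s k)%:C%C : C) @ \oo --> (l%:C%C : C).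
Proof.
move=> /cvgrPdist_lt sl; apply/cvgrPdist_lt => e e0.
have eE : e = (Re e)%:C%C.
  by rewrite [LHS]complexE (ger0_Im (ltW e0)) mulr0 addr0.
have e0' : 0 < Re e by rewrite -ltcR -eE.
apply: filterS (sl _ e0') => k; rewrite -ltcR -eE -normc_real.
by rewrite rmorphB.
Qed.

Lemma cvg_conj (s : nat -> C) (l : C) :
  s @ \oo --> l -> (fun k => (s k)^* : C) @ \oo --> (l^* : C).
Proof.
move=> /cvgrPdist_lt sl; apply/cvgrPdist_lt => e e0.
by apply: filterS (sl _ e0) => k; rewrite -rmorphB norm_conjC.
Qed.

Lemma cvgC_dominated (u : nat -> C) (s : nat -> R) : cvgn s -> nondecreasing_seq s ->
  (forall j k, (j <= k)%N -> `|u k - u j| <= (s k - s j)%:C%C) -> cvgn u.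
Proof.
move=> cs ns us; apply: cauchy_cvg; apply: cauchy_exP => e e0.
have eE : e = (Re e)%:C%C.
  by rewrite [LHS]complexE (ger0_Im (ltW e0)) mulr0 addr0.
have e0' : 0 < Re e by rewrite -ltcR -eE.
have [N _ sN] := (cvgrPdist_lt (F := \oo) s (limn s)).1 cs _ e0'.
exists (u N), N => // k /= Nk; rewrite -ball_normE/= distrC.
rewrite (le_lt_trans (us _ _ Nk))// eE ltcR.
rewrite (le_lt_trans _ (sN N _))//=.
have sk := nondecreasing_cvgn_le ns cs k.
by rewrite ger0_norm ?lerD2r// subr_ge0 (le_trans (ns _ _ Nk)).
Qed.

Lemma dot_CauchySchwarz (U : lmodType C) (f : {dot U for (@Num.conj C)}) x y :
  `|f x y| ^+ 2 <= f x x * f y y.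
Proof.
have [->|y0] := eqVneq y 0.
  by rewrite !linear0r normr0 expr0n mulr0.
have fy : 0 < f y y by rewrite dnorm_gt0.
have := dnorm_ge0 f (f y y *: x - f x y *: y).
rewrite dnormB !dnormZ linearZl_LR linearZr_LR/=.
have fyr : (f y y)^* = f y y by rewrite geC0_conj// ltW.
have -> : `|f y y| ^+ 2 = f y y * f y y by rewrite normCK fyr.
rewrite !rmorphM/= conjCK !fyr !normCK.
set a := f x y; set b := f y y; set c := f x x.
have -> : b * b * c + a * a^* * b - (b * (a^* * a) + b * (a * a^*)) =
  b * (c * b - a * a^*) by ring.
by rewrite pmulr_rge0// subr_ge0.
Qed.

Lemma dot_triangle (U : lmodType C) (f : {dot U for (@Num.conj C)}) x y :
  sqrtC (f (x + y) (x + y)) <= sqrtC (f x x) + sqrtC (f y y).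
Proof.
have ge0 z : 0 <= sqrtC (f z z) by rewrite sqrtC_ge0 dnorm_ge0.
rewrite -(@ler_pXn2r _ 2)// ?nnegrE ?addr_ge0// sqrtCK sqrrD !sqrtCK.
rewrite dnormD [leRHS]addrAC lerD2l.
have le1 : `|f x y| <= sqrtC (f x x) * sqrtC (f y y).
  rewrite -(@ler_pXn2r _ 2)// ?nnegrE ?mulr_ge0// exprMn !sqrtCK.
  exact: dot_CauchySchwarz.
rewrite (@le_trans _ _ (`|f x y| + `|f x y|))//; last first.
  by rewrite mulr2n lerD.
have -> : f x y + (f x y)^* = (Re (f x y))%:C%C + (Re (f x y))%:C%C.
  by case: (f x y) => a b; apply/eqP; rewrite eq_complex/= subrr addr0 !eqxx.
have h : (Re (f x y))%:C%C <= `|f x y|.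
  by rewrite (le_trans _ (Re_norm_le _))// normc_real lecR ler_norm.
exact: lerD.
Qed.

End complex_limits.

Section ell2.
Variables (R : realType) (n : nat) (K : hilbertType R).
Local Notation C := (R[i]).
Implicit Types f g h : word n -> K.

Definition sqnorm_sums f (N : nat) : R :=
  series (homsum (fun w => (Re `|f w|) ^+ 2)) N.

Definition square_summable : pred (word n -> K) := fun f =>
  `[< exists M : R, forall N, sqnorm_sums f N <= M >].

Lemma sqnorm_sumsE f N :
  (sqnorm_sums f N)%:C%C = series (homsum (fun w => hdot (f w) (f w))) N.
Proof.
rewrite /sqnorm_sums /series/= realC_sum; apply: eq_bigr => k _.
rewrite /homsum realC_sum; apply: eq_bigr => w _.
by rewrite hdot_norm [in RHS]normcE realCX.
Qed.

Lemma sqnorm_sums_nd f : nondecreasing_seq (sqnorm_sums f).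
Proof.
apply/nondecreasing_seqP => N; rewrite /sqnorm_sums /series/= big_nat_recr//= lerDl; apply: sumr_ge0 => w _; exact: sqr_ge0.
Qed.

Lemma hdot_CauchySchwarz (x y : K) : `|hdot x y| <= `|x| * `|y|.
Proof.
rewrite -(@ler_pXn2r _ 2)// ?nnegrE ?mulr_ge0 ?normr_ge0// exprMn.
by have := dot_CauchySchwarz hdot x y; rewrite !(hdot_norm x, hdot_norm y).
Qed.

Lemma sqnormD_le (a : C) (x y : K) :
  (Re `|a *: x + y|) ^+ 2 <=
  2 * (Re `|a|) ^+ 2 * (Re `|x|) ^+ 2 + 2 * (Re `|y|) ^+ 2.
Proof.
have : Re `|a *: x + y| <= Re `|a| * Re `|x| + Re `|y|.
  rewrite -lecR realCD realCM -!normcE (le_trans (ler_normD _ _))//.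
  by rewrite normrZ.
have := Re_norm_ge0 (a *: x + y); have := Re_norm_ge0 a.
have := Re_norm_ge0 x; have := Re_norm_ge0 y.
move: (Re `|a *: x + y|) (Re `|a|) (Re `|x|) (Re `|y|) => s t p q.
move=> q0 p0 t0 s0 sle.
have : s ^+ 2 <= (t * p + q) ^+ 2.
  by rewrite ler_pXn2r// nnegrE// addr_ge0// mulr_ge0.
by have := sqr_ge0 (t * p - q); nra.
Qed.

Lemma square_summable_submod : submod_closed square_summable.
Proof.
split.
  apply/asboolP; exists 0 => N; rewrite /sqnorm_sums /series/= big1// => k _.
  by rewrite /homsum big1// => w _; rewrite normr0/= expr0n.
move=> a f g /asboolP[M fM] /asboolP[L gL]; apply/asboolP.
exists (2 * (Re `|a|) ^+ 2 * M + 2 * L) => N.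
have fgN : sqnorm_sums (a *: f + g) N <=
    2 * (Re `|a|) ^+ 2 * sqnorm_sums f N + 2 * sqnorm_sums g N.
  rewrite /sqnorm_sums /series/= !mulr_sumr -big_split/=; apply: ler_sum => k _.
  rewrite /homsum !mulr_sumr -big_split/=; apply: ler_sum => w _.
  exact: sqnormD_le.
rewrite (le_trans fgN)// lerD// ler_wpM2l//.
by rewrite mulr_ge0// sqr_ge0.
Qed.

HB.instance Definition _ := GRing.isSubmodClosed.Build C (word n -> K)
  square_summable square_summable_submod.

(* The Hilbert direct sum of copies of K indexed by the words; sums over words
   are taken along the length. *)
Record ell2 := Ell2 {
  ell2_fun :> word n -> K ; ell2P : ell2_fun \in square_summable }.

HB.instance Definition _ := [isSub for ell2_fun].
HB.instance Definition _ := [Choice of ell2 by <:].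
HB.instance Definition _ := [SubChoice_isSubLmodule of ell2 by <:].

Implicit Types u v : ell2.

Lemma ell2_ext u v : (forall w, u w = v w) -> u = v.
Proof. by move=> uv; apply/val_inj/funext. Qed.

Lemma ell2D u v w : (u + v) w = u w + v w. Proof. by []. Qed.
Lemma ell2B u v w : (u - v) w = u w - v w. Proof. by []. Qed.
Lemma ell2Z a u w : (a *: u) w = a *: u w. Proof. by []. Qed.

Lemma sqnorm_sums_cvg u : cvgn (sqnorm_sums u).
Proof.
have /asboolP[M uM] := ell2P u.
apply: nondecreasing_is_cvgn (sqnorm_sums_nd _) _.
by exists M => _ [N _ <-].
Qed.

Definition ell2_dot u v : C :=
  limn (series (homsum (fun w => hdot (u w) (v w)))).

Lemma ell2_dot_cvg u v : cvgn (series (homsum (fun w => hdot (u w) (v w)))).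
Proof.
pose s N := sqnorm_sums u N + sqnorm_sums v N.
have sn : nondecreasing_seq s.
  by move=> j k jk; rewrite lerD//; apply: sqnorm_sums_nd.
apply: (@cvgC_dominated _ _ s) => //.
  by apply: is_cvgD; exact: sqnorm_sums_cvg.
move=> j k jk; rewrite sub_series_geq// /s.
rewrite opprD addrACA /sqnorm_sums !sub_series_geq//.
rewrite -big_split/= realC_sum (le_trans (ler_norm_sum _ _ _))//.
apply: ler_sum => i _; rewrite /homsum -big_split/= realC_sum.
rewrite (le_trans (ler_norm_sum _ _ _))//; apply: ler_sum => w _.
rewrite realCD !realCX -!normcE.
rewrite (le_trans (hdot_CauchySchwarz _ _))//.
rewrite (normcE (u w)) (normcE (v w)) -realCM -!realCX -realCD lecR.
move: (Re `|u w|) (Re `|v w|) => p q.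
by have := sqr_ge0 (p - q); have := sqr_ge0 (p + q); nra.
Qed.

Lemma ell2_dot_limE u v l :
  series (homsum (fun w => hdot (u w) (v w))) @ \oo --> (l : C) -> ell2_dot u v = l.
Proof. by apply: cvg_lim; exact: norm_hausdorff. Qed.

Lemma ell2_dotP u v :
  series (homsum (fun w => hdot (u w) (v w))) @ \oo --> ell2_dot u v.
Proof. exact: ell2_dot_cvg. Qed.

Lemma ell2_dotE u : ell2_dot u u = (limn (sqnorm_sums u))%:C%C.
Proof.
apply: ell2_dot_limE.
rewrite (_ : series _ = fun N => (sqnorm_sums u N)%:C%C); last first.
  by apply/funext => N; rewrite sqnorm_sumsE.
by apply: cvg_realC; exact: sqnorm_sums_cvg.
Qed.

Let dot_linl v : GRing.linear_for *%R (ell2_dot^~ v).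
Proof.
move=> a u1 u2; apply: ell2_dot_limE.
rewrite (_ : series _ = fun N =>
  a * series (homsum (fun w => hdot (u1 w) (v w))) N +
  series (homsum (fun w => hdot (u2 w) (v w))) N); last first.
  apply/funext => N; rewrite /series/= mulr_sumr -big_split/=.
  apply: eq_bigr => k _; rewrite /homsum mulr_sumr -big_split/=.
  by apply: eq_bigr => w _; rewrite linearDl linearZl_LR.
apply: cvgD; last exact: ell2_dotP.
by apply: cvgMl_tmp; exact: ell2_dotP.
Qed.

Let dot_conj u v : ell2_dot u v = (ell2_dot v u)^*.
Proof.
apply: ell2_dot_limE.
rewrite (_ : series _ = fun N =>
  (series (homsum (fun w => hdot (v w) (u w))) N)^*); last first.
  apply/funext => N; rewrite /series/= rmorph_sum.
  apply: eq_bigr => k _; rewrite /homsum rmorph_sum.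
  by apply: eq_bigr => w _; rewrite [LHS]hermC/= expr0 mul1r.
by apply: cvg_conj; exact: ell2_dotP.
Qed.

Let dot_bilinear : bilinear_for
  (GRing.Scale.Law.clone _ _ ( *%R ) _) (GRing.Scale.Law.clone _ _ (Num.conj \; *%R) _)
  ell2_dot.
Proof.
split=> [v|u]; first exact: dot_linl.
move=> a v1 v2; rewrite dot_conj dot_linl rmorphD rmorphM/=.
by rewrite -!dot_conj.
Qed.

HB.instance Definition _ :=
  bilinear_isBilinear.Build C ell2 ell2 _ _ _ ell2_dot dot_bilinear.

Let dot_herm u v : ell2_dot u v = (-1) ^+ false * (ell2_dot v u)^*.
Proof. by rewrite expr0 mul1r. Qed.

HB.instance Definition _ :=
  isHermitianSesquilinear.Build C ell2 _ _ ell2_dot dot_herm.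

Lemma sqnorm_sums_le u N : sqnorm_sums u N <= limn (sqnorm_sums u).
Proof.
by apply: nondecreasing_cvgn_le; [exact: sqnorm_sums_nd|exact: sqnorm_sums_cvg].
Qed.

Lemma ell2_coord_le u w : `|u w| ^+ 2 <= ell2_dot u u.
Proof.
rewrite ell2_dotE normcE -realCX lecR.
rewrite (le_trans _ (sqnorm_sums_le u (size w).+1))//.
rewrite /sqnorm_sums /series/= big_nat_recr//=.
rewrite {2}/homsum.
rewrite (bigD1 (in_tuple w))//= addrCA lerDl addr_ge0//.
  by apply: sumr_ge0 => k _; apply: sumr_ge0 => ? _; exact: sqr_ge0.
by apply: sumr_ge0 => ? _; exact: sqr_ge0.
Qed.

Let dot_pos u : u != 0 -> 0 < ell2_dot u u.
Proof.
move=> u0; have [w uw] : exists w, u w != 0.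
  apply: contrapT => /forallNP u0'; move/eqP : u0; apply.
  by apply: ell2_ext => w; apply/eqP/negP => /negP; exact: u0'.
by rewrite (lt_le_trans _ (ell2_coord_le u w))// exprn_gt0// normr_gt0.
Qed.

HB.instance Definition _ := isDotProduct.Build C ell2 ell2_dot dot_pos.

Let norm u : C := sqrtC (ell2_dot u u).

Let normD u v : norm (u + v) <= norm u + norm v.
Proof. exact: dot_triangle. Qed.

Let normZ (a : C) u : norm (a *: u) = `|a| * norm u.
Proof.
rewrite /norm dnormZ sqrtCM ?nnegrE ?exprn_ge0 ?dnorm_ge0//.
by rewrite -[X in _ = X * _]sqrCK.
Qed.

Let norm0_eq0 u : norm u = 0 -> u = 0.
Proof. by move=> /eqP; rewrite sqrtC_eq0 dnorm_eq0 => /eqP. Qed.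

HB.instance Definition _ := Lmodule_isNormed.Build C ell2 normD normZ norm0_eq0.

Lemma ell2_dot_norm u : ell2_dot u u = `|u| ^+ 2.
Proof. by rewrite -[`|u|]/(sqrtC _) sqrtCK. Qed.

End ell2.

Section ell2_complete.
Variables (R : realType) (n : nat) (K : hilbertType R).
Local Notation C := (R[i]).
Local Notation ell2 := (ell2 n K).

Lemma ell2_norm_sums (u : ell2) : (Re `|u|) ^+ 2 = limn (sqnorm_sums u).
Proof.
by apply: complexI; rewrite /= realCX -normcE -ell2_dot_norm ell2_dotE.
Qed.

Lemma sqnorm_sums_norm (u : ell2) N : sqnorm_sums u N <= (Re `|u|) ^+ 2.
Proof. by rewrite ell2_norm_sums; exact: sqnorm_sums_le. Qed.

Lemma norm_sqnorm_sums (u : ell2) e : 0 <= e ->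
  (forall N, sqnorm_sums u N <= e ^+ 2) -> Re `|u| <= e.
Proof.
move=> e0 ue; rewrite -(@ler_pXn2r _ 2)// ?nnegrE ?Re_norm_ge0//.
rewrite ell2_norm_sums; apply: limr_le; first exact: sqnorm_sums_cvg.
by apply: nearW => N; exact: ue.
Qed.

Lemma sqnorm_sumsB (f g h : word n -> K) N :
  sqnorm_sums (f - g) N <= 2 * sqnorm_sums (f - h) N + 2 * sqnorm_sums (h - g) N.
Proof.
rewrite /sqnorm_sums /series/= !mulr_sumr -big_split/=; apply: ler_sum => k _.
rewrite /homsum !mulr_sumr -big_split/=; apply: ler_sum => w _.
have := @sqnormD_le _ _ 1 (f w - h w) (h w - g w).
rewrite scale1r normr1 expr1n mulr1.
by rewrite addrA subrK; apply.
Qed.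

Lemma sq_cvg0 T (F : set_system T) (FF : ProperFilter F) (q : T -> R) :
  (forall d : R, 0 < d -> F [set h | `|q h| < d]) ->
  (fun h => q h ^+ 2) @ F --> (0 : R).
Proof.
move=> qF; have q0 : q @ F --> (0 : R).
  apply/cvgrPdist_lt => d d0; apply: filterS (qF d d0) => h /=.
  by rewrite sub0r normrN.
have := cvgM q0 q0; rewrite mulr0; exact.
Qed.

Lemma ell2_is_complete (F : set_system ell2) :
  ProperFilter F -> cauchy F -> cvg F.
Proof.
move=> FF Fc.
have coord w : cvg ((fun u : ell2 => u w) @ F).
  apply: cauchy_cvg; apply: cauchy_exP => e e0.
  have /cauchyP/(_ _ e0)[z Fz] := Fc; exists (z w).
  rewrite -[_ (ball _ _)]/(F ((fun u : ell2 => u w) @^-1` (ball (z w) e))).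
  apply: filterS Fz => u; rewrite -!ball_normE/= => H1.
  rewrite -ell2B (le_lt_trans _ H1)//.
  rewrite -(@ler_pXn2r _ 2)// ?nnegrE ?normr_ge0// -ell2_dot_norm.
  exact: ell2_coord_le.
pose g w := lim ((fun u : ell2 => u w) @ F).
have tail N (e : R) : 0 < e ->
    \forall h \near F, sqnorm_sums (ell2_fun h - g) N <= e.
  move=> e0.
  have sq0 w : (fun h : ell2 => (Re `|h w - g w|) ^+ 2) @ F --> (0 : R).
    apply: sq_cvg0 => d d0; have d0' : 0 < d%:C%C :> C by rewrite ltcR.
    have hh : F [set h : ell2 | `|g w - h w| < d%:C%C].
      exact: ((cvgrPdist_lt (F := F) (fun u : ell2 => u w) (g w)).1 (coord w) _ d0').
    apply: (@filterS _ F _ _ _ _ hh) => h /=; rewrite distrC normcE ltcR.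
    by rewrite ger0_norm// Re_norm_ge0.
  have : (fun h : ell2 => sqnorm_sums (ell2_fun h - g) N) @ F --> (0 : R).
    rewrite (_ : 0 = \sum_(0 <= k < N) \sum_(w : k.-tuple 'I_n) (0 : R)); last first.
      by rewrite big1// => k _; rewrite big1.
    rewrite /sqnorm_sums /series /homsum/=.
    apply: cvg_big => [|k _]; first exact: add_continuous.
    apply: cvg_big => [|w _]; first exact: add_continuous.
    exact: sq0.
  move=> /cvgrPdist_lt/(_ _ e0); apply: filterS => h.
  by rewrite sub0r normrN => /ltW; apply: le_trans; exact: ler_norm.
have close (e : R) : 0 < e -> exists z : ell2,
    \forall u \near F, forall N, sqnorm_sums (ell2_fun u - g) N <= e ^+ 2.
  move=> e0.
  have e4 : 0 < (e / 4)%:C%C :> C by rewrite ltcR divr_gt0.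
  have /cauchyP/(_ _ e4)[z Fz] := Fc; exists z.
  apply: filterS (Fz) => u zu N.
  have e20 : 0 < e ^+ 2 / 4 by rewrite divr_gt0// exprn_gt0.
  near F => h.
  rewrite (le_trans (sqnorm_sumsB _ _ (ell2_fun h) _))//.
  have hg : sqnorm_sums (ell2_fun h - g) N <= e ^+ 2 / 4.
    by near: h; exact: tail.
  have zh : ball z (e / 4)%:C%C h by near: h.
  have uh : Re `|u - h| <= e / 2.
    move: zu zh; rewrite -!ball_normE/= => zu zh.
    rewrite -lecR -normcE -(subrK z u) -addrA (le_trans (ler_normD _ _))//.
    have -> : (e / 2)%:C%C = (e / 4)%:C%C + (e / 4)%:C%C :> C.
      by rewrite -realCD; congr (_%:C%C); field.
    by rewrite lerD// ltW// distrC.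
  have uhN : sqnorm_sums (ell2_fun u - ell2_fun h) N <= (e / 2) ^+ 2.
    rewrite (le_trans (sqnorm_sums_norm (u - h) N))//.
    by rewrite ler_pXn2r// ?nnegrE ?Re_norm_ge0// divr_ge0// ltW.
  by nra.
have gP : g \in square_summable (K := K).
  have [z zP] := close 1 ltr01.
  near F => u.
  have uP : forall N, sqnorm_sums (ell2_fun u - g) N <= 1 ^+ 2 by near: u.
  have /asboolP[M uM] := ell2P u.
  apply/asboolP; exists (2 * M + 2) => N.
  have := sqnorm_sumsB g 0 (ell2_fun u) N; rewrite !subr0.
  have -> : sqnorm_sums (g - ell2_fun u) N = sqnorm_sums (ell2_fun u - g) N.
    rewrite /sqnorm_sums /series/=; apply: eq_bigr => k _.
    by apply: eq_bigr => w _; congr (Re _ ^+ 2); exact: distrC.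
  move=> /le_trans; apply; rewrite addrC lerD// ?ler_wpM2l//.
  by have := uP N; rewrite expr1n; lra.
apply/cvg_ex; exists (Ell2 gP).
apply/cvgrPdist_le => e e0.
have e0' : 0 < Re e by rewrite -ltcR -ge0_realC// ltW.
have [z zP] := close _ e0'.
apply: filterS zP => u uP.
rewrite distrC (ge0_realC (ltW e0)) normcE lecR.
by apply: norm_sqnorm_sums; first exact: ltW.
Unshelve. all: by end_near. Qed.

HB.instance Definition _ := Uniform_isComplete.Build ell2 ell2_is_complete.

HB.instance Definition _ := CompleteNormedModule_isHilbert.Build R ell2 (@ell2_dot_norm R n K).

End ell2_complete.

Section fock_space.
Variables (R : realType) (n : nat).
Local Notation C := (R[i]).

Lemma homsum_single (V : nmodType) (F : word n -> V) w k :
  (forall x, x != w -> F x = 0) ->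
  homsum F k = if k == size w then F w else 0.
Proof.
move=> F0; rewrite /homsum; case: eqVneq => [->|kw].
  rewrite (bigD1 (in_tuple w))//= big1 ?addr0// => x xw.
  by apply: F0; apply: contra_neq xw => xw; exact/val_inj.
rewrite big1// => x _; apply: F0; apply: contra_neq kw => <-.
by rewrite size_tuple.
Qed.

Lemma series_homsum_single (V : zmodType) (F : word n -> V) w N :
  (forall x, x != w -> F x = 0) ->
  series (homsum F) N = if (size w < N)%N then F w else 0.
Proof.
move=> F0; rewrite /series/=.
under eq_bigr do rewrite (homsum_single _ F0).
rewrite big_mkord; case: ltnP => wN.
  rewrite (bigD1 (Ordinal wN))//= eqxx big1 ?addr0// => i.
  by rewrite -val_eqE/= => /negbTE ->.
rewrite big1// => i _; case: eqVneq => // iw.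
by have := ltn_ord i; rewrite iw ltnNge wN.
Qed.

Section single.
Variable K : hilbertType R.

Let single_summable w (x : K) :
  (fun v : word n => if v == w then x else 0) \in square_summable (K := K).
Proof.
apply/asboolP; exists ((Re `|x|) ^+ 2) => N.
rewrite /sqnorm_sums (@series_homsum_single _ _ w).
  by rewrite eqxx; case: ifP => // _; exact: sqr_ge0.
by move=> v /negbTE ->; rewrite normr0/= expr0n.
Qed.

Definition single w x := Ell2 (single_summable w x).

Lemma hdot_single w x (u : ell2 n K) : hdot (single w x) u = hdot x (u w).
Proof.
apply: ell2_dot_limE.
apply: cvg_near_cst; exists (size w).+1 => // N /= wN.
rewrite (@series_homsum_single _ _ w) ?wN ?eqxx//.
by move=> v /negbTE ->; rewrite linear0l.
Qed.

End single.

Definition fock : hilbertType R := ell2 n C.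

Definition evec (w : word n) : fock := single w (1 : C).

Variable H : hilbertType R.

(* The Hilbert tensor product of the Fock space with H, realized as the sum of
   copies of H, e_w (x) h being h placed at w; hdot_tensv and tensv_total are its
   characteristic properties. *)
Definition fockT : hilbertType R := ell2 n H.

Let tens_summable (f : fock) (h : H) :
  (fun w : word n => (f : ell2 n C) w *: h) \in square_summable (K := H).
Proof.
have /asboolP[M fM] := ell2P (f : ell2 n C); apply/asboolP.
exists (M * (Re `|h|) ^+ 2) => N.
rewrite (_ : sqnorm_sums _ N = sqnorm_sums (ell2_fun f) N * (Re `|h|) ^+ 2).
  by rewrite ler_wpM2r// sqr_ge0.
rewrite /sqnorm_sums /series/= mulr_suml; apply: eq_bigr => k _.
rewrite /homsum mulr_suml; apply: eq_bigr => w _; rewrite -exprMn.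
by congr (_ ^+ 2); apply: complexI; rewrite /= realCM -!normcE normrZ.
Qed.

Definition tensv (f : fock) (h : H) : fockT := Ell2 (tens_summable f h).

Lemma hdot_tensv f g h k :
  hdot (tensv f h) (tensv g k) = hdot f g * hdot h k.
Proof.
apply: ell2_dot_limE.
rewrite (_ : series _ = fun N =>
  series (homsum (fun w => hdot (ell2_fun f w) (ell2_fun g w))) N * hdot h k).
  by apply: cvgMr_tmp; exact: ell2_dotP.
apply/funext => N; rewrite /series/= mulr_suml; apply: eq_bigr => j _.
rewrite /homsum mulr_suml; apply: eq_bigr => w _.
by rewrite /= linearZl_LR linearZr_LR/= mulrA.
Qed.

Lemma tensv_total (u : fockT) :
  (forall f h, hdot (tensv f h) u = 0) -> u = 0.
Proof.
move=> u0; apply: ell2_ext => w; apply/eqP.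
have := u0 (evec w) (ell2_fun u w).
have -> : tensv (evec w) (ell2_fun u w) = single w (ell2_fun u w).
  apply: ell2_ext => v /=.
  by case: eqVneq => _; rewrite ?scale1r ?scale0r.
by rewrite hdot_single => /eqP; rewrite dnorm_eq0.
Qed.

(* The bounded operator A (x) B, determined by its values on elementary tensors. *)
Definition tensop (A : bop fock) (B : bop H) : bop fockT :=
  xget 0 [set T : bop fockT |
    forall f h, T (tensv f h) = tensv (A f) (B h)].

End fock_space.

Section noncommutative_domains.
Variables (R : realType) (n : nat).
Local Notation C := (R[i]).

Record ncpoly := NCPoly {
  nccoef :> word n -> C ;
  _ : finite_set [set w | nccoef w != 0] }.

Definition positive_regular (p : ncpoly) : Prop :=
  [/\ forall w, 0 <= p w, p [::] = 0 & forall i, 0 < p [:: i]].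

(* The coefficient b^(m)_w; the inner sum ranges over the factorizations of w
   into j nonempty words. *)
Definition bcoef (p : ncpoly) (m : nat) (w : word n) : C :=
  if w is [::] then 1 else
  \sum_(1 <= j < (size w).+1)
    \sum_(g \in [set g : j.-tuple (word n) |
                  flatten g = w /\ all (fun v => 0 < size v)%N g])
      (\prod_(v <- g) p v) * 'C(j + m - 1, m - 1)%:R.

Definition wprod (H : hilbertType R) (Y : 'I_n -> 'B(H)) (w : word n) : 'B(H) :=
  \prod_(i <- w) Y i.

Definition Phi (p : ncpoly) (H : hilbertType R) (Y : 'I_n -> 'B(H))
    (D : 'B(H)) : 'B(H) :=
  \sum_(w \in [set: word n]) p w *: (wprod Y w * D * adjop (wprod Y w)).

Definition ncdomain (p : ncpoly) (m : nat) (H : hilbertType R) :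
    set ('I_n -> 'B(H)) :=
  [set Y | forall k, (1 <= k <= m)%N ->
     psdop (iter k (fun D => D - Phi p Y D) 1)].

Definition ncdomain_rad (p : ncpoly) (m : nat) (H : hilbertType R) :
    set ('I_n -> 'B(H)) :=
  [set Y | exists t : R, 0 <= t < 1 /\
     exists2 Z, ncdomain p m Z & Y = fun i => t%:C%C *: Z i].

(* The weighted creation operators are bounded when p is positive regular, and
   they are determined by their values on the orthonormal basis. *)
Definition left_creation (p : ncpoly) (m : nat) (i : 'I_n) : 'B(fock R n) :=
  xget 0 [set T : 'B(fock R n) | forall w, T (evec R w) =
    sqrtC (bcoef p m w / bcoef p m (i :: w)) *: evec R (i :: w)].

Definition right_creation (p : ncpoly) (m : nat) (i : 'I_n) : 'B(fock R n) :=
  xget 0 [set T : 'B(fock R n) | forall w, T (evec R w) =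
    sqrtC (bcoef p m w / bcoef p m (rcons w i)) *: evec R (rcons w i)].

Definition reconstruction (p : ncpoly) (m : nat) (H : hilbertType R)
    (X : 'I_n -> 'B(H)) : 'B(fockT n H) :=
  \sum_(w \in [set w : word n | (1 <= size w)%N])
    p (rev w) *: tensop (wprod (right_creation p m) w)
                        (adjop (wprod X (rev w))).

Definition fps := word n -> C.

Definition fps_one : fps := fun w => (w == [::])%:R.
Definition fps_var (i : 'I_n) : fps := fun w => (w == [:: i])%:R.
Definition fps_mul (F G : fps) : fps :=
  fun w => \sum_(0 <= k < (size w).+1) F (take k w) * G (drop k w).

Definition hol_sums (H : hilbertType R) (c : fps) (Y : 'I_n -> 'B(H)) :
    nat -> 'B(H) :=
  fun N => \sum_(0 <= k < N) homsum (fun w => c w *: wprod Y w) k.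

Definition antihol_sums (H : hilbertType R) (d : fps) (Y : 'I_n -> 'B(H)) :
    nat -> 'B(H) :=
  fun N => \sum_(1 <= k < N) homsum (fun w => d w *: adjop (wprod Y w)) k.

Definition Hol (p : ncpoly) (m : nat) : set fps :=
  [set c | forall (K : hilbertType R) (Y : 'I_n -> 'B(K)),
     ncdomain_rad p m Y -> cvgn (hol_sums c Y)].

(* The formal series sum_{|w| >= 1} d_w Z_w^* + sum_w c_w Z_w is the pair
   (d, c); d_1 = 0 makes this representation unique. *)
Definition Har (p : ncpoly) (m : nat) : set (fps * fps) :=
  [set G | G.1 [::] = 0 /\
     forall (K : hilbertType R) (Y : 'I_n -> 'B(K)), ncdomain_rad p m Y ->
       cvgn (antihol_sums G.1 Y) /\ cvgn (hol_sums G.2 Y)].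

Definition hol_har (c : fps) : fps * fps := (0, c).

Definition har_eval (H : hilbertType R) (Y : 'I_n -> 'B(H)) (G : fps * fps) :
    'B(H) :=
  limn (antihol_sums G.1 Y) + limn (hol_sums G.2 Y).

Definition har_dist (p : ncpoly) (m : nat) (r : R) (F G : fps * fps) : R :=
  let rW i := r%:C%C *: left_creation p m i in
  opnorm (har_eval rW F - har_eval rW G).

(* r k stands for r_{k+1}. *)
Definition har_metric (p : ncpoly) (m : nat) (r : nat -> R)
    (F G : fps * fps) : R :=
  limn (series (fun k => 2 ^- k.+1 *
    (har_dist p m (r k) F G / (1 + har_dist p m (r k) F G)))).

Definition norm_continuous_on (T : Type) (A : set T) (dist : T -> T -> R)
    (H : hilbertType R) (f : T -> 'B(H)) : Prop :=
  forall F, A F -> forall e : R, 0 < e -> exists2 d : R, 0 < d &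
    forall G, A G -> dist F G < d -> opnorm (f F - f G) < e.

Definition unital_alg_hom_on (A : set fps) (H : hilbertType R)
    (f : fps -> 'B(H)) : Prop :=
  [/\ f fps_one = 1,
      forall a F G, A F -> A G -> f (a *: F + G) = a *: f F + f G &
      forall F G, A F -> A G -> f (fps_mul F G) = f F * f G].

End noncommutative_domains.

(* Main.v *)
Require Import Defs.
From HB Require Import structures.
From mathcomp Require Import all_boot all_order all_algebra.
From mathcomp Require Import complex.
From mathcomp Require Import boolp classical_sets functions cardinality fsbigop reals.
From mathcomp Require Import topology normedtype sequences.
From mathcomp Require Import ring lra.

Set Implicit Arguments.
Unset Strict Implicit.
Unset Printing Implicit Defensive.

Import Order.TTheory GRing.Theory Num.Theory.
Import numFieldNormedType.Exports.

Local Open Scope classical_set_scope.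
Local Open Scope ring_scope.

(* The spectral radius enters only through the invertibility of [1 - R_X],
   where [R_X] is the reconstruction operator. As invertibility is open, [1 -
   R_{X/t}] is still invertible for [t = r k] close to 1. The reconstruction
   operator raises the length of words, so the equation [(1 - R_{X/t})^m u = 1
   (x) h] determines [u] coordinate by coordinate: [u = sum_w sqrt b_w e_w (x)
   t^-|w| X_w^* h]. As [u] lies in the Fock space, [sum_w b_w t^-2|w| |X_w^*
   h|^2 <= M^2 |h|^2], and by Cauchy-Schwarz [|sum_w c_w X_w| <= M (sum_w
   |c_w|^2 t^2|w| / b_w)^(1/2)], the last factor being the norm of the vector
   [F(tW) e_1]. For [G = (d, c)], the vectors [G(tW) e_1] and [G(tW)^* e_1]
   recover [c] and [d], whence [|G(X)| <= 2 M |G(tW)|]: this gives convergence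
   and continuity. Multiplicativity and uniqueness follow from the case of
   polynomials, as truncations converge to [F] on every [r k W]. *)

(** Adjoints, tensor products and creation operators are defined by choice with default [0], so each
    becomes usable only once existence is proved. Riesz' theorem provides the adjoints; a norm bound
    for weighted partial shifts provides the rest, their weights being controlled by
    [b_(i w) >= a_i b_w], where [a_i > 0] by positive regularity. The power [m] in the resolvent
    equation is dictated by the weights: [b^(m)] is the coefficient family of [(1 - p)^-m]. The
    recursion [(1 - p)^-(m+1) = (1 - p)^-m + p (1 - p)^-(m+1)] serves twice. With the factor [p] on
    the right it solves the resolvent equation; with [p] on the left it shows that [W] lies in the
    domain, which is what permits a series of [Har] to be evaluated at [tW] in the first place. The
    index [k] chosen near the limit depends on [X] alone, so a single seminorm [d_(r k)] dominates
    evaluation at [X]. This is why continuity for the whole metric follows from one of its terms,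
    whereas density of the polynomials involves all radii. *)

Local Notation Re := complex.Re.

(** * Real-valued norms *)

(* The norm of a normed module over [R[i]] is complex-valued; [nr] is the same norm
   with values in [R]. *)
Definition nr (R : realType) (V : normedModType R[i]) (x : V) : R := Re `|x|.
Arguments nr : simpl never.

Section real_norm.
Variables (R : realType) (V : normedModType R[i]).
Implicit Types (x y : V) (u : nat -> V).

Lemma nrE x : `|x| = (nr x)%:C%C. Proof. by rewrite [LHS]Defs.normcE. Qed.

Lemma nr_ge0 x : 0 <= nr x. Proof. exact: Re_norm_ge0. Qed.

Lemma le_nr x (y : R) : (`|x| <= y%:C%C) = (nr x <= y).
Proof. by rewrite nrE lecR. Qed.

Lemma lt_nr x (y : R) : (`|x| < y%:C%C) = (nr x < y).
Proof. by rewrite nrE ltcR. Qed.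

Lemma nrD x y : nr (x + y) <= nr x + nr y.
Proof. by rewrite -le_nr realCD -!nrE ler_normD. Qed.

Lemma nrN x : nr (- x) = nr x. Proof. by rewrite /nr normrN. Qed.

Lemma nrBC x y : nr (x - y) = nr (y - x).
Proof. by rewrite -nrN opprB. Qed.

Lemma nr0 : nr (0 : V) = 0. Proof. by rewrite /nr normr0. Qed.

Lemma nr_eq0 x : nr x = 0 -> x = 0.
Proof. by move=> x0; apply/normr0_eq0; rewrite nrE x0. Qed.

Lemma nrZ (a : R[i]) x : nr (a *: x) = Re `|a| * nr x.
Proof. by apply: complexI; rewrite [RHS]realCM -!nrE -Defs.normcE normrZ. Qed.

Lemma nr_triangle z x y : nr (x - y) <= nr (x - z) + nr (z - y).
Proof. by rewrite -{1}(subrK z x) -addrA nrD. Qed.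

Lemma nr_sum (I : Type) (r : seq I) (P : pred I) (F : I -> V) :
  nr (\sum_(i <- r | P i) F i) <= \sum_(i <- r | P i) nr (F i).
Proof.
rewrite -le_nr realC_sum (le_trans (ler_norm_sum _ _ _))//.
by apply: ler_sum => i _; rewrite nrE.
Qed.

(** A positive element of [R[i]] is real, so quantifying over complex [e] amounts to quantifying
    over real ones. *)
Lemma cvg_nrP u (l : V) : u @ \oo --> l <->
  forall e : R, 0 < e -> exists N, forall k, (N <= k)%N -> nr (l - u k) < e.
Proof.
split=> [/cvgrPdist_lt ul e e0|ul].
  have e0' : 0 < e%:C%C :> R[i] by rewrite ltcR.
  have [N _ h] := ul _ e0'; exists N => k Nk.
  by rewrite -lt_nr; exact: h.
apply/cvgrPdist_lt => e e0.
have e0' : 0 < Re e by rewrite -ltcR -ge0_realC// ltW.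
have [N h] := ul _ e0'; exists N => // k /= Nk.
by rewrite (ge0_realC (ltW e0)) lt_nr h.
Qed.

Lemma cvg_nr_dominated u (l : V) (s : nat -> R) :
  (forall k, nr (l - u k) <= s k) -> s @ \oo --> (0 : R) -> u @ \oo --> l.
Proof.
move=> us /cvgrPdist_lt s0; apply/cvg_nrP => e /s0[N _ sN]; exists N => k Nk.
rewrite (le_lt_trans (us k))// (le_lt_trans _ (sN k Nk))// sub0r normrN.
exact: ler_norm.
Qed.

Lemma nr_dist_le x y : `|nr x - nr y| <= nr (x - y).
Proof.
rewrite ler_norml lerNl opprB !lerBlDr; apply/andP; split.
  by rewrite -{1}(subrK x y) (le_trans (nrD _ _))// nrBC.
by rewrite -{1}(subrK y x) nrD.
Qed.

Lemma cvg_nr u (l : V) : u @ \oo --> l -> (fun k => nr (u k)) @ \oo --> nr l.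
Proof.
move=> /cvg_nrP ul; apply/cvgrPdist_lt => e /ul[N h]; exists N => // k /= Nk.
by rewrite (le_lt_trans (nr_dist_le _ _)) ?h.
Qed.

Lemma nr_limn_le u (M : R) : cvgn u -> (forall k, nr (u k) <= M) -> nr (limn u) <= M.
Proof.
move=> cu uM; have /cvg_nr h := cu.
rewrite -(cvg_lim (@norm_hausdorff _ _) h).
apply: limr_le; first by apply/cvg_ex; exists (nr (limn u)).
exact: nearW.
Qed.

End real_norm.

Lemma cauchy_nr (R : realType) (V : completeNormedModType R[i]) (u : nat -> V) :
  (forall e : R, 0 < e -> exists N, forall k, (N <= k)%N -> nr (u k - u N) < e) ->
  cvgn u.
Proof.
move=> uc; apply: cauchy_cvg; apply: cauchy_exP => e e0.
have e0' : 0 < Re e by rewrite -ltcR -ge0_realC// ltW.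
have [N h] := uc _ e0'; exists (u N), N => // k /= Nk.
by rewrite -ball_normE/= distrC (ge0_realC (ltW e0)) lt_nr h.
Qed.

Section inner_product.
Variables (R : realType) (H : hilbertType R).
Implicit Types x y z : H.

Lemma hdot_nr x : hdot x x = (nr x ^+ 2)%:C%C.
Proof. by rewrite hdot_norm nrE realCX. Qed.

Lemma hdotC x y : hdot x y = (hdot y x)^*.
Proof. by rewrite [LHS]hermC/= expr0 mul1r. Qed.

Lemma hdot_le x y : Re `|hdot x y| <= nr x * nr y.
Proof. by rewrite -lecR -Defs.normcE realCM -!nrE hdot_CauchySchwarz. Qed.

Lemma hdot_eq x y : (forall z, hdot z x = hdot z y) -> x = y.
Proof.
move=> h; apply/subr0_eq/nr_eq0.
have : hdot (x - y) (x - y) = 0 by rewrite linearB/= h subrr.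
by rewrite hdot_nr => /complexI/eqP; rewrite sqrf_eq0 => /eqP.
Qed.

Lemma nr_sqrD x y : nr (x + y) ^+ 2 = nr x ^+ 2 + nr y ^+ 2 + 2 * Re (hdot x y).
Proof.
apply: complexI; rewrite /= -hdot_nr linearDl/= !linearD/=.
rewrite (hdotC y x) !hdot_nr !realCD.
rewrite addrACA addrA addrAC -!addrA; congr (_ + _).
rewrite addrC -addrA; congr (_ + _).
case: (hdot x y) => a b; apply/eqP; rewrite eq_complex /=.
by apply/andP; split; apply/eqP; ring.
Qed.

Lemma realC_conj (t : R) : (t%:C%C : R[i])^* = t%:C%C.
Proof. exact: conjc_real. Qed.

Lemma Re_conjc (z : R[i]) : Re z^* = Re z.
Proof. by case: z. Qed.

End inner_product.

(** * Riesz representation and adjoints *)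

Section riesz.
Variables (R : realType) (H : hilbertType R).
Implicit Types x y h : H.

Lemma small_inv (e : R) : 0 < e -> exists N, forall k, (N <= k)%N -> k.+1%:R^-1 < e.
Proof.
move=> e0; have /cvgrPdist_lt/(_ _ e0)[N _ h] := @cvg_harmonic R.
exists N => k /h; rewrite sub0r normrN; apply: le_lt_trans; exact: ler_norm.
Qed.

(** Direct method: the representing vector minimises [J x = |x|^2 - 2 Re (f x)], which is bounded
    below by [- M^2]. Minimising sequences are Cauchy by the parallelogram law, and the vanishing
    first variation gives equality of the real parts. *)
Lemma riesz_representation (f : H -> R[i]) (M : R) : linear_for *%R f ->
  (forall x, Re `|f x| <= M * nr x) -> exists y, forall x, f x = hdot x y.
Proof.
move=> lf fM.
have fD x y : f (x + y) = f x + f y by have := lf 1 x y; rewrite scale1r mul1r.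
have f0 : f 0 = 0 by have := lf (-1) 0 0; rewrite scaler0 addr0 mulN1r addNr.
have fZ a x : f (a *: x) = a * f x by have := lf a x 0; rewrite f0 !addr0.
have Ref (z : R[i]) : `|Re z| <= Re `|z|.
  by rewrite -lecR -normc_real -Defs.normcE Re_norm_le.
pose J x := nr x ^+ 2 - 2 * Re (f x).
have Jlb x : - M ^+ 2 <= J x.
  have h1 : Re (f x) <= M * nr x := le_trans (ler_norm _) (le_trans (Ref _) (fM x)).
  by have := sqr_ge0 (nr x - M); rewrite /J; move: (nr x) (Re _) h1 => p q; nra.
have hinf : has_inf (range J).
  by split; [exists (J 0), 0|exists (- M ^+ 2) => _ [x _ <-]].
pose mu := inf (range J).
have muJ x : mu <= J x by apply: (ge_inf hinf.2); exists x.
have /choice[u uP] : forall k : nat, exists x, J x < mu + k.+1%:R^-1.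
  move=> k; have k0 : 0 < k.+1%:R^-1 :> R by rewrite invr_gt0.
  by have [_ [x _ <-] h] := inf_adherent k0 hinf; exists x.
have RZ (t : R) (z : R[i]) : Re (t%:C%C * z) = t * Re z.
  by case: z => a b /=; rewrite mul0r subr0.
have cR (t : R) : Re `|t%:C%C : R[i]| = `|t| by rewrite normc_real.
(* The parallelogram law reads [|x - y|^2 = 2 J x + 2 J y - 4 J ((x + y) / 2)], and the midpoint has
   [J >= mu]. *)
have par x y : nr (x - y) ^+ 2 <= 2 * (J x - mu + (J y - mu)).
  have := muJ ((2^-1)%:C%C *: (x + y)).
  rewrite /J nrZ cR exprMn nr_sqrD fZ fD RZ raddfD/= real_normK ?num_real//.
  rewrite nr_sqrD nrN linearN raddfN/=.
  by move: (nr x ^+ 2) (nr y ^+ 2) (Re _) (Re _) (Re _) => p q s t r0; lra.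
have /cauchy_nr/cvg_ex[/= y /cvg_nrP uy] : forall e : R, 0 < e ->
    exists N, forall k, (N <= k)%N -> nr (u k - u N) < e.
  move=> e e0; have e20 : 0 < e ^+ 2 / 4 by rewrite divr_gt0// exprn_gt0.
  have [N NP] := small_inv e20; exists N => k Nk.
  rewrite -(@ltr_pXn2r _ 2)// ?nnegrE ?nr_ge0 ?(ltW e0)//.
  rewrite (le_lt_trans (par _ _))//.
  have := uP k; have := uP N; have := NP N (leqnn _); have := NP k Nk.
  move: (J _) (J _) (k.+1%:R^-1) (N.+1%:R^-1) => a b c d; lra.
exists y.
have ReE h : Re (f h) = Re (hdot h y).
  apply/eqP; rewrite -subr_eq0 -normr_le0; apply/ler_addgt0Pr => e e0; rewrite add0r.
  pose B := nr h ^+ 2 + 1.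
  have B0 : 0 < B by rewrite ltr_pwDr// sqr_ge0.
  have eB0 : 0 < e / (2 * B) by rewrite divr_gt0 ?mulr_gt0.
  have [N1 N1P] := uy _ eB0.
  have e2B : 0 < (e / 2) ^+ 2 / B by rewrite divr_gt0// exprn_gt0// divr_gt0.
  have [N2 N2P] := small_inv e2B.
  pose k := maxn N1 N2.
  have := N1P k (leq_maxl _ _); have := N2P k (leq_maxr _ _).
  have := uP k; move: (k.+1%:R^-1) => d ukd dB uyk.
  pose a := Re (hdot h (u k)) - Re (f h).
  have adot : Re (hdot (u k) h) = Re (hdot h (u k)).
    by rewrite hdotC Re_conjc.
  (* First variation: compare [u k] with [u k - (a / B) h]. As [J (u k) < mu + d], this step cannot
     lower [J] by [d] or more, but it lowers [J] by at least [a^2 / B]. The [1] in [B] keeps it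
     positive when [h = 0]. *)
  have aB : a ^+ 2 < B * d.
    have := muJ (u k + (- (a / B))%:C%C *: h).
    rewrite /J nr_sqrD nrZ cR exprMn real_normK ?num_real// fD fZ raddfD/= RZ.
    rewrite linearZr_LR/= realC_conj RZ adot.
    rewrite -[Re (hdot h (u k))](subrK (Re (f h))) -/a.
    move: ukd; rewrite /J; set P := nr (u k) ^+ 2; set Q := Re (f (u k)).
    set S := Re (f h) => h1 h2.
    have h3 : 0 < d + ((a / B) ^+ 2 * nr h ^+ 2 - 2 * (a / B) * a) by rewrite -sqrrN; lra.
    have h4 : (a / B) ^+ 2 * nr h ^+ 2 <= (a / B) * a.
      rewrite (_ : a / B * a = (a / B) ^+ 2 * B).
        by rewrite ler_wpM2l ?sqr_ge0// lerDl.
      by field; rewrite gt_eqF.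
    have h5 : a / B * a < d by lra.
    by rewrite -ltr_pdivrMl// mulrC expr2 mulrAC.
  have a2 : `|a| < e / 2.
    rewrite -(@ltr_pXn2r _ 2)// ?nnegrE ?normr_ge0 ?divr_ge0// ?(ltW e0)//.
    rewrite real_normK ?num_real// (lt_trans aB)// mulrC -ltr_pdivlMr//.
  have b2 : `|Re (hdot h (y - u k))| <= e / 2.
    rewrite (le_trans (Ref _))// (le_trans (hdot_le _ _))//.
    have hB : nr h <= B by have := sqr_ge0 (nr h - 1); rewrite /B; nra.
    rewrite (@le_trans _ _ (B * (e / (2 * B))))//.
      by apply: ler_pM; rewrite ?nr_ge0// ltW.
    by rewrite le_eqVlt (_ : B * _ = e / 2) ?eqxx//; field; rewrite gt_eqF.
  have -> : Re (f h) - Re (hdot h y) = - a - Re (hdot h (y - u k)).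
    by rewrite linearB raddfB/= /a; ring.
  by rewrite (le_trans (ler_normB _ _))// normrN [leRHS]splitr lerD// ltW.
(* The imaginary parts follow from the real ones, since [Re (i z) = - Im z]. *)
move=> x; have := ReE ('i%C *: x); rewrite fZ linearZl_LR/= => h2.
have := ReE x; move: h2; case: (f x) => a b; case: (hdot x y) => c d /=.
by rewrite !mul0r !mul1r !sub0r => /oppr_inj -> ->.
Qed.

End riesz.

Section adjoint.
Variables (R : realType) (H : hilbertType R).
Implicit Types (x y : H) (S T : 'B(H)).

Lemma nr_bop T : nr T = opnorm T. Proof. by []. Qed.

Lemma nr_bop_le T x : nr (T x) <= nr T * nr x.
Proof. by rewrite -lecR realCM -!nrE le_opnorm. Qed.

Lemma nr_bop_ub T (M : R) : 0 <= M -> (forall x, nr (T x) <= M * nr x) -> nr T <= M.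
Proof.
move=> M0 TM; apply: opnorm_le => x x1; rewrite (le_trans (TM x))//.
by rewrite ler_piMr// -(lecR (nr x) 1) -nrE.
Qed.

Lemma nr_bopM S T : nr (S * T) <= nr S * nr T.
Proof.
apply: nr_bop_ub => [|x]; first by rewrite mulr_ge0 ?nr_ge0.
by rewrite bopM (le_trans (nr_bop_le _ _))// -mulrA ler_wpM2l ?nr_ge0// nr_bop_le.
Qed.

Lemma mk_bop (f : H -> H) (M : R) : linear f -> (forall x, nr (f x) <= M * nr x) ->
  exists T : 'B(H), forall x, T x = f x.
Proof.
move=> lf fM; have fP : f \in bounded_linear (H := H).
  apply/asboolP; split=> //; exists M%:C%C => x.
  by rewrite [leRHS](_ : _ = (M * nr x)%:C%C) ?le_nr// realCM -nrE.
by exists (Bop fP).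
Qed.

(** As [adjop] is a choice with default [0], the content is existence. Riesz gives the values [S y],
    the inner product forces linearity, and [|S z|^2 = <T (S z), z>] forces the bound
    [|S z| <= |T| |z|]. *)
Lemma adjopP T x y : hdot (T x) y = hdot x (adjop T y).
Proof.
rewrite /adjop; case: xgetP => [S _ ->//|noS]; exfalso.
have /choice[S SP] : forall y, exists z, forall x, hdot (T x) y = hdot x z.
  move=> z; apply: (@riesz_representation _ _ (fun x => hdot (T x) z) (nr T * nr z)).
    by move=> a u v; rewrite linearP linearPl.
  move=> u; rewrite (le_trans (hdot_le _ _))// mulrAC ler_wpM2r ?nr_ge0//.
  exact: nr_bop_le.
have lS : linear S.
  move=> a u v; apply: hdot_eq => z.
  by rewrite -SP !(linearDr, linearZr_LR)/= !SP.
have SM z : nr (S z) <= nr T * nr z.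
  have [->|Sz0] := eqVneq (S z) 0; first by rewrite nr0 mulr_ge0 ?nr_ge0.
  have nSz : 0 < nr (S z).
    by rewrite lt_neqAle nr_ge0 andbT eq_sym; apply: contra_neq Sz0 => /nr_eq0.
  rewrite -(ler_pM2r nSz) -expr2 (@le_trans _ _ (nr (T (S z)) * nr z))//.
    rewrite (le_trans _ (hdot_le _ _))// SP hdot_nr normc_real/=.
    by rewrite ler_norm.
  by rewrite mulrAC ler_wpM2r ?nr_ge0// nr_bop_le.
have [S' S'E] := mk_bop lS SM.
by apply: (noS S') => u v; rewrite S'E SP.
Qed.

Lemma adjopPr T x y : hdot x (T y) = hdot (adjop T x) y.
Proof. by rewrite hdotC adjopP -hdotC. Qed.

Lemma adjop_uniq S T : (forall x y, hdot (T x) y = hdot x (S y)) -> adjop T = S.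
Proof.
by move=> ST; apply: bop_ext => y; apply: hdot_eq => x; rewrite -adjopP ST.
Qed.

Lemma adjopK T : adjop (adjop T) = T.
Proof. by apply: adjop_uniq => x y; rewrite adjopPr. Qed.

Lemma adjopM S T : adjop (S * T) = adjop T * adjop S.
Proof. by apply: adjop_uniq => x y; rewrite !bopM !adjopP. Qed.

Lemma adjop1 : adjop (1 : 'B(H)) = 1.
Proof. by apply: adjop_uniq => x y; rewrite !bop1. Qed.

Lemma adjop0 : adjop (0 : 'B(H)) = 0.
Proof. by apply: adjop_uniq => x y; rewrite !bop0 linear0l linear0r. Qed.

Lemma adjopD S T : adjop (S + T) = adjop S + adjop T.
Proof. by apply: adjop_uniq => x y; rewrite !bopD linearDl/= linearDr/= !adjopP. Qed.

Lemma adjopZ a T : adjop (a *: T) = a^* *: adjop T.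
Proof.
by apply: adjop_uniq => x y; rewrite !bopZ linearZl_LR linearZr_LR/= conjCK adjopP.
Qed.

Lemma adjop_sum (I : Type) (r : seq I) (P : pred I) (F : I -> 'B(H)) :
  adjop (\sum_(i <- r | P i) F i) = \sum_(i <- r | P i) adjop (F i).
Proof. exact: (big_morph _ adjopD adjop0). Qed.

Lemma nr_adjop T : nr (adjop T) = nr T.
Proof.
have le_adj S : nr (adjop S) <= nr S.
  apply: nr_bop_ub => [|z]; first exact: nr_ge0.
  have [->|Sz0] := eqVneq (adjop S z) 0; first by rewrite nr0 mulr_ge0 ?nr_ge0.
  have nSz : 0 < nr (adjop S z).
    by rewrite lt_neqAle nr_ge0 andbT eq_sym; apply: contra_neq Sz0 => /nr_eq0.
  rewrite -(ler_pM2r nSz) -expr2 (@le_trans _ _ (nr (S (adjop S z)) * nr z))//.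
    rewrite (le_trans _ (hdot_le _ _))// adjopP hdot_nr normc_real/=.
    by rewrite ler_norm.
  by rewrite mulrAC ler_wpM2r ?nr_ge0// nr_bop_le.
by apply/eqP; rewrite eq_le le_adj -{1}(adjopK T) le_adj.
Qed.

End adjoint.

(** * Completeness of [B(H)] *)

Section operator_completeness.
Variables (R : realType) (H : hilbertType R).

Lemma cvg_nr_near (V : normedModType R[i]) (F : set_system V) (FF : ProperFilter F) (l : V) :
  (forall e : R, 0 < e -> \forall u \near F, nr (u - l) <= e) -> F --> l.
Proof.
move=> h; apply/cvgrPdist_le => e e0.
have e0' : 0 < Re e by rewrite -ltcR -ge0_realC// ltW.
apply: filterS (h _ e0') => u.
by rewrite distrC (ge0_realC (ltW e0)) le_nr.
Qed.

(** The limit is built pointwise; the Cauchy estimate, uniform on the unit ball, survives the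
    pointwise limit and yields both boundedness and norm convergence. *)
Lemma bop_complete (F : set_system 'B(H)) : ProperFilter F -> cauchy F -> cvg F.
Proof.
move=> FF Fc.
have Fball (e : R) : 0 < e -> exists S, \forall T \near F, nr (S - T) < e.
  move=> e0; have e0' : 0 < e%:C%C :> R[i] by rewrite ltcR.
  have /cauchyP/(_ _ e0')[S FS] := Fc; exists S.
  by apply: filterS FS => T; rewrite -ball_normE/= lt_nr.
have evc x : cvg ((fun T : 'B(H) => T x) @ F).
  apply: cauchy_cvg; apply: cauchy_exP => e e0.
  have e0' : 0 < Re e by rewrite -ltcR -ge0_realC// ltW.
  have x0 : 0 < nr x + 1 by rewrite ltr_wpDl ?nr_ge0.
  have [S FS] := Fball _ (divr_gt0 e0' x0); exists (S x).
  rewrite -[_ (ball _ _)]/(F ((fun T : 'B(H) => T x) @^-1` (ball (S x) e))).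
  apply: filterS FS => T; rewrite -ball_normE/= (ge0_realC (ltW e0)) lt_nr => ST.
  rewrite (_ : S x - T x = (S - T) x)// (le_lt_trans (nr_bop_le _ _))//.
  rewrite (@le_lt_trans _ _ (nr (S - T) * (nr x + 1)))//.
    by rewrite ler_wpM2l ?nr_ge0// lerDl.
  by rewrite -ltr_pdivlMr.
pose g x := lim ((fun T : 'B(H) => T x) @ F).
have gP x : (fun T : 'B(H) => T x) @ F --> g x by exact: evc.
have lg : linear g.
  move=> a x y.
  have h : (fun T : 'B(H) => T (a *: x + y)) @ F --> a *: g x + g y.
    rewrite (_ : (fun T : 'B(H) => T (a *: x + y)) = fun T => a *: T x + T y).
      by apply: cvgD; [apply: cvgZl_tmp|]; exact: gP.
    by apply/funext => T; rewrite linearP.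
  by apply: cvg_lim h; exact: norm_hausdorff.
have gdist (S : 'B(H)) e : (\forall T \near F, nr (S - T) < e) ->
    forall x, nr (S x - g x) <= e * nr x.
  move=> FS x; apply/ler_addgt0Pr => d d0.
  have d0' : 0 < d%:C%C :> R[i] by rewrite ltcR.
  have [T [ST gT]] := filter_ex (filterI FS ((cvgrPdist_lt (F := F) _ _).1 (gP x) _ d0')).
  rewrite (le_trans (nr_triangle (T x) _ _))// lerD//.
    rewrite (_ : S x - T x = (S - T) x)// (le_trans (nr_bop_le _ _))//.
    by rewrite ler_wpM2r ?nr_ge0// ltW.
  by rewrite nrBC ltW// -lt_nr.
have gb : exists M : R, forall x, nr (g x) <= M * nr x.
  have [S FS] := Fball 1 ltr01; exists (nr S + 1) => x.
  rewrite -(subrK (S x) (g x)) (le_trans (nrD _ _))// addrC mulrDl lerD//.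
    exact: nr_bop_le.
  by rewrite nrBC; exact: (gdist _ _ FS).
have [M gM] := gb; have [G GE] := mk_bop lg gM.
apply/cvg_ex; exists G; apply: cvg_nr_near => e e0.
have e2 : 0 < e / 2 by rewrite divr_gt0.
have [S FS] := Fball _ e2; apply: filterS (FS) => T ST.
rewrite (le_trans (nr_triangle S _ _))// [leRHS]splitr lerD//.
  by rewrite nrBC ltW.
apply: nr_bop_ub => [|x]; first exact: ltW.
by rewrite bopD bopN GE; exact: (gdist _ _ FS).
Qed.

HB.instance Definition _ := Uniform_isComplete.Build 'B(H) bop_complete.

End operator_completeness.

(** * Neumann series *)

Section limits.
Variables (R : realType).

Lemma cvg_nr0 (V : normedModType R[i]) (u : nat -> V) (l : V) :
  u @ \oo --> l -> (fun k => nr (l - u k)) @ \oo --> (0 : R).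
Proof.
move=> ul; rewrite -(nr0 V) -(subrr l); apply: cvg_nr.
by apply: cvgB => //; exact: cvg_cst.
Qed.

Lemma cvg_bopM (H : hilbertType R) (u v : nat -> 'B(H)) (S T : 'B(H)) :
  u @ \oo --> S -> v @ \oo --> T -> (fun k => u k * v k) @ \oo --> S * T.
Proof.
move=> uS vT.
apply: (@cvg_nr_dominated _ _ _ _ (fun k => nr (S - u k) * nr T + nr (u k) * nr (T - v k))).
  move=> k; rewrite (le_trans _ (lerD (nr_bopM _ _) (nr_bopM _ _)))//.
  rewrite (_ : _ - _ = (S - u k) * T + u k * (T - v k)) ?nrD//.
  by rewrite mulrBl mulrBr addrA subrK.
have -> : (0 : R) = 0 * nr T + nr S * 0 by rewrite mul0r mulr0 addr0.
apply: cvgD; first by apply: cvgMr_tmp; exact: cvg_nr0.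
by apply: cvgM; [exact: cvg_nr|exact: cvg_nr0].
Qed.

Lemma cvg_bopv (H : hilbertType R) (u : nat -> 'B(H)) (S : 'B(H)) (x : H) :
  u @ \oo --> S -> (fun k => u k x) @ \oo --> S x.
Proof.
move=> uS; apply: (@cvg_nr_dominated _ _ _ _ (fun k => nr (S - u k) * nr x)).
  by move=> k; exact: (nr_bop_le (S - u k)).
by rewrite -(mul0r (nr x)); apply: cvgMr_tmp; exact: cvg_nr0.
Qed.

Lemma cvg_bop_apply (H : hilbertType R) (u : nat -> H) (T : 'B(H)) (x : H) :
  u @ \oo --> x -> (fun k => T (u k)) @ \oo --> T x.
Proof.
move=> ux; apply: (@cvg_nr_dominated _ _ _ _ (fun k => nr T * nr (x - u k))).
  by move=> k; rewrite -linearB; exact: nr_bop_le.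
by rewrite -(mulr0 (nr T)); apply: cvgMl_tmp; exact: cvg_nr0.
Qed.

Lemma cvg_geometric_increments (V : completeNormedModType R[i]) (u : nat -> V)
    (A q : R) : 0 <= A -> 0 <= q < 1 ->
  (forall k, nr (u k.+1 - u k) <= A * q ^+ k) -> cvgn u.
Proof.
move=> A0 /andP[q0 q1] uq.
have uN N j : nr (u (N + j)%N - u N) <= (A / (1 - q)) * q ^+ N.
  have : nr (u (N + j)%N - u N) <= A * q ^+ N * (1 - q ^+ j) / (1 - q).
    elim: j => [|j IH]; first by rewrite addn0 subrr nr0 subrr mulr0 mul0r.
    rewrite (le_trans (nr_triangle (u (N + j)%N) _ _))// addnS.
    rewrite (le_trans (lerD (uq _) IH))// le_eqVlt; apply/orP; left; apply/eqP.
    by rewrite exprD exprS; field; rewrite subr_eq0 gt_eqF.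
  move=> /le_trans; apply; rewrite -!mulrA ler_wpM2l// [leRHS]mulrC.
  by rewrite ler_wpM2l ?exprn_ge0// ler_piMl ?invr_ge0 ?subr_ge0 ?(ltW q1)// gerBl exprn_ge0.
apply: cauchy_nr => e e0.
have /cvgrPdist_lt/(_ _ e0)[N _ NP] : (fun N => (A / (1 - q)) * q ^+ N) @ \oo --> (0 : R).
  by apply: cvg_geometric; rewrite ger0_norm.
exists N => k Nk; rewrite -(subnKC Nk) (le_lt_trans (uN _ _))//.
by rewrite (le_lt_trans _ (NP N _))//= sub0r normrN ler_norm.
Qed.

End limits.

Section neumann.
Variables (R : realType) (H : hilbertType R).
Implicit Types (S T A E : 'B(H)).

Definition bop_invertible T := exists S, S * T = 1 /\ T * S = 1.

Lemma nr_bop1 : nr (1 : 'B(H)) <= 1.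
Proof. by apply: nr_bop_ub => // x; rewrite bop1 mul1r. Qed.

Lemma nr_bopX T k : nr (T ^+ k) <= nr T ^+ k.
Proof.
elim: k => [|k IH]; first by rewrite !expr0 nr_bop1.
by rewrite !exprS (le_trans (nr_bopM _ _))// ler_wpM2l ?nr_ge0.
Qed.

Lemma neumann_inverse T : nr T < 1 -> bop_invertible (1 - T).
Proof.
move=> T1; pose P N := \sum_(k < N) T ^+ k.
have PS N : P N.+1 = P N + T ^+ N by rewrite /P big_ord_recr.
have cP : cvgn P.
  apply: (@cvg_geometric_increments _ _ _ 1 (nr T)) => //.
    by rewrite nr_ge0.
  by move=> k; rewrite PS addrC addKr mul1r nr_bopX.
have Tk : (fun k => T ^+ k) @ \oo --> (0 : 'B(H)).
  apply: (@cvg_nr_dominated _ _ _ _ (fun k => 1 * nr T ^+ k)).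
    by move=> k; rewrite sub0r nrN mul1r nr_bopX.
  by apply: cvg_geometric; rewrite ger0_norm ?nr_ge0.
have P1 : (fun N => 1 - T ^+ N) @ \oo --> (1 : 'B(H)).
  by rewrite -[X in _ --> X]subr0; apply: cvgB => //; exact: cvg_cst.
have PTl N : P N * (1 - T) = 1 - T ^+ N.
  elim: N => [|N IH]; first by rewrite /P big_ord0 mul0r expr0 subrr.
  by rewrite PS mulrDl IH mulrBr mulr1 -exprSr addrA subrK.
have PTr N : (1 - T) * P N = 1 - T ^+ N.
  elim: N => [|N IH]; first by rewrite /P big_ord0 mulr0 expr0 subrr.
  by rewrite PS mulrDr IH mulrBl mul1r -exprS addrA subrK.
have hd := @norm_hausdorff R[i] 'B(H).
exists (limn P); split.
  have h : (fun N => P N * (1 - T)) @ \oo --> limn P * (1 - T).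
    by apply: cvg_bopM; [exact: cP|exact: cvg_cst].
  apply: (cvg_unique hd h); rewrite (_ : (fun N => _) = fun N => 1 - T ^+ N)//.
  by apply/funext => N; rewrite PTl.
have h : (fun N => (1 - T) * P N) @ \oo --> (1 - T) * limn P.
  by apply: cvg_bopM; [exact: cvg_cst|exact: cP].
apply: (cvg_unique hd h); rewrite (_ : (fun N => _) = fun N => 1 - T ^+ N)//.
by apply/funext => N; rewrite PTr.
Qed.

Lemma invertible_perturb A S E : S * A = 1 -> A * S = 1 -> nr S * nr E < 1 ->
  bop_invertible (A - E).
Proof.
move=> SA AS SE.
have [Q [QS SQ]] := neumann_inverse (le_lt_trans (nr_bopM S E) SE).
have -> : A - E = A * (1 - S * E) by rewrite mulrBr mulr1 mulrA AS mul1r.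
exists (Q * S); split; first by rewrite -mulrA (mulrA S) SA mul1r QS.
by rewrite -mulrA (mulrA _ Q) SQ mul1r AS.
Qed.

(** Otherwise [1] lies in the spectrum. To conclude that the supremum is at least [1], the spectrum
    has to be bounded above: [sup] says nothing about an unbounded set. The Neumann series bounds it
    by [|T|]. *)
Lemma spectral_radius_lt1 T : spectral_radius T < 1 -> bop_invertible (1 - T).
Proof.
move=> T1; apply: contrapT => niT.
pose Sp := [set Re `|l| | l in spectrum T].
have SpT l : spectrum T l -> Re `|l| <= nr T.
  move=> Tl; rewrite leNgt; apply/negP => Tlt; apply: Tl.
  have l0 : l != 0.
    by apply: contraTneq Tlt => ->; rewrite normr0/= -leNgt nr_ge0.
  have nl0 : 0 < Re `|l| by rewrite (le_lt_trans (nr_ge0 _) Tlt).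
  have /neumann_inverse[Q [Q1 Q2]] : nr (l^-1 *: T) < 1.
    rewrite nrZ; have -> : Re `|l^-1| = (Re `|l|)^-1.
      apply: complexI; rewrite -Defs.normcE normfV.
      by rewrite [in LHS](Defs.normcE (l : R[i]^o)) /= fmorphV.
    by rewrite mulrC ltr_pdivrMr// mul1r.
  exists (l^-1 *: Q).
  have -> : l *: (1 : 'B(H)) - T = l *: (1 - l^-1 *: T).
    by rewrite scalerBr scalerA mulfV// scale1r.
  have ZZ (a b : R[i]) (U V : 'B(H)) : (a *: U) * (b *: V) = (a * b) *: (U * V).
    by apply: bop_ext => x; rewrite !(bopM, bopZ) linearZ/= scalerA.
  by rewrite !ZZ Q1 Q2 mulVf// mulfV// scale1r.
have Sp1 : Sp 1.
  exists 1; last by rewrite normr1.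
  by rewrite /spectrum/= scale1r.
have : 1 <= sup Sp.
  apply: ub_le_sup => //; exists (nr T) => _ [l Tl <-]; exact: SpT.
by rewrite leNgt T1.
Qed.

End neumann.

(** * Sums over words and square-summable families *)

Section words.
Variable n : nat.
Local Notation word := (word n).

(** Flattening the sums by length into one duplicate-free list lets partial sums be compared with
    sums over arbitrary finite sets of words. *)
Definition words (N : nat) : seq word :=
  flatten [seq [seq tval t | t <- index_enum (k.-tuple 'I_n : finType)] | k <- index_iota 0 N].

Lemma sum_words (V : nmodType) (F : word -> V) N :
  \sum_(0 <= k < N) homsum F k = \sum_(w <- words N) F w.
Proof.
rewrite /words big_flatten/= big_map; apply: eq_bigr => k _.
by rewrite big_map.
Qed.

Lemma mem_words N (w : word) : (w \in words N) = (size w < N)%N.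
Proof.
apply/flattenP/idP => [[s /mapP[k]]|wN].
  rewrite mem_index_iota => kN -> /mapP[t _ ->]; by rewrite size_tuple.
exists [seq tval t | t <- index_enum ((size w).-tuple 'I_n : finType)].
  by apply/mapP; exists (size w); rewrite ?mem_index_iota.
by apply/mapP; exists (in_tuple w); rewrite ?mem_index_enum.
Qed.

Lemma wordsS N :
  words N.+1 = words N ++ [seq tval t | t <- index_enum (N.-tuple 'I_n : finType)].
Proof. by rewrite /words /index_iota !subn0 -addn1 iotaD map_cat flatten_cat /= cats0. Qed.

Lemma words_uniq N : uniq (words N).
Proof.
elim: N => [//|N IH]; rewrite wordsS cat_uniq IH/=; apply/andP; split.
  apply/hasPn => w /mapP[t _ ->]; apply/negP; rewrite mem_words.
  by rewrite size_tuple ltnn.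
by rewrite map_inj_uniq ?index_enum_uniq//; exact: val_inj.
Qed.

Lemma sum_subwords (V : nmodType) (F : word -> V) N (s : seq word) : uniq s ->
  (forall w, w \in s -> (size w < N)%N) ->
  \sum_(w <- s) F w = \sum_(w <- words N | w \in s) F w.
Proof.
move=> us sN; rewrite -[RHS]big_filter; apply: perm_big; apply: uniq_perm => //.
  by rewrite filter_uniq ?words_uniq.
move=> w; rewrite mem_filter mem_words.
by case: (boolP (w \in s)) => //= /sN ->.
Qed.

Lemma le_sum_words (R : realType) (F : word -> R) N (s : seq word) : uniq s ->
  (forall w, 0 <= F w) -> (forall w, w \in s -> (size w < N)%N) ->
  \sum_(w <- s) F w <= \sum_(w <- words N) F w.
Proof.
move=> us F0 sN; rewrite (sum_subwords F us sN) big_mkcond/=.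
by apply: ler_sum => w _; case: ifP.
Qed.

Lemma words_bound (s : seq word) : exists N, forall w, w \in s -> (size w < N)%N.
Proof.
exists (\max_(w <- s) size w).+1 => w ws.
by rewrite ltnS (big_rem w)//= leq_maxl.
Qed.

End words.

Section ell2_theory.
Variables (R : realType) (n : nat) (K : hilbertType R).
Implicit Types (f : word n -> K) (u v : ell2 n K) (w : word n).

Lemma sqnorm_words f N : sqnorm_sums f N = \sum_(w <- words n N) nr (f w) ^+ 2.
Proof. by rewrite /sqnorm_sums /series/= sum_words. Qed.

Lemma sum_sqr_le u (s : seq (word n)) : uniq s ->
  \sum_(w <- s) nr (u w) ^+ 2 <= nr u ^+ 2.
Proof.
move=> us; have [N sN] := words_bound s.
rewrite (le_trans _ (sqnorm_sums_norm u N))// sqnorm_words.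
by apply: le_sum_words => // w; exact: sqr_ge0.
Qed.

Lemma mk_ell2 f (M : R) : (forall N, \sum_(w <- words n N) nr (f w) ^+ 2 <= M) ->
  exists u, forall w, u w = f w.
Proof.
move=> fM; have fP : f \in square_summable (K := K).
  by apply/asboolP; exists M => N; rewrite sqnorm_words.
by exists (Ell2 fP).
Qed.

Lemma nr_ell2_le u (M : R) : 0 <= M ->
  (forall N, \sum_(w <- words n N) nr (u w) ^+ 2 <= M ^+ 2) -> nr u <= M.
Proof.
by move=> M0 uM; apply: norm_sqnorm_sums => // N; rewrite sqnorm_words.
Qed.

Lemma nr_coord u w : nr (u w) <= nr u.
Proof.
rewrite -(@ler_pXn2r _ 2)// ?nnegrE ?nr_ge0//.
by have := @sum_sqr_le u [:: w] isT; rewrite big_seq1.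
Qed.

Lemma cvg_coord (u : nat -> ell2 n K) (v : ell2 n K) w :
  u @ \oo --> v -> (fun k => u k w) @ \oo --> v w.
Proof.
move=> uv; apply: (@cvg_nr_dominated _ _ _ _ (fun k => nr (v - u k))).
  by move=> k; rewrite -ell2B nr_coord.
exact: cvg_nr0.
Qed.

Definition trunc u N : ell2 n K := \sum_(w <- words n N) single w (u w).

Lemma ell2_sum (I : Type) (s : seq I) (F : I -> ell2 n K) w :
  (\sum_(i <- s) F i) w = \sum_(i <- s) F i w.
Proof.
elim: s => [|i s IH]; first by rewrite !big_nil.
by rewrite !big_cons ell2D IH.
Qed.

Lemma truncE u N w : trunc u N w = if (size w < N)%N then u w else 0.
Proof.
rewrite /trunc ell2_sum -mem_words /=.
rewrite [LHS](_ : _ = \sum_(v <- words n N | v == w) u w); last first.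
  rewrite [RHS]big_mkcond; apply: eq_bigr => v _ /=.
  by rewrite eq_sym; case: eqVneq => [->|].
by rewrite big_const_seq count_uniq_mem ?words_uniq//; case: ifP => _ /=; rewrite ?addr0.
Qed.

(** By orthogonality, [|u - trunc u N|^2] is at most the tail of the convergent series of [|u|^2].
    Density of finitely supported vectors is what makes an operator determined by its values on
    [single]. *)
Lemma trunc_cvg u : trunc u @ \oo --> u.
Proof.
have tail N : nr (u - trunc u N) ^+ 2 <= nr u ^+ 2 - sqnorm_sums u N.
  have h M : \sum_(w <- words n M) nr ((u - trunc u N) w) ^+ 2 <=
      nr u ^+ 2 - sqnorm_sums u N.
    rewrite lerBrDr sqnorm_words.
    rewrite (@le_trans _ _ (\sum_(w <- words n (maxn M N)) nr (u w) ^+ 2))//; last first.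
      by rewrite sum_sqr_le ?words_uniq.
    rewrite (@sum_subwords _ _ _ (maxn M N) (words n N)) ?words_uniq//; last first.
      by move=> w; rewrite mem_words => wN; rewrite leq_max wN orbT.
    rewrite (@le_trans _ _ (\sum_(w <- words n (maxn M N))
        nr ((u - trunc u N) w) ^+ 2 +
        \sum_(w <- words n (maxn M N) | w \in words n N) nr (u w) ^+ 2))//.
      rewrite lerD2r; apply: le_sum_words; rewrite ?words_uniq//.
        by move=> w; exact: sqr_ge0.
      by move=> w; rewrite mem_words => wN; rewrite leq_max wN.
    rewrite [X in _ + X <= _]big_mkcond -big_split; apply: ler_sum => w _.
    rewrite ell2B truncE mem_words; case: ifP => _; last by rewrite /= subr0 addr0.
    by rewrite /= subrr nr0 expr0n add0r.
  have e0 : 0 <= nr u ^+ 2 - sqnorm_sums u N.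
    by rewrite subr_ge0 sqnorm_sums_norm.
  rewrite -(sqr_sqrtr e0) ler_pXn2r// ?nnegrE ?nr_ge0 ?sqrtr_ge0//.
  apply: nr_ell2_le; first exact: sqrtr_ge0.
  by move=> M; rewrite sqr_sqrtr.
apply/cvg_nrP => e e0.
have e20 : 0 < e ^+ 2 by rewrite exprn_gt0.
have /cvgrPdist_lt/(_ _ e20)[N _ NP] : sqnorm_sums u @ \oo --> limn (sqnorm_sums u).
  exact: sqnorm_sums_cvg.
exists N => k /NP; rewrite -ell2_norm_sums => h.
rewrite -(@ltr_pXn2r _ 2)// ?nnegrE ?nr_ge0 ?(ltW e0)//.
by rewrite (le_lt_trans (tail k))// (le_lt_trans _ h)// ler_norm.
Qed.

Lemma bop_ext_single (S T : 'B(ell2 n K)) :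
  (forall w x, S (single w x) = T (single w x)) -> S = T.
Proof.
move=> ST; apply: bop_ext => u.
have hS := @cvg_bop_apply _ _ _ S _ (@trunc_cvg u).
have hT := @cvg_bop_apply _ _ _ T _ (@trunc_cvg u).
apply: (cvg_unique (@norm_hausdorff _ _) hS).
rewrite (_ : (fun k => _) = fun k => T (trunc u k))//.
apply/funext => k; rewrite /trunc !linear_sum; apply: eq_bigr => w _; exact: ST.
Qed.

(** A weighted partial shift read backwards: coordinate [w] of the image comes from coordinate
    [src w]. Injectivity of [src] means that every coordinate of [u] is used at most once, whence
    the norm bound [G |B|]. Products of creation operators, and their tensor products with an
    operator, are all of this form. *)
Lemma mk_shift (src : word n -> option (word n)) (g : word n -> R[i]) (G : R)
    (B : 'B(K)) :
  (forall w w1 w2, src w1 = Some w -> src w2 = Some w -> w1 = w2) ->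
  0 <= G -> (forall w, Re `|g w| <= G) ->
  exists T : 'B(ell2 n K), forall u w,
    T u w = if src w is Some v then g w *: B (u v) else 0.
Proof.
move=> inj G0 gG.
pose f u w := if src w is Some v then g w *: B (u v) else 0.
have fle u N : \sum_(w <- words n N) nr (f u w) ^+ 2 <= (G * nr B * nr u) ^+ 2.
  rewrite exprMn.
  rewrite (@le_trans _ _ ((G * nr B) ^+ 2 * \sum_(v <- pmap src (words n N)) nr (u v) ^+ 2))//.
    elim: (words n N) => [|w s IH]; first by rewrite !big_nil mulr0.
    rewrite /= big_cons /f; case E : (src w) => [v|] /=.
      rewrite big_cons mulrDr lerD// -exprMn.
      rewrite ler_pXn2r ?nnegrE ?nr_ge0 ?mulr_ge0 ?nr_ge0//.
      by rewrite nrZ -mulrA ler_pM ?nr_ge0 ?Re_norm_ge0 ?nr_bop_le.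
    by rewrite nr0 expr0n add0r.
  rewrite ler_wpM2l ?sqr_ge0// sum_sqr_le//.
  have := words_uniq n N; elim: (words n N) => [//|w s IH] /= /andP[ws us].
  case E : (src w) => [v|] /=; last exact: IH.
  rewrite IH// andbT; apply/negP; rewrite mem_pmap => /mapP[w' w's /esym E'].
  by move: ws; rewrite (inj _ _ _ E E') w's.
have /choice[F FE] : forall u, exists v : ell2 n K, forall w, v w = f u w.
  by move=> u; apply: mk_ell2 (fle u).
have lF : linear F.
  move=> a u v; apply: ell2_ext => w; rewrite ell2D ell2Z !FE /f.
  case: (src w) => [x|]; last by rewrite scaler0 addr0.
  by rewrite ell2D ell2Z linearP scalerDr !scalerA mulrC.
have [T TE] : exists T : 'B(ell2 n K), forall u, T u = F u.
  apply: (mk_bop lF (M := G * nr B)) => u.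
  apply: nr_ell2_le; first by rewrite !mulr_ge0 ?nr_ge0.
  by move=> N; under eq_bigr do rewrite FE; exact: fle.
by exists T => u w; rewrite TE FE.
Qed.

Lemma nr_single w (x : K) : nr (single w x) = nr x.
Proof.
apply/eqP; rewrite eq_le; apply/andP; split; last first.
  by have := nr_coord (single w x) w; rewrite /= eqxx.
rewrite -(@ler_pXn2r _ 2)// ?nnegrE ?nr_ge0// -lecR -!hdot_nr.
by rewrite hdot_single /= eqxx.
Qed.

End ell2_theory.

(** * Coefficients of powers of (1 - p)^-1 *)

Section coefficients.
Variables (R : realType) (n : nat).
Local Notation C := R[i].
Implicit Types (F G K : fps R n) (w : word n).

Lemma fps_mul0 F G : fps_mul F G [::] = F [::] * G [::].
Proof. by rewrite /fps_mul big_nat1. Qed.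

Lemma fps_mul_cons F G i w :
  fps_mul F G (i :: w) = F [::] * G (i :: w) + fps_mul (fun v => F (i :: v)) G w.
Proof. by rewrite /fps_mul big_nat_recl. Qed.

Lemma fps_mulDl F G K w : fps_mul (fun v => F v + G v) K w = fps_mul F K w + fps_mul G K w.
Proof.
by rewrite /fps_mul -big_split; apply: eq_bigr => k _; rewrite mulrDl.
Qed.

Lemma fps_mulZl (a : C) G K w : fps_mul (fun v => a * G v) K w = a * fps_mul G K w.
Proof.
by rewrite /fps_mul mulr_sumr; apply: eq_bigr => k _; rewrite mulrA.
Qed.

Lemma eq_fps_mul F F' G G' : F =1 F' -> G =1 G' -> fps_mul F G =1 fps_mul F' G'.
Proof. by move=> FF' GG' w; apply: eq_bigr => k _; rewrite FF' GG'. Qed.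

(** Removing the first letter of [w] replaces [F] by its left derivative [fun v => F (i :: v)], so
    the induction must be general in [F]. *)
Lemma fps_mulA F G K w : fps_mul F (fps_mul G K) w = fps_mul (fps_mul F G) K w.
Proof.
elim: w F => [|i w IH] F; first by rewrite !fps_mul0 mulrA.
rewrite [LHS]fps_mul_cons [RHS]fps_mul_cons IH fps_mul0.
rewrite [in RHS](@eq_fps_mul _ (fun v => F [::] * G (i :: v) +
  fps_mul (fun v => F (i :: v)) G v) K K)//; last first.
  by move=> v; rewrite fps_mul_cons.
by rewrite fps_mulDl fps_mulZl fps_mul_cons mulrDr mulrA addrA.
Qed.

Lemma fps_mul1l F w : fps_mul (@fps_one R n) F w = F w.
Proof.
rewrite /fps_mul big_nat_recl//= take0 drop0 /fps_one eqxx mul1r big_nat.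
rewrite big1 ?addr0// => k /andP[_ kw].
rewrite (_ : _ == _ = false) ?mul0r//; apply/eqP => /(congr1 size).
by rewrite size_takel.
Qed.

Lemma fps_mul1r F w : fps_mul F (@fps_one R n) w = F w.
Proof.
rewrite /fps_mul big_nat_recr//= take_size drop_size /fps_one eqxx mulr1 big_nat.
rewrite big1 ?add0r// => k /andP[_ kw].
rewrite (_ : _ == _ = false) ?mulr0//; apply/eqP => /(congr1 size).
by rewrite size_drop/= => /eqP; rewrite subn_eq0 leqNgt kw.
Qed.

Fixpoint fps_pow F j : fps R n :=
  if j is j'.+1 then fps_mul F (fps_pow F j') else @fps_one R n.

Lemma fps_powSr F j w : fps_pow F j.+1 w = fps_mul (fps_pow F j) F w.
Proof.
elim: j w => [|j IH] w; first by rewrite /= fps_mul1r fps_mul1l.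
by rewrite /= -fps_mulA; apply: eq_fps_mul => // v; rewrite -IH.
Qed.

(* The coefficients of [(1 - F)^-m]; for [m = 0] the truncated subtraction makes
   ['C(j + m - 1, j)] vanish except at [j = 0], where it is [1]. *)
Definition fps_geom F m : fps R n := fun w =>
  \sum_(0 <= j < (size w).+1) 'C(j + m - 1, j)%:R * fps_pow F j w.

Section nonunit.
Variable F : fps R n.
Hypothesis F0 : F [::] = 0.

(** Without constant term, each factor uses up at least one letter. Hence the sum over powers is
    finite at every word, and its upper bound can be raised at will. *)
Lemma fps_pow_eq0 j w : (size w < j)%N -> fps_pow F j w = 0.
Proof.
elim: j w => [//|j IH] w wj /=.
rewrite /fps_mul big_nat_recl//= take0 F0 mul0r add0r.
rewrite big_nat big1// => k /andP[_ kw]; rewrite IH ?mulr0// size_drop.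
by rewrite ltnS in wj; rewrite (leq_trans _ wj)// ltn_subrL (leq_ltn_trans _ kw).
Qed.

Lemma fps_geom_widen m w N : (size w <= N)%N ->
  fps_geom F m w = \sum_(0 <= j < N.+1) 'C(j + m - 1, j)%:R * fps_pow F j w.
Proof.
move=> wN; rewrite [RHS](big_cat_nat _ (n := (size w).+1))//=.
rewrite [X in _ + X]big_nat [X in _ + X]big1 ?addr0// => j /andP[wj _].
by rewrite fps_pow_eq0// mulr0.
Qed.

(** Pascal's rule, the coefficient form of [(1 - F)^-(m+1) = (1 - F)^-m + F (1 - F)^-(m+1)]. The
    function [f] leaves open on which side the extra factor [F] is split off. *)
Lemma fps_geom_rec (f : nat -> C) m w :
  (forall j, f j = fps_pow F j.+1 w) ->
  fps_geom F m.+1 w = fps_geom F m w +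
    \sum_(0 <= j < (size w).+1) 'C(j + m.+1 - 1, j)%:R * f j.
Proof.
move=> fE; rewrite (@fps_geom_widen m.+1 w (size w).+1)//.
rewrite (@fps_geom_widen m w (size w).+1)//.
rewrite big_nat_recl// [in RHS]big_nat_recl//= !bin0 -addrA; congr (_ + _).
rewrite -big_split/=; apply: eq_bigr => j _; rewrite fE -mulrDl -natrD; congr (_%:R * _).
by rewrite !addnS !addSn !subn1/= binS.
Qed.

(** The left form matches left creation operators and [Phi]; the right form, proved next, matches
    right creation operators and the reconstruction operator. *)
Lemma fps_geomSl m w :
  fps_geom F m.+1 w = fps_geom F m w + fps_mul F (fps_geom F m.+1) w.
Proof.
rewrite (@fps_geom_rec (fun j => fps_mul F (fps_pow F j) w))//; congr (_ + _).
under eq_bigr do rewrite /fps_mul mulr_sumr.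
rewrite exchange_big; apply: eq_bigr => k _.
rewrite (@fps_geom_widen m.+1 (drop k w) (size w)) ?size_drop ?leq_subr//.
by rewrite mulr_sumr; apply: eq_bigr => j _; rewrite mulrCA.
Qed.

Lemma fps_geomSr m w :
  fps_geom F m.+1 w = fps_geom F m w + fps_mul (fps_geom F m.+1) F w.
Proof.
rewrite (@fps_geom_rec (fun j => fps_mul (fps_pow F j) F w)); last first.
  by move=> j; rewrite fps_powSr.
congr (_ + _); under eq_bigr do rewrite /fps_mul mulr_sumr.
rewrite exchange_big; apply: eq_bigr => k _.
rewrite (@fps_geom_widen m.+1 (take k w) (size w)) ?size_take_min ?geq_minr//.
by rewrite mulr_suml; apply: eq_bigr => j _; rewrite mulrA.
Qed.

Lemma fps_geom_nil m : fps_geom F m [::] = 1.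
Proof. by rewrite /fps_geom big_nat1 bin0 mul1r. Qed.

Lemma fps_geom0 w : fps_geom F 0 w = fps_one R w.
Proof.
rewrite /fps_geom big_nat_recl//= bin0 mul1r big1 ?addr0// => j _.
by rewrite addn0 subn1/= bin_small// mul0r.
Qed.

End nonunit.

Section positivity.
Variable F : fps R n.
Hypothesis F_ge0 : forall w, 0 <= F w.

Lemma fps_mul_ge0 G w : (forall v, 0 <= G v) -> 0 <= fps_mul F G w.
Proof. by move=> G0; apply: sumr_ge0 => k _; rewrite mulr_ge0. Qed.

Lemma fps_geom_ge0 m w : 0 <= fps_geom F m w.
Proof.
apply: sumr_ge0 => j _; rewrite mulr_ge0 ?ler0n//.
elim: j w => [|j IH] w /=; first by rewrite /fps_one ler0n.
exact: fps_mul_ge0.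
Qed.

Hypothesis F0 : F [::] = 0.

(** Only the term with the one-letter prefix [i] is kept in the recursion. Since [a_i > 0], this
    bounds the weights of the creation operators. *)
Lemma fps_geom_cons m i w : F [:: i] * fps_geom F m.+1 w <= fps_geom F m.+1 (i :: w).
Proof.
rewrite [leRHS]fps_geomSl//= fps_mul_cons F0 mul0r add0r ler_wpDl ?fps_geom_ge0//.
rewrite /fps_mul big_nat_recl//= take0 drop0 lerDl sumr_ge0// => k _.
by rewrite mulr_ge0 ?fps_geom_ge0.
Qed.

Lemma fps_geom_rcons m i w : fps_geom F m.+1 w * F [:: i] <= fps_geom F m.+1 (rcons w i).
Proof.
rewrite [leRHS]fps_geomSr// ler_wpDl ?fps_geom_ge0//.
rewrite /fps_mul size_rcons big_nat_recr//= big_nat_recr//=.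
rewrite -cats1 take_size_cat// drop_size_cat// drop_oversize ?size_cat ?addn1//.
rewrite F0 mulr0 addr0 lerDr sumr_ge0// => k _.
by rewrite mulr_ge0 ?fps_geom_ge0.
Qed.

Lemma fps_geom_gt0 m w : (forall i, 0 < F [:: i]) -> 0 < fps_geom F m.+1 w.
Proof.
move=> Fi; elim: w => [|i w IH]; first by rewrite fps_geom_nil.
by rewrite (lt_le_trans _ (fps_geom_cons _ _ _))// mulr_gt0.
Qed.

End positivity.

Section factorizations.

(** An explicit enumeration of the index set in [bcoef], cutting off the first factor at each
    position; its recursion is that of the powers of a power series. *)
Fixpoint factorizations j w : seq (j.-tuple (word n)) :=
  if j is j'.+1 return seq (j.-tuple (word n)) then
    [seq cons_tuple (take k w) g | k <- index_iota 1 (size w).+1,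
                                   g <- factorizations j' (drop k w)]
  else if w is [::] then [:: [tuple]] else [::].

Lemma mem_factorizations j w (g : j.-tuple (word n)) :
  (g \in factorizations j w) =
  (flatten g == w) && all (fun v => 0 < size v)%N g.
Proof.
elim: j w g => [|j IH] w g.
  by rewrite (tuple0 g) /=; case: w => [|i w] //=.
apply/allpairsPdep/idP => [[k [h [kw]]]|].
  rewrite IH => /andP[/eqP hw h0] ->; rewrite /= hw cat_take_drop eqxx h0 andbT/=.
  move: kw; rewrite mem_index_iota => /andP[k0 kw].
  by rewrite size_takel.
case/tupleP: g => v g /= /and3P[/eqP vw v0 g0].
have Ev : take (size v) w = v by rewrite -vw take_size_cat.
have Eg : drop (size v) w = flatten g by rewrite -vw drop_size_cat.
exists (size v), g; split.
- by rewrite mem_index_iota v0 -vw size_cat ltnS leq_addr.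
- by rewrite IH Eg eqxx g0.
- by apply: val_inj; rewrite /= Ev.
Qed.

Lemma factorizations_uniq j w : uniq (factorizations j w).
Proof.
elim: j w => [|j IH] w; first by case: w.
apply: allpairs_uniq_dep; first exact: iota_uniq.
  by move=> k _; exact: IH.
move=> [k g] [k' g'] /allpairsPdep[k1 [g1 [k1s _ /(congr1 (@tag _ _))/= Ek]]].
move=> /allpairsPdep[k2 [g2 [k2s _ /(congr1 (@tag _ _))/= Ek']]] /= /(congr1 val)/=.
rewrite -Ek -Ek' in k1s k2s; move: k1s k2s; rewrite !mem_index_iota.
move=> /andP[_ kw] /andP[_ kw'] [/(congr1 size) + gg].
rewrite !size_takel//; move=> kk; rewrite kk.
by congr (existT _ _ _); apply: val_inj.
Qed.

Lemma sum_factorizations F j w : F [::] = 0 ->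
  \sum_(g <- factorizations j w) \prod_(v <- g) F v = fps_pow F j w.
Proof.
move=> F0; elim: j w => [|j IH] w.
  by case: w => [|i w]; rewrite /= ?big_seq1 ?big_nil.
rewrite /= big_allpairs_dep /fps_mul [RHS]big_nat_recl//= take0 F0 mul0r add0r.
rewrite big_add1/=; apply: eq_bigr => k _.
by rewrite -IH mulr_sumr; apply: eq_bigr => g _; rewrite big_cons.
Qed.

End factorizations.

(** Grouping the factorizations by their number [j] of factors gives the power [p^j], so the weights
    are the coefficients of [(1 - p)^-(m+1)] and inherit its recursions. *)
Lemma bcoefE (p : ncpoly R n) m w : p [::] = 0 -> bcoef p m.+1 w = fps_geom p m.+1 w.
Proof.
move=> p0; case: w => [|i w]; first by rewrite fps_geom_nil.
rewrite /bcoef -/(size (i :: w)); move: (i :: w) (isT : (0 < size (i :: w))%N) => {i}w w0.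
rewrite /fps_geom [RHS]big_nat_recl//= (_ : fps_one R w = 0) ?mulr0 ?add0r; last first.
  by rewrite /fps_one; case: w w0.
rewrite big_add1/=; apply: eq_bigr => j _.
rewrite -[fps_mul _ _ _]/(fps_pow p j.+1 w) -sum_factorizations// mulr_sumr.
rewrite (fsbigE (factorizations j.+1 w)) ?factorizations_uniq//; first last.
- move=> g /= [/eqP wg g0]; by rewrite mem_factorizations wg g0.
- by move=> g /=; rewrite mem_factorizations => /andP[/eqP].
rewrite big_seq_cond [RHS]big_seq; apply: eq_big => [g|g _].
  case: (boolP (g \in _)) => //=; rewrite mem_factorizations => /andP[/eqP wg g0].
  exact: mem_set.
rewrite mulrC; congr (_%:R * _).
(* Symmetry of the binomial coefficient: [bcoef] has lower index [m], while [fps_geom] has the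
   number of factors. *)
rewrite !addnS subn1 /= subn1/= -[X in 'C(_, X) = _](addKn j.+1 m) addSn.
by rewrite bin_sub// -addSn leq_addr.
Qed.

End coefficients.

(** * Weighted creation operators *)

Section splitting.
Variable n : nat.
Implicit Types (g v w : word n).

Definition strip_prefix g w := if prefix g w then Some (drop (size g) w) else None.

Definition strip_suffix g w :=
  if suffix g w then Some (take (size w - size g) w) else None.

Lemma strip_prefixP g w v : strip_prefix g w = Some v <-> w = g ++ v.
Proof.
rewrite /strip_prefix; split=> [|->]; last by rewrite prefix_prefix drop_size_cat.
by case: prefixP => // -[u ->]; rewrite drop_size_cat// => -[->].
Qed.

Lemma strip_suffixP g w v : strip_suffix g w = Some v <-> w = v ++ g.
Proof.
rewrite /strip_suffix; split=> [|->].
  by case: suffixP => // -[u ->]; rewrite size_cat addnK take_size_cat// => -[->].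
by rewrite suffix_suffix size_cat addnK take_size_cat.
Qed.

Lemma sum_fibers (V : nmodType) (J : Type) (T : eqType) (I : seq J) (s : seq T)
    (key : J -> T) (F : J -> V) : uniq s -> (forall j, key j \notin s -> F j = 0) ->
  \sum_(g <- s) \sum_(j <- I | key j == g) F j = \sum_(j <- I) F j.
Proof.
move=> us F0; under eq_bigr do rewrite big_mkcond.
rewrite exchange_big/=; apply: eq_bigr => j _; rewrite -big_mkcond/=.
have [js|/F0 Fj] := boolP (key j \in s); last by rewrite big1// => g _.
rewrite -big_filter (_ : seq.filter _ s = [:: key j]) ?big_seq1//.
rewrite (seq.eq_filter (a2 := pred1 (key j))); first by rewrite filter_pred1_uniq.
by move=> g /=; rewrite eq_sym.
Qed.

Section sums.
Variables (V : nmodType) (F : word n -> word n -> V) (s : seq (word n)) (w : word n).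
Hypotheses (us : uniq s) (Fs : forall g v, g \notin s -> F g v = 0).

(** The prefixes of [w] are its cuts [take k w]. A sum of shifts indexed by the support [s] thus
    becomes, at coordinate [w], a sum over cuts as in [fps_mul]; prefixes missing from [s]
    contribute zero. *)
Lemma sum_strip_prefix :
  \sum_(g <- s) (if strip_prefix g w is Some v then F g v else 0) =
  \sum_(0 <= k < (size w).+1) F (take k w) (drop k w).
Proof.
rewrite -(@sum_fibers _ _ _ _ s (fun k => take k w)) => [|//|k /Fs //].
apply: eq_bigr => g _.
case E : (strip_prefix g w) => [v|].
  move/strip_prefixP : E => E.
  rewrite big_mkcond (bigD1_seq (size g)) ?iota_uniq//=; last first.
    by rewrite mem_index_iota E size_cat ltnS leq_addr.
  rewrite E take_size_cat// drop_size_cat// eqxx big_nat_cond big1 ?addr0// => k.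
  move=> /andP[/andP[_ kw] kg]; case: eqP => // /(congr1 size).
  rewrite size_takel// => kg'; first by rewrite kg' eqxx in kg.
rewrite big_nat_cond big1// => k /andP[_ /eqP kg].
have /strip_prefixP : w = g ++ drop k w by rewrite -kg cat_take_drop.
by rewrite E.
Qed.

Lemma sum_strip_suffix :
  \sum_(g <- s) (if strip_suffix g w is Some v then F g v else 0) =
  \sum_(0 <= k < (size w).+1) F (drop k w) (take k w).
Proof.
rewrite -(@sum_fibers _ _ _ _ s (fun k => drop k w)) => [|//|k /Fs //].
apply: eq_bigr => g _.
case E : (strip_suffix g w) => [v|].
  move/strip_suffixP : E => E.
  rewrite big_mkcond (bigD1_seq (size v)) ?iota_uniq//=; last first.
    by rewrite mem_index_iota E size_cat ltnS leq_addr.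
  rewrite E take_size_cat// drop_size_cat// eqxx big_nat_cond big1 ?addr0// => k.
  move=> /andP[/andP[_ kw] kg]; case: eqP => // /(congr1 size).
  rewrite size_drop size_cat => kg'; move: kg; rewrite ltnS size_cat in kw.
  by rewrite -(eqn_add2r (size g)) -[X in (_ + X)%N == _]kg' subnKC// eqxx.
rewrite big_nat_cond big1// => k /andP[_ /eqP kg].
have /strip_suffixP : w = take k w ++ g by rewrite -kg cat_take_drop.
by rewrite E.
Qed.

End sums.
End splitting.

Section weighted_shifts.
Variables (R : realType) (n m : nat) (p : ncpoly R n).
Hypothesis p_reg : positive_regular p.
Local Notation C := R[i].
Local Notation b := (bcoef p m.+1).

(** Weights are written as ratios [sqrtb v / sqrtb w] because these telescope along products of
    creation operators. *)
Definition sqrtb (w : word n) : C := sqrtC (b w).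

Lemma bcoef_gt0 w : 0 < b w.
Proof. by case: p_reg => p0 p1 pi; rewrite bcoefE// fps_geom_gt0. Qed.

Lemma bcoef_ge0 w : 0 <= b w. Proof. exact: ltW (bcoef_gt0 w). Qed.

Lemma sqrtb_gt0 w : 0 < sqrtb w. Proof. by rewrite sqrtC_gt0 bcoef_gt0. Qed.

Lemma sqrtb_neq0 w : sqrtb w != 0. Proof. by rewrite gt_eqF ?sqrtb_gt0. Qed.

Lemma sqrtbK w : sqrtb w ^+ 2 = b w. Proof. exact: sqrtCK. Qed.

Lemma sqrtb_nil : sqrtb [::] = 1. Proof. by rewrite /sqrtb/= sqrtC1. Qed.

Lemma sqrtb_ratio v w : sqrtC (b v / b w) = sqrtb v / sqrtb w.
Proof.
by rewrite sqrtCM ?nnegrE ?invr_ge0 ?bcoef_ge0// rootCV ?bcoef_ge0.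
Qed.

Lemma sqrtb_cons i w : sqrtb w / sqrtb (i :: w) <= sqrtC (p [:: i])^-1.
Proof.
have [p_ge0 p0 pi] := p_reg.
rewrite -sqrtb_ratio ler_sqrtC ?nnegrE ?divr_ge0 ?invr_ge0 ?bcoef_ge0//.
rewrite ler_pdivrMr ?bcoef_gt0// ler_pdivlMl//.
by rewrite !bcoefE// fps_geom_cons.
Qed.

Lemma sqrtb_rcons i w : sqrtb w / sqrtb (rcons w i) <= sqrtC (p [:: i])^-1.
Proof.
have [p_ge0 p0 pi] := p_reg.
rewrite -sqrtb_ratio ler_sqrtC ?nnegrE ?divr_ge0 ?invr_ge0 ?bcoef_ge0//.
rewrite ler_pdivrMr ?bcoef_gt0// ler_pdivlMl// mulrC.
by rewrite !bcoefE// fps_geom_rcons.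
Qed.

Lemma sqrtb_ratio_ge0 v w : 0 <= sqrtb v / sqrtb w.
Proof. by rewrite divr_ge0// ltW// sqrtb_gt0. Qed.

Lemma sqrtb_ratio_trans w u v : sqrtb u / sqrtb v = (sqrtb u / sqrtb w) * (sqrtb w / sqrtb v).
Proof. by rewrite mulrA divfK// sqrtb_neq0. Qed.

Lemma sqrtb_prefix g : exists G : C, forall v, sqrtb v / sqrtb (g ++ v) <= G.
Proof.
elim: g => [|i g [G GP]]; first by exists 1 => v; rewrite divff// sqrtb_neq0.
exists (G * sqrtC (p [:: i])^-1) => v; rewrite (sqrtb_ratio_trans (g ++ v)).
by rewrite ler_pM ?sqrtb_ratio_ge0// sqrtb_cons.
Qed.

Lemma sqrtb_suffix g : exists G : C, forall v, sqrtb v / sqrtb (v ++ g) <= G.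
Proof.
elim/last_ind: g => [|g i [G GP]].
  by exists 1 => v; rewrite cats0 divff// sqrtb_neq0.
exists (G * sqrtC (p [:: i])^-1) => v; rewrite (sqrtb_ratio_trans (v ++ g)).
by rewrite ler_pM ?sqrtb_ratio_ge0// -rcons_cat sqrtb_rcons.
Qed.

Section on_ell2.
Variables (K : hilbertType R) (B : 'B(K)).

Lemma mk_strip_shift (src : word n -> option (word n)) (dst : word n -> word n)
    (G : C) : (forall w v, src w = Some v <-> w = dst v) ->
  (forall v, sqrtb v / sqrtb (dst v) <= G) ->
  exists T : 'B(ell2 n K), forall u w,
    T u w = if src w is Some v then (sqrtb v / sqrtb w) *: B (u v) else 0.
Proof.
move=> srcP dstG.
pose g w := if src w is Some v then sqrtb v / sqrtb w else 0.
have G0 : 0 <= G := le_trans (sqrtb_ratio_ge0 [::] _) (dstG _).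
have [|||T TE] := @mk_shift _ _ K src g (Re G) B.
- by move=> w w1 w2 /srcP -> /srcP ->.
- by rewrite -(lecR 0) -ge0_realC.
- move=> w; rewrite -lecR -Defs.normcE -ge0_realC// /g.
  case E : (src w) => [v|]; last by rewrite normr0.
  by rewrite ger0_norm ?sqrtb_ratio_ge0//; move/srcP : E => ->.
by exists T => u w; rewrite TE /g; case: (src w).
Qed.

Lemma strip_shift_single (src : word n -> option (word n)) (dst : word n -> word n)
    (T : 'B(ell2 n K)) : (forall w v, src w = Some v <-> w = dst v) ->
  (forall u w,
    T u w = if src w is Some v then (sqrtb v / sqrtb w) *: B (u v) else 0) ->
  forall v x, T (single v x) = single (dst v) ((sqrtb v / sqrtb (dst v)) *: B x).
Proof.
move=> srcP TE v x; apply: ell2_ext => w; rewrite TE /=.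
have [->|wv] := eqVneq w (dst v).
  by have /srcP -> := erefl (dst v); rewrite eqxx.
case E : (src w) => [v'|//]; case: eqVneq => [vv|]; last by rewrite linear0 scaler0.
by move/srcP : E wv => ->; rewrite vv eqxx.
Qed.

End on_ell2.

Lemma single_evec (w : word n) (x : C) : single w x = x *: evec R w.
Proof.
apply: ell2_ext => v; rewrite ell2Z /=; case: eqVneq => _; last by rewrite scaler0.
by rewrite -[_ *: _]/(_ * _) mulr1.
Qed.

Lemma scaleC1 (a : C) : a *: (1 : C) = a. Proof. exact: mulr1. Qed.

(** The choice in [left_creation] defaults to [0], so a bounded operator with these values must be
    exhibited: a prefix shift, bounded thanks to [sqrtb_prefix]. *)
Lemma left_creation_evec i (w : word n) : left_creation p m.+1 i (evec R w) =
  (sqrtb w / sqrtb (i :: w)) *: evec R (i :: w).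
Proof.
rewrite -sqrtb_ratio /left_creation; case: xgetP => [T _ ->//|noT]; exfalso.
have [G GP] := sqrtb_prefix [:: i].
have [T TE] := mk_strip_shift (1 : 'B(C)) (strip_prefixP [:: i]) GP.
apply: (noT T) => v; rewrite sqrtb_ratio /evec (strip_shift_single (strip_prefixP [:: i]) TE).
by rewrite [LHS]single_evec bop1 scaleC1.
Qed.

Lemma right_creation_evec i (w : word n) : right_creation p m.+1 i (evec R w) =
  (sqrtb w / sqrtb (rcons w i)) *: evec R (rcons w i).
Proof.
rewrite -sqrtb_ratio /right_creation; case: xgetP => [T _ ->//|noT]; exfalso.
have [G GP] := sqrtb_suffix [:: i].
have [T TE] := mk_strip_shift (1 : 'B(C)) (strip_suffixP [:: i]) GP.
apply: (noT T) => v; rewrite sqrtb_ratio /evec (strip_shift_single (strip_suffixP [:: i]) TE).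
by rewrite [LHS]single_evec bop1 scaleC1 cats1.
Qed.

Lemma wprod_cons (H : hilbertType R) (Y : 'I_n -> 'B(H)) i w :
  wprod Y (i :: w) = Y i * wprod Y w.
Proof. by rewrite /wprod big_cons. Qed.

Lemma wprod_cat (H : hilbertType R) (Y : 'I_n -> 'B(H)) v w :
  wprod Y (v ++ w) = wprod Y v * wprod Y w.
Proof. by rewrite /wprod big_cat. Qed.

Lemma wprod_left_evec (g v : word n) : wprod (left_creation p m.+1) g (evec R v) =
  (sqrtb v / sqrtb (g ++ v)) *: evec R (g ++ v).
Proof.
elim: g => [|i g IH]; first by rewrite /wprod big_nil bop1 divff ?sqrtb_neq0// scale1r.
rewrite wprod_cons bopM IH linearZ/= left_creation_evec scalerA.
by rewrite -sqrtb_ratio_trans.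
Qed.

(** The rightmost operator acts first, so the letters of [g] are appended in reverse order. This
    explains the reversals in the reconstruction operator. *)
Lemma wprod_right_evec (g v : word n) : wprod (right_creation p m.+1) g (evec R v) =
  (sqrtb v / sqrtb (v ++ rev g)) *: evec R (v ++ rev g).
Proof.
elim: g => [|i g IH].
  by rewrite /wprod big_nil bop1 cats0 divff ?sqrtb_neq0// scale1r.
rewrite wprod_cons bopM IH linearZ/= right_creation_evec scalerA.
by rewrite -sqrtb_ratio_trans rev_cons -rcons_cat.
Qed.

Lemma wprod_leftE g (u : fock R n) w : wprod (left_creation p m.+1) g u w =
  if strip_prefix g w is Some v then (sqrtb v / sqrtb w) * u v else 0.
Proof.
have [G GP] := sqrtb_prefix g.
have [T TE] := mk_strip_shift (1 : 'B(C)) (strip_prefixP g) GP.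
suff -> : wprod (left_creation p m.+1) g = T by rewrite TE.
apply: bop_ext_single => v x.
rewrite (strip_shift_single (strip_prefixP g) TE) !single_evec linearZ/=.
by rewrite wprod_left_evec !scalerA mulrC.
Qed.

Lemma wprod_rightE g (u : fock R n) w : wprod (right_creation p m.+1) g u w =
  if strip_suffix (rev g) w is Some v then (sqrtb v / sqrtb w) * u v else 0.
Proof.
have [G GP] := sqrtb_suffix (rev g).
have [T TE] := mk_strip_shift (1 : 'B(C)) (strip_suffixP (rev g)) GP.
suff -> : wprod (right_creation p m.+1) g = T by rewrite TE.
apply: bop_ext_single => v x.
rewrite (strip_shift_single (strip_suffixP (rev g)) TE) !single_evec linearZ/=.
by rewrite wprod_right_evec !scalerA mulrC.
Qed.

Lemma adj_wprod_leftE g (u : fock R n) v :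
  adjop (wprod (left_creation p m.+1) g) u v = (sqrtb v / sqrtb (g ++ v)) * u (g ++ v).
Proof.
have := adjopP (wprod (left_creation p m.+1) g) (evec R v) u.
rewrite wprod_left_evec linearZl_LR/= !hdot_single => /(congr1 Num.conj).
rewrite -![hdot _ _]/(_ * _) !mul1r rmorphM/= !conjCK => <-.
by rewrite geC0_conj ?sqrtb_ratio_ge0.
Qed.

(** The shift with coefficient [B] acts as required on elementary tensors, so the choice in [tensop]
    succeeds. It agrees with that shift since every [single v x] is the elementary tensor of [e_v]
    and [x]. *)
Lemma tensop_rightE (H : hilbertType R) (B : 'B(H)) g (u : fockT n H) w :
  tensop (wprod (right_creation p m.+1) g) B u w =
  if strip_suffix (rev g) w is Some v then (sqrtb v / sqrtb w) *: B (u v) else 0.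
Proof.
have [G GP] := sqrtb_suffix (rev g).
have [T TE] := mk_strip_shift B (strip_suffixP (rev g)) GP.
have TP f h : T (tensv f h) = tensv (wprod (right_creation p m.+1) g f) (B h).
  apply: ell2_ext => v; rewrite TE /= wprod_rightE.
  by case: (strip_suffix _ _) => [v'|]; rewrite ?scale0r// linearZ/= scalerA.
suff -> : tensop (wprod (right_creation p m.+1) g) B = T by rewrite TE.
rewrite /tensop; case: xgetP => [S _ SP|noS]; last by exfalso; exact: noS TP.
apply: bop_ext_single => v x.
have -> : single v x = tensv (evec R v) x.
  by apply: ell2_ext => v' /=; case: eqVneq => _; rewrite ?scale1r ?scale0r.
by rewrite SP TP.
Qed.

End weighted_shifts.

(** * The weighted left creation operators belong to the domain *)

Section model.
Variables (R : realType) (n m : nat) (p : ncpoly R n).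
Hypothesis p_reg : positive_regular p.
Local Notation C := R[i].
Local Notation b := (bcoef p m.+1).
Local Notation sb := (sqrtb m p).
Local Notation W := (left_creation p m.+1).

Lemma ncpoly_support : exists2 s : seq (word n), uniq s & forall w, w \notin s -> p w = 0.
Proof.
case: p => f ff; have /finite_seqP[s sE] := ff.
exists (undup s); first exact: undup_uniq.
move=> w; rewrite mem_undup => ws; apply/eqP; rewrite -[_ == _]negbK; apply: contra ws => fw.
by have : [set w | f w != 0] w by []; rewrite sE.
Qed.

Lemma Phi_sum (s : seq (word n)) (H : hilbertType R) (Y : 'I_n -> 'B(H)) D : uniq s ->
  (forall w, w \notin s -> p w = 0) ->
  Phi p Y D = \sum_(g <- s) p g *: (wprod Y g * D * adjop (wprod Y g)).
Proof.
move=> us ps; rewrite /Phi (fsbigE s)//; last by move=> g _ /ps ->; rewrite scale0r.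
by apply: eq_bigl => g; exact: in_setT.
Qed.

Lemma bop_sum (H : hilbertType R) (I : Type) (s : seq I) (F : I -> 'B(H)) x :
  (\sum_(i <- s) F i) x = \sum_(i <- s) F i x.
Proof.
elim: s => [|i s IH]; first by rewrite !big_nil bop0.
by rewrite !big_cons bopD IH.
Qed.

(** [Phi] preserves diagonal operators, and in terms of the rescaled diagonal [b w * d w] it is left
    multiplication by the series [p]. *)
Lemma Phi_diagonal (D : 'B(fock R n)) (d : fps R n) : (forall u w, D u w = d w * u w) ->
  forall u w, Phi p W D u w = fps_mul p (fun v => b v * d v) w / b w * u w.
Proof.
move=> DE u w; have [s us ps] := ncpoly_support.
rewrite (Phi_sum _ _ us ps) bop_sum (@ell2_sum R n C).
pose F g v := p g * (b v * d v / b w * u w).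
rewrite (eq_bigr (fun g => if strip_prefix g w is Some v then F g v else 0)); last first.
  move=> g _; rewrite bopZ ell2Z !bopM wprod_leftE//.
  case E : (strip_prefix g w) => [v|]; last by rewrite scaler0.
  move/strip_prefixP : E => E.
  rewrite DE adj_wprod_leftE// -E -[_ *: _]/(_ * _) /F; congr (_ * _).
  rewrite -[b v](sqrtbK m p) -[b w](sqrtbK m p); field.
  exact: sqrtb_neq0.
rewrite sum_strip_prefix//; last by move=> g v /ps; rewrite /F => ->; rewrite mul0r.
by rewrite /fps_mul !mulr_suml; apply: eq_bigr => k _; rewrite /F !mulrA.
Qed.

(** The rescaled diagonal of the identity is [b], that is [(1 - p)^-(m+1)]. Each application of
    [id - Phi] multiplies it by [1 - p] and removes one factor, so up to [k = m + 1] the diagonal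
    keeps nonnegative coefficients. *)
Lemma left_creation_iter k : (k <= m.+1)%N -> forall u w,
  iter k (fun D => D - Phi p W D) 1 u w = fps_geom p (m.+1 - k) w / b w * u w.
Proof.
have [p_ge0 p0 _] := p_reg.
elim: k => [_ u w|k IH km u w].
  by rewrite subn0 -bcoefE// divff ?mul1r// gt_eqF// bcoef_gt0.
rewrite iterS bopD bopN ell2B (IH (ltnW km)) (Phi_diagonal (IH (ltnW km))).
rewrite -mulrBl -mulrBl; congr (_ / _ * _).
rewrite (@eq_fps_mul _ _ _ p _ (fps_geom p (m.+1 - k)))//; last first.
  by move=> v; rewrite mulrCA divff ?mulr1// gt_eqF// bcoef_gt0.
by rewrite subSn// subSS fps_geomSl// addrK.
Qed.

Lemma left_creation_ncdomain : ncdomain p m.+1 W.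
Proof.
have [p_ge0 p0 _] := p_reg.
move=> k /andP[_ km] u.
have hl := @ell2_dotP R n C (iter k (fun D => D - Phi p W D) 1 u) u.
rewrite -[hdot _ _]/(ell2_dot _ _); set l := ell2_dot _ _ in hl *.
have nn N : 0 <= series (homsum (fun w => hdot
    (iter k (fun D => D - Phi p W D) 1 u w) (u w))) N.
  rewrite /series/=; apply: sumr_ge0 => j _; apply: sumr_ge0 => w _.
  rewrite left_creation_iter// -[hdot _ _]/(_ * _) -mulrA mulr_ge0//.
    by rewrite divr_ge0 ?fps_geom_ge0// bcoef_ge0.
  by rewrite -normCK exprn_ge0.
move: hl nn; set v := series _ => hl nn.
(* The partial sums equal their moduli, hence so does the limit, and [l = |l|] is exactly
   nonnegativity in [R[i]]. *)
have hn : v @ \oo --> (`|l| : C).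
  rewrite (_ : v = fun N => `|v N|); first exact: cvg_norm.
  by apply/funext => N; rewrite ger0_norm.
by rewrite (cvg_unique (@norm_hausdorff _ _) hl hn).
Qed.

End model.

(** * The reconstruction operator *)

Section reconstruction.
Variables (R : realType) (n m : nat) (p : ncpoly R n) (H : hilbertType R).
Variable X : 'I_n -> 'B(H).
Hypothesis p_reg : positive_regular p.
Local Notation C := R[i].
Local Notation sb := (sqrtb m p).

(* For [c = 1] this is the reconstruction operator of [X]; in general it is that
   of [c X]. *)
Definition scaled_reconstruction (s : seq (word n)) (c : R) : 'B(fockT n H) :=
  \sum_(g <- s) (p g * c%:C%C ^+ size g) *:
    tensop (wprod (right_creation p m.+1) (rev g)) (adjop (wprod X g)).

Section support.
Variable s : seq (word n).
Hypotheses (us : uniq s) (ps : forall w, w \notin s -> p w = 0).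

(** Reindexing by [g = rev w] moves the reversal to the right creation operators, whose product
    along [rev g] appends [g] to a word. *)
Lemma reconstructionE : reconstruction p m.+1 X = scaled_reconstruction s 1.
Proof.
have [_ p0 _] := p_reg.
rewrite /reconstruction (fsbigE [seq rev g | g <- s & (0 < size g)%N]).
- rewrite big_map big_filter_cond /scaled_reconstruction.
  rewrite [RHS](bigID (fun g => 0 < size g)%N)/=.
  rewrite [X in _ = _ + X]big1 ?addr0; last first.
    by move=> g; rewrite -leqNgt leqn0 size_eq0 => /eqP ->; rewrite p0 mul0r scale0r.
  apply: eq_big => [g|g _]; last by rewrite revK expr1n mulr1.
  have [g0|//] := boolP (0 < size g)%N; rewrite /= (_ : _ \in _ = true)//.
  by apply/mem_set => /=; rewrite size_rev.
- by rewrite map_inj_uniq ?filter_uniq//; exact: inv_inj revK.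
- by move=> _ /mapP[g /[!mem_filter]/andP[g0 _] ->] /=; rewrite size_rev.
- move=> w /= w0 ws; rewrite ps ?scale0r//; apply: contra ws => ws.
  by apply/mapP; exists (rev w); rewrite ?revK// mem_filter size_rev w0.
Qed.

Lemma scaled_reconstruction_coord c (u : fockT n H) w :
  scaled_reconstruction s c u w =
  \sum_(0 <= k < (size w).+1) (p (drop k w) * c%:C%C ^+ size (drop k w)) *:
     ((sb (take k w) / sb w) *: adjop (wprod X (drop k w)) (u (take k w))).
Proof.
rewrite /scaled_reconstruction bop_sum (@ell2_sum R n H).
pose F g v := (p g * c%:C%C ^+ size g) *:
  ((sb v / sb w) *: adjop (wprod X g) (u v)).
rewrite -(@sum_strip_suffix _ _ F s)//; last first.
  by move=> g v /ps; rewrite /F => ->; rewrite mul0r scale0r.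
apply: eq_bigr => g _; rewrite bopZ ell2Z tensop_rightE// revK /F.
by case: (strip_suffix g w) => [v|]; rewrite ?scaler0.
Qed.

(* Creation raises the length of words, so the resolvent equation determines the
   coordinates at [w] from those at the proper prefixes of [w]. *)
Lemma resolvent_coord c (T : 'B(fockT n H)) (h : H) j w :
  (1 - scaled_reconstruction s c) * T = 1 ->
  (T ^+ j) (single [::] h) w =
    (c%:C%C ^+ size w * fps_geom p j w / sb w) *: adjop (wprod X w) h.
Proof.
have [p_ge0 p0 _] := p_reg => T1; elim: j w => [|j IH] w.
  rewrite expr0 bop1 fps_geom0 /fps_one /=; case: eqVneq => [->|_].
    by rewrite expr0 mul1r sqrtb_nil divr1 scale1r /wprod big_nil adjop1 bop1.
  by rewrite mulr0 mul0r scale0r.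
(* For fixed power, a second induction on the length of [w]: the coordinate at [w] refers to the
   same power at shorter words and to the previous power at [w]. *)
have [N] := ubnP (size w); elim: N w => // N IHN w; rewrite ltnS => wN.
have rec : (T ^+ j.+1) (single [::] h) w = (T ^+ j) (single [::] h) w +
    scaled_reconstruction s c ((T ^+ j.+1) (single [::] h)) w.
  have : (1 - scaled_reconstruction s c) ((T ^+ j.+1) (single [::] h)) =
      (T ^+ j) (single [::] h) by rewrite exprS -!bopM mulrA T1 mul1r.
  by move=> <-; rewrite bopD bopN ell2B bop1 subrK.
(* The last cut has the empty word as suffix and vanishes because [p [::] = 0]; only proper prefixes
   remain. *)
rewrite rec IH scaled_reconstruction_coord big_nat_recr//= drop_size p0 mul0r scale0r addr0.
rewrite (eq_big_nat _ _ (F2 := fun k => (c%:C%C ^+ size w / sb w *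
    (fps_geom p j.+1 (take k w) * p (drop k w))) *: adjop (wprod X w) h)); last first.
  move=> k /andP[_ kw]; rewrite IHN ?size_takel ?(ltnW kw)//; last exact: leq_trans kw wN.
  (* Adjoints reverse products: [X_g^* X_v^* = (X_v X_g)^* = X_w^*] for [w = v g]. So all terms
     carry the same vector and only scalars remain to be summed. *)
  rewrite [X in _ *: (_ *: X) = _]linearZ/= -bopM -adjopM -wprod_cat cat_take_drop !scalerA.
  congr (_ *: _).
  rewrite -[in RHS](cat_take_drop k w) size_cat exprD cat_take_drop size_takel ?(ltnW kw)//.
  by field; rewrite !sqrtb_neq0.
rewrite -scaler_suml -scalerDl; congr (_ *: _).
rewrite -mulr_sumr fps_geomSr// /fps_mul [in RHS]big_nat_recr//= drop_size p0 mulr0 addr0.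
by rewrite mulrDr mulrDl; congr (_ + _); rewrite mulrAC.
Qed.

(** The left side is a partial sum of squared coordinates of [T ^+ m.+1] applied to [single [::] h].
    At this power the coefficient [fps_geom] is [b] itself, and [b w / sqrtb w = sqrtb w]. *)
Lemma kernel_bound_of_resolvent c (T : 'B(fockT n H)) :
  (1 - scaled_reconstruction s c) * T = 1 -> forall h N,
  \sum_(w <- words n N) nr ((c%:C%C ^+ size w * sb w) *: adjop (wprod X w) h) ^+ 2 <=
  (nr (T ^+ m.+1) * nr h) ^+ 2.
Proof.
move=> T1 h N; have [_ p0 _] := p_reg.
rewrite -(nr_single (n := n) [::] h).
rewrite (@le_trans _ _ (nr ((T ^+ m.+1) (single [::] h)) ^+ 2))//; last first.
  by rewrite ler_pXn2r ?nnegrE ?mulr_ge0 ?nr_ge0// nr_bop_le.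
rewrite (le_trans _ (sum_sqr_le _ (words_uniq n N)))//.
rewrite le_eqVlt; apply/orP; left; apply/eqP; apply: eq_bigr => w _.
rewrite (resolvent_coord _ _ _ T1) -bcoefE// -(sqrtbK m p).
by rewrite expr2 mulrA mulfK// sqrtb_neq0.
Qed.

End support.

Lemma cvg_scaled_reconstruction s (c : nat -> R) : c @ \oo --> (1 : R) ->
  (fun k => scaled_reconstruction s (c k)) @ \oo --> scaled_reconstruction s 1.
Proof.
move=> c1; rewrite /scaled_reconstruction.
apply: cvg_big => [|g _]; first exact: add_continuous.
apply: cvgZr_tmp; apply: cvgMl_tmp.
rewrite (_ : (fun k => _) = fun k => (c k ^+ size g)%:C%C); last first.
  by apply/funext => k; rewrite realCX.
rewrite -realCX; apply: cvg_realC; elim: (size g) => [|j IH]; first exact: cvg_cst.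
rewrite (_ : (fun k => _) = fun k => c k * c k ^+ j); last first.
  by apply/funext => k; rewrite exprS.
by rewrite exprS; exact: cvgM.
Qed.

Lemma kernel_bound (r : nat -> R) : (forall k, 0 < r k < 1) -> r @ \oo --> (1 : R) ->
  spectral_radius (reconstruction p m.+1 X) < 1 ->
  exists k0, forall k, (k0 <= k)%N -> exists2 M : R, 0 <= M & forall h N,
    \sum_(w <- words n N)
      nr (((r k)^-1%:C%C ^+ size w * sb w) *: adjop (wprod X w) h) ^+ 2 <=
    (M * nr h) ^+ 2.
Proof.
move=> r01 r1 X1; have [s us ps] := ncpoly_support p.
move: X1; rewrite (reconstructionE us ps) => /spectral_radius_lt1[S [S1 S2]].
have rV : (fun k => (r k)^-1) @ \oo --> (1 : R).
  by rewrite -invr1; apply: cvgV => //; exact: oner_neq0.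
(* A perturbation smaller than this keeps [|S| |E| < 1]; the [1] covers the case [S = 0]. *)
have e0 : 0 < (nr S + 1)^-1 by rewrite invr_gt0 ltr_pwDr ?nr_ge0.
have /cvg_nrP/(_ _ e0)[k0 k0P] := @cvg_scaled_reconstruction s _ rV.
exists k0 => k /k0P kP.
have [T [_ T1]] : bop_invertible (1 - scaled_reconstruction s (r k)^-1).
  rewrite (_ : _ - _ = (1 - scaled_reconstruction s 1) -
    (scaled_reconstruction s (r k)^-1 - scaled_reconstruction s 1)); last first.
    by rewrite opprB addrA subrK.
  apply: (invertible_perturb S1 S2); rewrite nrBC.
  rewrite (@le_lt_trans _ _ (nr S * (nr S + 1)^-1))//.
    by rewrite ler_wpM2l ?nr_ge0// ltW.
  by rewrite ltr_pdivrMr ?mul1r ?ltrDl// ltr_pwDr ?nr_ge0.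
by exists (nr (T ^+ m.+1)); [exact: nr_ge0|exact: (kernel_bound_of_resolvent us ps T1)].
Qed.

End reconstruction.

(** * Evaluation bounds *)

Section cauchy_schwarz.
Variable R : realType.

Lemma sum_cauchy_schwarz (I : Type) (s : seq I) (f g : I -> R) :
  (\sum_(i <- s) f i * g i) ^+ 2 <=
  (\sum_(i <- s) f i ^+ 2) * (\sum_(i <- s) g i ^+ 2).
Proof.
elim: s => [|i s IH]; first by rewrite !big_nil expr0n mul0r.
rewrite !big_cons; move: IH.
have : 0 <= \sum_(j <- s) f j ^+ 2 by apply: sumr_ge0 => j _; exact: sqr_ge0.
have : 0 <= \sum_(j <- s) g j ^+ 2 by apply: sumr_ge0 => j _; exact: sqr_ge0.
move: (\sum_(j <- s) f j * g j) (\sum_(j <- s) f j ^+ 2) (\sum_(j <- s) g j ^+ 2).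
move=> S P Q Q0 P0 SPQ; set x := f i; set y := g i.
(* Arithmetic-geometric mean for [x^2 Q] and [y^2 P], whose product dominates [(x y S)^2] by the
   induction hypothesis. *)
have h : 2 * (x * y * S) <= x ^+ 2 * Q + y ^+ 2 * P.
  have h0 : 0 <= x ^+ 2 * Q + y ^+ 2 * P by rewrite addr_ge0// mulr_ge0// sqr_ge0.
  rewrite (le_trans (ler_norm _))// -(@ler_pXn2r _ 2)// ?nnegrE// real_normK ?num_real//.
  rewrite (@le_trans _ _ (4 * (x * y) ^+ 2 * (P * Q)))//.
    rewrite (_ : (2 * _) ^+ 2 = 4 * (x * y) ^+ 2 * S ^+ 2); last by ring.
    by rewrite ler_wpM2l// mulr_ge0// sqr_ge0.
  by have := sqr_ge0 (x ^+ 2 * Q - y ^+ 2 * P); nra.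
by nra.
Qed.

Lemma sum_mul_le (I : Type) (s : seq I) (f g : I -> R) (A B : R) :
  0 <= A -> 0 <= B -> \sum_(i <- s) f i ^+ 2 <= A ^+ 2 ->
  \sum_(i <- s) g i ^+ 2 <= B ^+ 2 -> \sum_(i <- s) f i * g i <= A * B.
Proof.
move=> A0 B0 fA gB; rewrite (le_trans (ler_norm _))//.
rewrite -(@ler_pXn2r _ 2)// ?nnegrE ?mulr_ge0// real_normK ?num_real//.
rewrite (le_trans (sum_cauchy_schwarz _ _ _))// exprMn ler_pM//.
all: by apply: sumr_ge0 => j _; exact: sqr_ge0.
Qed.

Lemma nrCM (x y : R[i]) : nr (x * y) = nr x * nr y.
Proof. exact: (nrZ x (y : R[i])). Qed.

Lemma nr_conj (x : R[i]) : nr (x^*) = nr x.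
Proof. by rewrite /nr norm_conjC. Qed.

End cauchy_schwarz.

Section word_series.
Variables (R : realType) (n : nat) (H : hilbertType R) (Y : 'I_n -> 'B(H)).
Implicit Types (c d : fps R n).

Lemma hol_sumsE c N : hol_sums c Y N = \sum_(w <- words n N) c w *: wprod Y w.
Proof. exact: sum_words. Qed.

Lemma antihol_sumsE d N : d [::] = 0 ->
  antihol_sums d Y N = \sum_(w <- words n N) d w *: adjop (wprod Y w).
Proof.
move=> d0; rewrite -sum_words /antihol_sums; case: N => [|N]; first by rewrite !big_geq.
rewrite [RHS]big_ltn// [X in X + _](_ : _ = 0) ?add0r// /homsum big1// => w _.
by rewrite tuple0 /= d0 scale0r.
Qed.

Lemma hol_sums_linear a c c' : hol_sums (a *: c + c') Y = a *: hol_sums c Y + hol_sums c' Y.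
Proof.
apply/funext => N; rewrite [in RHS]/GRing.add/= [in RHS]/GRing.scale/= !hol_sumsE.
by rewrite scaler_sumr -big_split/=; apply: eq_bigr => w _; rewrite scalerDl scalerA.
Qed.

Lemma antihol_sums_linear a c c' :
  antihol_sums (a *: c + c') Y = a *: antihol_sums c Y + antihol_sums c' Y.
Proof.
apply/funext => N; rewrite [in RHS]/GRing.add/= [in RHS]/GRing.scale/= /antihol_sums.
rewrite scaler_sumr -big_split/=; apply: eq_bigr => k _; rewrite /homsum.
by rewrite scaler_sumr -big_split/=; apply: eq_bigr => w _; rewrite scalerDl scalerA.
Qed.

Lemma words_tail (V : zmodType) (F : word n -> V) N k : (N <= k)%N ->
  \sum_(w <- words n k) F w - \sum_(w <- words n N) F w =
  \sum_(w <- [seq w <- words n k | w \notin words n N]) F w.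
Proof.
move=> Nk; rewrite (@sum_subwords _ _ F k (words n N)) ?words_uniq//; last first.
  by move=> w; rewrite mem_words => /leq_trans; apply.
by rewrite (bigID (fun w => w \in words n N))/= addrAC subrr add0r big_filter.
Qed.

End word_series.

Section evaluation.
Variables (R : realType) (n m : nat) (p : ncpoly R n) (H : hilbertType R).
Variable X : 'I_n -> 'B(H).
Hypothesis p_reg : positive_regular p.
Local Notation C := R[i].
Local Notation sb := (sqrtb m p).
Variables (t M : R).
Hypotheses (t0 : 0 < t) (M0 : 0 <= M).
Hypothesis kernelX : forall h N,
  \sum_(w <- words n N) nr ((t^-1%:C%C ^+ size w * sb w) *: adjop (wprod X w) h) ^+ 2
  <= (M * nr h) ^+ 2.

(* The coordinates of [F(tW) e_1], for [F] with coefficients [c]. *)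
Definition weighted (c : fps R n) : fps R n := fun w => c w * t%:C%C ^+ size w / sb w.

Lemma weighted_conj c w : nr (weighted (fun v => (c v)^*) w) = nr (weighted c w).
Proof. by rewrite /weighted -!mulrA nrCM nr_conj -nrCM. Qed.

Lemma nr_antihol_le c (s : seq (word n)) (A : R) : uniq s -> 0 <= A ->
  \sum_(w <- s) nr (weighted c w) ^+ 2 <= A ^+ 2 ->
  nr (\sum_(w <- s) c w *: adjop (wprod X w)) <= M * A.
Proof.
move=> us A0 cA; have tC : t%:C%C != 0 :> C by rewrite fmorph_eq0 gt_eqF.
apply: nr_bop_ub => [|h]; first exact: mulr_ge0.
(* The factors [t^|w| / sqrtb w] and their inverses are inserted so that Cauchy-Schwarz pairs
   [weighted c] with [kernelX]. *)
rewrite bop_sum (eq_bigr (fun w => weighted c w *: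
    ((t^-1%:C%C ^+ size w * sb w) *: adjop (wprod X w) h))); last first.
  move=> w _; rewrite bopZ scalerA; congr (_ *: _).
  rewrite /weighted [t^-1%:C%C]fmorphV exprVn; field.
  by rewrite sqrtb_neq0// expf_neq0.
rewrite (le_trans (nr_sum _ _ _))//; under eq_bigr do rewrite nrZ.
rewrite mulrAC mulrC; apply: sum_mul_le; rewrite ?mulr_ge0 ?nr_ge0//.
have [N sN] := words_bound s.
apply: le_trans (kernelX h N); apply: le_sum_words => // w; exact: sqr_ge0.
Qed.

(** The kernel bound concerns [X_w^*], so the sum is replaced by its adjoint; conjugating the
    coefficients does not change their moduli. *)
Lemma nr_hol_le c (s : seq (word n)) (A : R) : uniq s -> 0 <= A ->
  \sum_(w <- s) nr (weighted c w) ^+ 2 <= A ^+ 2 ->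
  nr (\sum_(w <- s) c w *: wprod X w) <= M * A.
Proof.
move=> us A0 cA; rewrite -nr_adjop adjop_sum.
under eq_bigr do rewrite adjopZ.
by apply: nr_antihol_le => //; under eq_bigr do rewrite weighted_conj.
Qed.

(** The estimate is assumed on every finite set of words because it is applied to tails, whose
    square sums tend to zero. The abstract [F] covers both the analytic and the antianalytic
    series. *)
Lemma weighted_series_cvg (F : word n -> 'B(H)) c (A : R) : 0 <= A ->
  (forall N, \sum_(w <- words n N) nr (weighted c w) ^+ 2 <= A ^+ 2) ->
  (forall s B, uniq s -> 0 <= B -> \sum_(w <- s) nr (weighted c w) ^+ 2 <= B ^+ 2 ->
    nr (\sum_(w <- s) F w) <= M * B) ->
  cvgn (fun N => \sum_(w <- words n N) F w) /\
  nr (limn (fun N => \sum_(w <- words n N) F w)) <= M * A.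
Proof.
move=> A0 cA FP.
have cF : cvgn (fun N => \sum_(w <- words n N) F w).
  pose q N := \sum_(w <- words n N) nr (weighted c w) ^+ 2.
  have qnd : nondecreasing_seq q.
    move=> N k Nk; apply: le_sum_words; rewrite ?words_uniq//.
      by move=> w; exact: sqr_ge0.
    by move=> w; rewrite mem_words => wN; exact: leq_trans wN Nk.
  have qc : cvgn q.
    by apply: nondecreasing_is_cvgn => //; exists (A ^+ 2) => _ [N _ <-]; exact: cA.
  apply: cauchy_nr => e e0.
  have M10 : 0 < M + 1 by rewrite ltr_wpDl.
  have e20 : 0 < (e / (M + 1)) ^+ 2 by rewrite exprn_gt0// divr_gt0.
  have /cvgrPdist_lt/(_ _ e20)[N _ NP] : q @ \oo --> limn q by exact: qc.
  exists N => k Nk; rewrite words_tail//.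
  rewrite (@le_lt_trans _ _ (M * (e / (M + 1))))//.
    apply: FP; first by rewrite filter_uniq ?words_uniq.
      by rewrite ltW// divr_gt0.
    rewrite -(words_tail _ Nk) (le_trans _ (ltW (NP N (leqnn N))))//.
    rewrite (le_trans _ (ler_norm _))// lerD2r.
    exact: nondecreasing_cvgn_le.
  by rewrite mulrCA gtr_pMr// ltr_pdivrMr// mul1r ltrDl.
split=> //; apply: nr_limn_le => // N; apply: FP => //; exact: words_uniq.
Qed.

Lemma hol_sums_cvg c (A : R) : 0 <= A ->
  (forall N, \sum_(w <- words n N) nr (weighted c w) ^+ 2 <= A ^+ 2) ->
  cvgn (hol_sums c X) /\ nr (limn (hol_sums c X)) <= M * A.
Proof.
move=> A0 cA; rewrite (_ : hol_sums c X = fun N => \sum_(w <- words n N) c w *: wprod X w).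
  by apply: weighted_series_cvg => // s B us B0; exact: nr_hol_le.
by apply/funext => N; rewrite hol_sumsE.
Qed.

Lemma antihol_sums_cvg d (A : R) : d [::] = 0 -> 0 <= A ->
  (forall N, \sum_(w <- words n N) nr (weighted d w) ^+ 2 <= A ^+ 2) ->
  cvgn (antihol_sums d X) /\ nr (limn (antihol_sums d X)) <= M * A.
Proof.
move=> d0 A0 cA.
rewrite (_ : antihol_sums d X = fun N => \sum_(w <- words n N) d w *: adjop (wprod X w)).
  by apply: weighted_series_cvg => // s B us B0; exact: nr_antihol_le.
by apply/funext => N; rewrite antihol_sumsE.
Qed.

End evaluation.

(** * Recovering the coefficients of [G] from [G(tW)] *)

Section model_coefficients.
Variables (R : realType) (n m : nat) (p : ncpoly R n).
Hypothesis p_reg : positive_regular p.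
Local Notation C := R[i].
Local Notation sb := (sqrtb m p).
Variable t : R.
Local Notation tW := (fun i => t%:C%C *: left_creation p m.+1 i).

Lemma bopZM (H : hilbertType R) (a b : C) (S T : 'B(H)) :
  (a *: S) * (b *: T) = (a * b) *: (S * T).
Proof. by apply: bop_ext => x; rewrite !(bopM, bopZ) linearZ/= scalerA. Qed.

Lemma wprodZ (H : hilbertType R) (a : C) (Y : 'I_n -> 'B(H)) w :
  wprod (fun i => a *: Y i) w = a ^+ size w *: wprod Y w.
Proof.
elim: w => [|i w IH]; first by rewrite /wprod !big_nil scale1r.
by rewrite !wprod_cons IH bopZM exprS.
Qed.

(** Matrix coefficients of the partial sums at [tW] are eventually constant, so those of the limit
    operator can be computed exactly. *)
Lemma lim_coord (u : nat -> 'B(fock R n)) x w (a : C) N0 : cvgn u ->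
  (forall N, (N0 <= N)%N -> u N x w = a) -> limn u x w = a.
Proof.
move=> cu ua; have h := @cvg_coord R n C _ _ w (cvg_bopv (x := x) cu).
apply: (cvg_unique (@norm_hausdorff _ _) h).
by apply: cvg_near_cst; exists N0 => // N; exact: ua.
Qed.

Lemma sum_single_word (F : word n -> C) v N : (size v < N)%N ->
  (forall w, w != v -> F w = 0) -> \sum_(w <- words n N) F w = F v.
Proof.
move=> vN F0; rewrite (bigD1_seq v) ?words_uniq ?mem_words//= big1 ?addr0//.
Qed.

Lemma hol_coord_vacuum c v : cvgn (hol_sums c tW) ->
  limn (hol_sums c tW) (evec R [::]) v = weighted m p t c v.
Proof.
move=> cc; apply: (lim_coord (N0 := (size v).+1)) => // N vN.
rewrite hol_sumsE bop_sum (@ell2_sum R n C).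
have E w : (c w *: wprod tW w) (evec R [::]) v =
    if w == v then weighted m p t c w else 0.
  rewrite wprodZ scalerA bopZ wprod_left_evec// !ell2Z cats0 sqrtb_nil div1r /=.
  rewrite eq_sym; case: eqVneq => _; last by rewrite !scaler0.
  by rewrite scaleC1.
rewrite (sum_single_word (v := v))//; first by rewrite E eqxx.
by move=> w wv; rewrite E (negbTE wv).
Qed.

Lemma antihol_coord_vacuum d v : d [::] = 0 -> cvgn (antihol_sums d tW) ->
  limn (antihol_sums d tW) (evec R [::]) v = 0.
Proof.
move=> d0 cd; apply: (lim_coord (N0 := 0)) => // N _.
rewrite antihol_sumsE// bop_sum (@ell2_sum R n C) big1// => w _.
rewrite wprodZ adjopZ scalerA bopZ ell2Z adj_wprod_leftE//=.
by case: w => [|i w]; rewrite ?d0 ?mul0r ?scale0r//= mulr0 scaler0.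
Qed.

Lemma hol_vacuum_coord c v : cvgn (hol_sums c tW) ->
  limn (hol_sums c tW) (evec R v) [::] = if v == [::] then c [::] else 0.
Proof.
move=> cc; apply: (lim_coord (N0 := 1)) => // N N0.
rewrite hol_sumsE bop_sum (@ell2_sum R n C).
rewrite (sum_single_word (v := [::]))//.
  rewrite wprodZ scalerA bopZ wprod_left_evec// !ell2Z /= mulr1 divff ?sqrtb_neq0//.
  by case: v => [|i v]; rewrite ?scaler0//= scale1r scaleC1.
move=> w w0; rewrite wprodZ scalerA bopZ wprod_left_evec// !ell2Z /=.
by case: w w0 => [|i w]//= _; rewrite !scaler0.
Qed.

Lemma antihol_vacuum_coord d v : d [::] = 0 -> cvgn (antihol_sums d tW) ->
  limn (antihol_sums d tW) (evec R v) [::] = weighted m p t d v.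
Proof.
move=> d0 cd; apply: (lim_coord (N0 := (size v).+1)) => // N vN.
rewrite antihol_sumsE// bop_sum (@ell2_sum R n C).
have E w : (d w *: adjop (wprod tW w)) (evec R v) [::] =
    if w == v then weighted m p t d w else 0.
  rewrite wprodZ adjopZ scalerA bopZ ell2Z adj_wprod_leftE//= cats0 sqrtb_nil div1r.
  rewrite rmorphXn/= realC_conj.
  case: eqVneq => _; last by rewrite mulr0 scaler0.
  by rewrite mulr1.
rewrite (sum_single_word (v := v))//; first by rewrite E eqxx.
by move=> w wv; rewrite E (negbTE wv).
Qed.

Lemma nr_evec (w : word n) : nr (evec R w) = 1.
Proof. by rewrite nr_single /nr normr1. Qed.

Lemma weighted_hol_le (G : fps R n * fps R n) N : G.1 [::] = 0 ->
  cvgn (antihol_sums G.1 tW) -> cvgn (hol_sums G.2 tW) ->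
  \sum_(w <- words n N) nr (weighted m p t G.2 w) ^+ 2 <= nr (har_eval tW G) ^+ 2.
Proof.
move=> G0 cd cc; set V := har_eval tW G.
have VE v : V (evec R [::]) v = weighted m p t G.2 v.
  by rewrite /V bopD ell2D hol_coord_vacuum// antihol_coord_vacuum// add0r.
rewrite (@le_trans _ _ (nr (V (evec R [::])) ^+ 2))//; last first.
  rewrite ler_pXn2r ?nnegrE ?nr_ge0// (le_trans (nr_bop_le _ _))//.
  by rewrite nr_evec mulr1.
under eq_bigr do rewrite -VE.
exact: (@sum_sqr_le R n C _ _ (words_uniq n N)).
Qed.

Lemma weighted_antihol_le (G : fps R n * fps R n) N : G.1 [::] = 0 ->
  cvgn (antihol_sums G.1 tW) -> cvgn (hol_sums G.2 tW) ->
  \sum_(w <- words n N) nr (weighted m p t G.1 w) ^+ 2 <= nr (har_eval tW G) ^+ 2.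
Proof.
move=> G0 cd cc; set V := har_eval tW G.
(* The analytic part contributes only its constant term, at the empty word. There [weighted] of
   [G.1] vanishes, so this extra term can only increase the square sum. *)
have VE v : (adjop V (evec R [::]) v)^* =
    weighted m p t G.1 v + if v == [::] then G.2 [::] else 0.
  have := adjopP V (evec R v) (evec R [::]); rewrite hdot_single hdotC hdot_single.
  rewrite -![hdot _ _]/(_ * _) !mul1r conjCK => <-.
  by rewrite /V bopD ell2D hol_vacuum_coord// antihol_vacuum_coord.
rewrite -(nr_adjop V) (@le_trans _ _ (nr (adjop V (evec R [::])) ^+ 2))//; last first.
  rewrite ler_pXn2r ?nnegrE ?nr_ge0// (le_trans (nr_bop_le _ _))//.
  by rewrite nr_evec mulr1.
rewrite (le_trans _ (@sum_sqr_le R n C _ _ (words_uniq n N)))//.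
apply: ler_sum => w _; rewrite -(nr_conj (adjop V _ w)) VE.
case: eqVneq => [->|_]; last by rewrite addr0.
by rewrite /weighted G0 !mul0r nr0 expr0n sqr_ge0.
Qed.

End model_coefficients.

(** * Metric and polynomials *)

Section metric.
Variable R : realType.
Implicit Type x : nat -> R.

Let term x k : R := 2 ^- k.+1 * (x k / (1 + x k)).

Lemma sum_halves L : \sum_(0 <= k < L) (2 ^- k.+1 : R) = 1 - 2 ^- L.
Proof.
elim: L => [|L IH]; first by rewrite big_nil expr0 invr1 subrr.
by rewrite big_nat_recr//= IH exprS invfM; lra.
Qed.

Lemma frac_ge0 (a : R) : 0 <= a -> 0 <= a / (1 + a).
Proof. by move=> a0; rewrite divr_ge0// addr_ge0. Qed.

Lemma frac_le1 (a : R) : 0 <= a -> a / (1 + a) <= 1.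
Proof.
by move=> a0; rewrite ler_pdivrMr ?ltr_wpDr// mul1r lerDr.
Qed.

Lemma frac_le (a : R) : 0 <= a -> a / (1 + a) <= a.
Proof.
move=> a0; rewrite ler_pdivrMr ?ltr_wpDr// mulrDr mulr1 lerDl.
exact: mulr_ge0.
Qed.

Lemma frac_lt (a e : R) : 0 <= a -> 0 <= e -> a / (1 + a) < e / (1 + e) -> a < e.
Proof.
move=> a0 e0; have a1 : 0 < 1 + a by rewrite ltr_wpDr.
have e1 : 0 < 1 + e by rewrite ltr_wpDr.
by rewrite ltr_pdivrMr// mulrAC ltr_pdivlMr//; lra.
Qed.

Lemma half_gt0 k : 0 < (2 ^- k : R). Proof. by rewrite invr_gt0 exprn_gt0. Qed.

Section nonneg.
Variable x : nat -> R.
Hypothesis x0 : forall k, 0 <= x k.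

Lemma metric_term_ge0 k : 0 <= term x k.
Proof. by rewrite mulr_ge0 ?(ltW (half_gt0 _)) ?frac_ge0. Qed.

Lemma metric_term_le k : term x k <= 2 ^- k.+1.
Proof. by rewrite ler_piMr ?(ltW (half_gt0 _)) ?frac_le1. Qed.

Lemma metric_cvg : cvgn (series (term x)).
Proof.
apply: nondecreasing_is_cvgn.
  by apply/nondecreasing_seqP => N; rewrite /series/= big_nat_recr//= lerDl metric_term_ge0.
exists 1 => _ [N _ <-]; rewrite /series/=.
rewrite (@le_trans _ _ (1 - 2 ^- N))//; last by rewrite gerBl ltW// half_gt0.
by rewrite -sum_halves; apply: ler_sum => k _; exact: metric_term_le.
Qed.

Lemma metric_ge k : term x k <= limn (series (term x)).
Proof.
rewrite (@le_trans _ _ (series (term x) k.+1))//.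
  rewrite /series/= big_nat_recr//= lerDr; apply: sumr_ge0 => j _; exact: metric_term_ge0.
apply: nondecreasing_cvgn_le; last exact: metric_cvg.
by apply/nondecreasing_seqP => N; rewrite /series/= big_nat_recr//= lerDl metric_term_ge0.
Qed.

(** Terms beyond [K] add up to at most [2^-K] whatever [x] is, so smallness in the metric is a
    condition on finitely many radii. The first [K] terms give at most [e] since the weights sum to
    less than [1]. *)
Lemma metric_le (e : R) K : 0 <= e -> (forall k, (k < K)%N -> x k <= e) ->
  limn (series (term x)) <= e + 2 ^- K.
Proof.
move=> e0 xe; apply: limr_le; first exact: metric_cvg.
apply: nearW => L; rewrite /series/=.
rewrite (@le_trans _ _ (\sum_(0 <= k < maxn K L) term x k))//.
  rewrite [leRHS](big_cat_nat _ (n := L)) ?leq_maxr//= lerDl.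
  by apply: sumr_ge0 => j _; exact: metric_term_ge0.
rewrite (big_cat_nat _ (n := K)) ?leq_maxl//= lerD//.
  rewrite (@le_trans _ _ (\sum_(0 <= k < K) 2 ^- k.+1 * e))//.
    rewrite big_nat [leRHS]big_nat; apply: ler_sum => k /andP[_ kK].
    by rewrite ler_wpM2l ?(ltW (half_gt0 _))// (le_trans (frac_le _))// xe.
  by rewrite -mulr_suml sum_halves ler_piMl// gerBl ltW// half_gt0.
rewrite (@le_trans _ _ (\sum_(K <= k < maxn K L) 2 ^- k.+1))//.
  by apply: ler_sum => k _; exact: metric_term_le.
have := sum_halves (maxn K L); rewrite (big_cat_nat _ (n := K)) ?leq_maxl//= sum_halves.
have := half_gt0 (maxn K L).
by move: (\sum_(_ <= k < _) _) (2 ^- K) (2 ^- maxn K L) => S a b; lra.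
Qed.

End nonneg.
End metric.

Section polynomials.
Variables (R : realType) (n : nat).
Local Notation C := R[i].
Implicit Types (F G : fps R n) (u v w : word n).

Definition monomial u : fps R n := fun w => (w == u)%:R.

Definition fps_trunc F N : fps R n := \sum_(u <- words n N) F u *: monomial u.

Lemma fps_sumE (s : seq (word n)) (F : word n -> fps R n) w :
  (\sum_(u <- s) F u) w = \sum_(u <- s) F u w.
Proof. by elim: s => [|u s IH]; rewrite ?big_nil// !big_cons -IH. Qed.

Lemma fps_truncE F N w : fps_trunc F N w = if (size w < N)%N then F w else 0.
Proof.
rewrite /fps_trunc fps_sumE -mem_words.
have E u : (F u *: monomial u) w = if u == w then F w else 0.
  rewrite -[LHS]/(F u * (w == u)%:R) eq_sym.
  by case: eqVneq => [->|_]; rewrite ?mulr1 ?mulr0.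
rewrite (eq_bigr _ (fun u _ => E u)) -big_mkcond/= -big_filter.
have [wN|wN] := boolP (w \in words n N).
  by rewrite filter_pred1_uniq ?words_uniq// big_seq1.
rewrite (_ : [seq i <- words n N | i == w] = [::]) ?big_nil//.
apply/eqP; rewrite -[_ == _]negbK -has_filter; apply: contra wN.
by move=> /hasP[u uN /eqP <-].
Qed.

Lemma monomial_nil : monomial [::] = @fps_one R n. Proof. by []. Qed.

Lemma fps_var_mul i G w : fps_mul (@fps_var R n i) G w =
  if w is j :: v then (if j == i then G v else 0) else 0.
Proof.
case: w => [|j v]; first by rewrite fps_mul0 /fps_var mul0r.
rewrite fps_mul_cons {1}/fps_var/= mul0r add0r.
case: eqVneq => [->|ji].
  rewrite -[RHS]fps_mul1l; apply: eq_fps_mul => // w.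
  by rewrite /fps_var /fps_one eqseq_cons eqxx.
rewrite /fps_mul big1// => k _.
by rewrite /fps_var eqseq_cons (negbTE ji) mul0r.
Qed.

Lemma monomial_cons i u : monomial (i :: u) = fps_mul (@fps_var R n i) (monomial u).
Proof.
apply/funext => w; rewrite fps_var_mul; case: w => [|j v]//=.
by rewrite /monomial eqseq_cons; case: eqVneq.
Qed.

Lemma words_cons N : perm_eq (words n N.+1)
  ([::] :: [seq i :: v | i <- enum 'I_n, v <- words n N]).
Proof.
apply: uniq_perm; first exact: words_uniq.
  rewrite /= allpairs_uniq ?enum_uniq ?words_uniq ?andbT//.
    by apply/allpairsP => -[[i v] [_ _]].
  by move=> [i v] [j w] _ _ /= [-> ->].
move=> w; rewrite mem_words in_cons; case: w => [|i v] //=.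
apply/idP/allpairsP => [vN|[[j w]] /= [_ wN [_ ->]]].
  by exists (i, v); rewrite mem_enum mem_words.
by rewrite ltnS -mem_words.
Qed.

Variables (H : hilbertType R) (X : 'I_n -> 'B(H)).

(** Multiplication by a letter raises lengths by one, hence an exact identity with the index shifted
    by one; iterating it treats all monomials. *)
Lemma hol_sums_var_mul i G N :
  hol_sums (fps_mul (@fps_var R n i) G) X N.+1 = X i * hol_sums G X N.
Proof.
rewrite !hol_sumsE (perm_big _ (words_cons N)) /= big_cons fps_var_mul scale0r add0r.
rewrite big_allpairs_dep/= (bigD1_seq i) ?mem_enum ?enum_uniq//= [X in _ + X]big1 ?addr0.
  rewrite mulr_sumr; apply: eq_bigr => v _; rewrite fps_var_mul eqxx wprod_cons.
  by apply: bop_ext => x; rewrite !(bopM, bopZ) linearZ.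
move=> j ji; rewrite big1// => v _.
by rewrite fps_var_mul (negbTE ji) scale0r.
Qed.

Lemma hol_sums_monomial_mul u G (T : 'B(H)) : hol_sums G X @ \oo --> T ->
  hol_sums (fps_mul (monomial u) G) X @ \oo --> wprod X u * T.
Proof.
move=> GT; elim: u => [|i u IH].
  rewrite monomial_nil /wprod big_nil mul1r (_ : fps_mul _ _ = G)//.
  by apply/funext => w; rewrite fps_mul1l.
rewrite (_ : fps_mul _ _ = fps_mul (@fps_var R n i) (fps_mul (monomial u) G)); last first.
  by apply/funext => w; rewrite fps_mulA -monomial_cons.
rewrite -cvg_shiftS.
rewrite (_ : (fun k => _) = fun N => X i * hol_sums (fps_mul (monomial u) G) X N); last first.
  by apply/funext => N; rewrite hol_sums_var_mul.
by rewrite wprod_cons -mulrA; apply: cvg_bopM => //; exact: cvg_cst.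
Qed.

Lemma hol_sums_sum (s : seq (word n)) (a : word n -> C) (F : word n -> fps R n) N :
  hol_sums (\sum_(u <- s) a u *: F u) X N = \sum_(u <- s) a u *: hol_sums (F u) X N.
Proof.
rewrite hol_sumsE; under [RHS]eq_bigr do rewrite hol_sumsE scaler_sumr.
rewrite exchange_big; apply: eq_bigr => w _ /=.
rewrite fps_sumE scaler_suml; apply: eq_bigr => u _; by rewrite scalerA.
Qed.

Lemma hol_sums_trunc_mul F G N (T : 'B(H)) : hol_sums G X @ \oo --> T ->
  hol_sums (fps_mul (fps_trunc F N) G) X @ \oo --> hol_sums F X N * T.
Proof.
move=> GT; rewrite (_ : fps_mul _ _ =
    \sum_(u <- words n N) F u *: fps_mul (monomial u) G); last first.
  apply/funext => w; rewrite fps_sumE /fps_mul.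
  under [RHS]eq_bigr do rewrite -[_ w]/(_ * _) mulr_sumr.
  rewrite [RHS]exchange_big; apply: eq_bigr => k _ /=.
  rewrite /fps_trunc fps_sumE mulr_suml; apply: eq_bigr => u _.
  by rewrite -[(_ *: _) _]/(_ * _) mulrA.
rewrite (_ : hol_sums _ X = fun K => \sum_(u <- words n N)
    F u *: hol_sums (fps_mul (monomial u) G) X K); last first.
  by apply/funext => K; exact: hol_sums_sum.
rewrite hol_sumsE mulr_suml; apply: cvg_big => [|u _]; first exact: add_continuous.
have -> : F u *: wprod X u * T = F u *: (wprod X u * T) by exact: bop_ext.
by apply: cvgZl_tmp; exact: hol_sums_monomial_mul.
Qed.

Lemma hol_sums_trunc F N K : (N <= K)%N -> hol_sums (fps_trunc F N) X K = hol_sums F X N.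
Proof.
move=> NK; rewrite !hol_sumsE (@sum_subwords _ _ _ K (words n N)) ?words_uniq//; last first.
  by move=> w; rewrite mem_words => wN; exact: leq_trans wN NK.
rewrite [RHS]big_mkcond; apply: eq_bigr => w _.
by rewrite fps_truncE mem_words; case: ifP; rewrite ?scale0r.
Qed.

Lemma hol_sums_trunc_cvg F N : hol_sums (fps_trunc F N) X @ \oo --> hol_sums F X N.
Proof. by apply: cvg_near_cst; exists N => // K; exact: hol_sums_trunc. Qed.

End polynomials.

(** * The functional calculus *)

Section evaluations.
Variables (R : realType) (n : nat).
Implicit Types F G : fps R n.

Lemma antihol_sums0 (H : hilbertType R) (Y : 'I_n -> 'B(H)) :
  antihol_sums (0 : fps R n) Y = fun=> 0.
Proof.
apply/funext => N; rewrite /antihol_sums big1// => k _.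
by rewrite /homsum big1// => w _; rewrite scale0r.
Qed.

Lemma har_eval_hol (H : hilbertType R) (Y : 'I_n -> 'B(H)) F :
  har_eval Y (hol_har F) = limn (hol_sums F Y).
Proof.
rewrite /har_eval/= antihol_sums0 (cvg_lim (@norm_hausdorff _ _) (cvg_cst _)).
exact: add0r.
Qed.

Lemma Har_hol (p : ncpoly R n) m F : Hol p m F -> Har p m (hol_har F).
Proof.
move=> HF; split=> // K Y /HF ?; split=> //=.
by rewrite antihol_sums0; exact: is_cvg_cst.
Qed.

Definition har_sub (F G : fps R n * fps R n) := (F.1 - G.1, F.2 - G.2).

Lemma hol_sumsB (H : hilbertType R) (Y : 'I_n -> 'B(H)) F G (S T : 'B(H)) :
  hol_sums F Y @ \oo --> S -> hol_sums G Y @ \oo --> T ->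
  hol_sums (F - G) Y @ \oo --> S - T.
Proof.
move=> FS GT; rewrite (_ : F - G = -1 *: G + F); last by rewrite scaleN1r addrC.
rewrite hol_sums_linear (_ : S - T = -1 *: T + S); last by rewrite scaleN1r addrC.
by apply: cvgD FS; exact: cvgZl_tmp.
Qed.

Lemma antihol_sumsB (H : hilbertType R) (Y : 'I_n -> 'B(H)) F G (S T : 'B(H)) :
  antihol_sums F Y @ \oo --> S -> antihol_sums G Y @ \oo --> T ->
  antihol_sums (F - G) Y @ \oo --> S - T.
Proof.
move=> FS GT; rewrite (_ : F - G = -1 *: G + F); last by rewrite scaleN1r addrC.
rewrite antihol_sums_linear (_ : S - T = -1 *: T + S); last by rewrite scaleN1r addrC.
by apply: cvgD FS; exact: cvgZl_tmp.
Qed.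

Lemma har_eval_sub (H : hilbertType R) (Y : 'I_n -> 'B(H)) (F G : fps R n * fps R n) :
  cvgn (antihol_sums F.1 Y) /\ cvgn (hol_sums F.2 Y) ->
  cvgn (antihol_sums G.1 Y) /\ cvgn (hol_sums G.2 Y) ->
  har_eval Y (har_sub F G) = har_eval Y F - har_eval Y G.
Proof.
move=> [dF cF] [dG cG]; rewrite /har_eval opprD addrACA; congr (_ + _).
  by apply: cvg_lim (antihol_sumsB dF dG); exact: norm_hausdorff.
by apply: cvg_lim (hol_sumsB cF cG); exact: norm_hausdorff.
Qed.

Lemma Har_sub (p : ncpoly R n) m (F G : fps R n * fps R n) :
  Har p m F -> Har p m G -> Har p m (har_sub F G).
Proof.
move=> [F0 HF] [G0 HG]; split; first by rewrite /= -[LHS]/(_ - _) F0 G0 subrr.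
move=> K Y Yrad; have [dF cF] := HF K Y Yrad; have [dG cG] := HG K Y Yrad.
split; apply/cvg_ex.
  exists (limn (antihol_sums F.1 Y) - limn (antihol_sums G.1 Y)).
  exact: (antihol_sumsB dF dG).
by exists (limn (hol_sums F.2 Y) - limn (hol_sums G.2 Y)); exact: (hol_sumsB cF cG).
Qed.

Lemma Hol_linear (p : ncpoly R n) m a F G : Hol p m F -> Hol p m G -> Hol p m (a *: F + G).
Proof.
move=> HF HG K Y Yrad; rewrite hol_sums_linear; apply/cvg_ex.
exists (a *: limn (hol_sums F Y) + limn (hol_sums G Y)).
by apply: cvgD; [apply: cvgZl_tmp; exact: HF|exact: HG].
Qed.

Lemma Hol_trunc (p : ncpoly R n) m F N : Hol p m (fps_trunc F N).
Proof. by move=> K Y _; apply/cvg_ex; exists (hol_sums F Y N); exact: hol_sums_trunc_cvg. Qed.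

Lemma hol_sums_monomial (H : hilbertType R) (Y : 'I_n -> 'B(H)) u :
  hol_sums (monomial R u) Y @ \oo --> wprod Y u.
Proof.
apply: cvg_near_cst; exists (size u).+1 => // N /= uN; rewrite hol_sumsE.
rewrite (bigD1_seq u) ?words_uniq ?mem_words//= /monomial eqxx scale1r big1 ?addr0//.
by move=> w /negbTE ->; rewrite scale0r.
Qed.

Lemma Hol_monomial (p : ncpoly R n) m u : Hol p m (monomial R u).
Proof. by move=> K Y _; apply/cvg_ex; exists (wprod Y u); exact: hol_sums_monomial. Qed.

End evaluations.

Section uniqueness.
Variables (R : realType) (n m : nat) (p : ncpoly R n) (H : hilbertType R).
Variables (X : 'I_n -> 'B(H)) (Theta : fps R n -> 'B(H)).
Hypothesis Theta_hom : unital_alg_hom_on (Hol p m) Theta.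
Hypothesis Theta_var : forall i, Theta (fps_var R i) = X i.

Lemma hom_monomial u : Theta (monomial R u) = wprod X u.
Proof.
have [T1 _ TM] := Theta_hom; elim: u => [|i u IH].
  by rewrite monomial_nil T1 /wprod big_nil.
rewrite monomial_cons TM ?IH ?Theta_var ?wprod_cons//; last exact: Hol_monomial.
exact: (@Hol_monomial _ _ p m [:: i]).
Qed.

Lemma hom_trunc F N : Theta (fps_trunc F N) = hol_sums F X N.
Proof.
have [_ TD _] := Theta_hom.
have H0 : Hol p m 0.
  by have := @Hol_trunc R n p m 0 0; rewrite /fps_trunc (_ : words n 0 = [::])// big_nil.
have T0 : Theta 0 = 0.
  by have := TD (-1) 0 0 H0 H0; rewrite scaler0 addr0 scaleN1r addNr.
rewrite /fps_trunc hol_sumsE.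
(* Linearity of [Theta] is available only on [Hol], so membership is carried through the
   induction. *)
suff [] : Hol p m (\sum_(u <- words n N) F u *: monomial R u) /\
  Theta (\sum_(u <- words n N) F u *: monomial R u) =
  \sum_(u <- words n N) F u *: wprod X u by [].
elim: (words n N) => [|u s [Hs IH]]; first by rewrite !big_nil.
rewrite !big_cons; split; first by apply: Hol_linear => //; exact: Hol_monomial.
by rewrite TD ?IH ?hom_monomial//; exact: Hol_monomial.
Qed.

End uniqueness.

Section functional_calculus.
Variables (R : realType) (n m : nat) (p : ncpoly R n) (H : hilbertType R).
Variables (X : 'I_n -> 'B(H)) (r : nat -> R).
Hypothesis p_reg : positive_regular p.
Hypothesis r_int : forall k, 0 < r k < 1.
Local Notation C := R[i].
Local Notation sb := (sqrtb m p).
Local Notation W := (left_creation p m.+1).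
Local Notation scaledW t := (fun i => t%:C%C *: W i).

Lemma scaled_left_creation_rad k : ncdomain_rad p m.+1 (scaledW (r k)).
Proof.
have /andP[r0 r1] := r_int k; exists (r k); split; first by rewrite ltW.
by exists W; [exact: left_creation_ncdomain|].
Qed.

Lemma hol_lim_coord c t (u : fock R n) w : cvgn (hol_sums c (scaledW t)) ->
  limn (hol_sums c (scaledW t)) u w = \sum_(0 <= k < (size w).+1)
    c (take k w) * t%:C%C ^+ size (take k w) * (sb (drop k w) / sb w) * u (drop k w).
Proof.
move=> cc; apply: (lim_coord (N0 := (size w).+1)) => // N wN.
rewrite hol_sumsE bop_sum (@ell2_sum R n C).
pose F g v := if g \in words n N then
  c g * t%:C%C ^+ size g * (sb v / sb w) * u v else 0.
rewrite (eq_big_seq (fun g => if strip_prefix g w is Some v then F g v else 0)).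
  rewrite sum_strip_prefix ?words_uniq//; last by move=> g v /negbTE gN; rewrite /F gN.
  apply: eq_big_nat => k /andP[_ kw]; rewrite /F mem_words.
  by rewrite (leq_ltn_trans _ wN)// size_take_min geq_minr.
move=> g gN; rewrite wprodZ scalerA bopZ ell2Z wprod_leftE// /F gN.
case: (strip_prefix g w) => [v|]; last by rewrite scaler0.
exact: mulrA.
Qed.

(* [weighted (F G)] is the image of the vector [G(tW) e_1] under [F(tW)]. *)
Lemma weighted_mul_le F G t N :
  cvgn (hol_sums F (scaledW t)) -> cvgn (hol_sums G (scaledW t)) ->
  \sum_(w <- words n N) nr (weighted m p t (fps_mul F G) w) ^+ 2 <=
  (nr (limn (hol_sums F (scaledW t))) * nr (limn (hol_sums G (scaledW t)))) ^+ 2.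
Proof.
move=> cF cG; set VF := limn _; set VG := limn (hol_sums G _).
have E w : VF (VG (evec R [::])) w = weighted m p t (fps_mul F G) w.
  rewrite hol_lim_coord// /weighted /fps_mul !mulr_suml.
  apply: eq_big_nat => k /andP[_ kw].
  rewrite hol_coord_vacuum// /weighted -[in RHS](cat_take_drop k w) size_cat exprD.
  rewrite cat_take_drop; field.
  by rewrite !sqrtb_neq0.
under eq_bigr do rewrite -E.
rewrite (le_trans (@sum_sqr_le R n C _ _ (words_uniq n N)))//.
rewrite ler_pXn2r ?nnegrE ?mulr_ge0 ?nr_ge0// (le_trans (nr_bop_le _ _))//.
rewrite ler_wpM2l ?nr_ge0// (le_trans (nr_bop_le _ _))//.
by rewrite nr_evec mulr1.
Qed.

Variables (k0 : nat) (M : R).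
Hypothesis M0 : 0 <= M.
Hypothesis kernelX : forall h N, \sum_(w <- words n N)
  nr (((r k0)^-1%:C%C ^+ size w * sb w) *: adjop (wprod X w) h) ^+ 2 <= (M * nr h) ^+ 2.

Let r0 : 0 < r k0. Proof. by have /andP[] := r_int k0. Qed.

(** The constant [2 M] is one [M] for each of the two series, whose coefficients are both controlled
    by the single operator [G(r_k0 W)]. *)
Lemma har_eval_bound G : Har p m.+1 G ->
  [/\ cvgn (antihol_sums G.1 X), cvgn (hol_sums G.2 X) &
     nr (har_eval X G) <= 2 * M * nr (har_eval (scaledW (r k0)) G)].
Proof.
move=> [G0 HG]; have [dW cW] := HG _ _ (scaled_left_creation_rad k0).
have V0 := nr_ge0 (har_eval (scaledW (r k0)) G).
have [dX dXle] := antihol_sums_cvg p_reg r0 M0 kernelX G0 V0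
  (fun N => weighted_antihol_le p_reg N G0 dW cW).
have [cX cXle] := hol_sums_cvg p_reg r0 M0 kernelX V0
  (fun N => weighted_hol_le p_reg N G0 dW cW).
split=> //; rewrite (le_trans (nrD _ _))// (le_trans (lerD dXle cXle))//.
by rewrite -mulrA mulr_natl.
Qed.

Lemma har_dist_ge0 k F G : 0 <= har_dist p m.+1 (r k) F G.
Proof. exact: opnorm_ge0. Qed.

Lemma har_eval_continuous : norm_continuous_on (Har p m.+1) (har_metric p m.+1 r) (har_eval X).
Proof.
move=> F HF e e0.
have M1 : 0 < 2 * M + 1 by rewrite ltr_wpDl// mulr_ge0.
pose e' := e / (2 * M + 1); have e'0 : 0 < e' by rewrite divr_gt0.
(* The metric dominates its term of index [k0], and [x / (1 + x)] is increasing. So this distance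
   forces [|(F - G)(r_k0 W)| < e'], and the bound [2 M] then gives less than [e]. *)
exists (2 ^- k0.+1 * (e' / (1 + e'))).
  by rewrite mulr_gt0 ?half_gt0// divr_gt0// ltr_wpDr// ltW.
move=> G HG FG.
have [dF cF _] := har_eval_bound HF; have [dG cG _] := har_eval_bound HG.
have [dFW cFW] := HF.2 _ _ (scaled_left_creation_rad k0).
have [dGW cGW] := HG.2 _ _ (scaled_left_creation_rad k0).
rewrite -nr_bop -har_eval_sub//.
have [_ _ le] := har_eval_bound (Har_sub HF HG).
rewrite (le_lt_trans le)// har_eval_sub//.
set x := nr _; have x0 : 0 <= x by exact: nr_ge0.
have xe : x < e'.
  apply: frac_lt => //; first exact: ltW.
  rewrite -(ltr_pM2l (half_gt0 R k0.+1)) (le_lt_trans _ FG)//.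
  exact: (metric_ge (fun k => har_dist_ge0 k F G) k0).
rewrite (@le_lt_trans _ _ ((2 * M + 1) * x))//.
  by rewrite ler_wpM2r// lerDl.
by rewrite mulrC -ltr_pdivlMr.
Qed.

Lemma hol_sums_Hol_cvg F : Hol p m.+1 F -> cvgn (hol_sums F X).
Proof. by move=> /Har_hol/har_eval_bound[]. Qed.

(* For a truncation of [F] both sides agree, and [weighted_mul_le] controls the
   error made by truncating. *)
Lemma hol_eval_mul F G : Hol p m.+1 F -> Hol p m.+1 G ->
  limn (hol_sums (fps_mul F G) X) = limn (hol_sums F X) * limn (hol_sums G X).
Proof.
move=> HF HG.
have FX := hol_sums_Hol_cvg HF; have GX := hol_sums_Hol_cvg HG.
have GW := HG _ _ (scaled_left_creation_rad k0).
have FW := HF _ _ (scaled_left_creation_rad k0).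
set tW := (fun i => _) in GW FW.
(* Used for [K = F], to get convergence of the product series at [X], and for
   [K = F - fps_trunc F N], to estimate the truncation error. *)
have bound K : cvgn (hol_sums K tW) -> cvgn (hol_sums (fps_mul K G) X) /\
    nr (limn (hol_sums (fps_mul K G) X)) <=
    M * (nr (limn (hol_sums K tW)) * nr (limn (hol_sums G tW))).
  move=> KW; apply: (hol_sums_cvg p_reg r0 M0 kernelX).
    by rewrite mulr_ge0 ?nr_ge0.
  by move=> N; exact: weighted_mul_le.
have [FGX _] := bound F FW.
have h1 : (fun N => hol_sums F X N * limn (hol_sums G X)) @ \oo -->
    limn (hol_sums F X) * limn (hol_sums G X).
  by apply: cvg_bopM; [exact: FX|exact: cvg_cst].
apply: (cvg_unique (@norm_hausdorff _ _) _ h1).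
apply: (@cvg_nr_dominated _ _ _ _ (fun N => M *
  (nr (limn (hol_sums F tW) - hol_sums F tW N) * nr (limn (hol_sums G tW))))); last first.
  rewrite -(mulr0 M); apply: cvgMl_tmp; rewrite -(mul0r (nr (limn (hol_sums G tW)))).
  by apply: cvgMr_tmp; exact: cvg_nr0.
move=> N.
have DW := hol_sumsB FW (@hol_sums_trunc_cvg _ _ _ tW F N).
have cDW : cvgn (hol_sums (F - fps_trunc F N) tW).
  by apply/cvg_ex; exists (limn (hol_sums F tW) - hol_sums F tW N).
have [_] := bound _ cDW.
rewrite (cvg_lim (@norm_hausdorff _ _) DW); apply: le_trans.
rewrite le_eqVlt; apply/orP; left; apply/eqP; congr nr.
have h2 := hol_sumsB FGX (@hol_sums_trunc_mul _ _ _ X F G N _ GX).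
rewrite -(cvg_lim (@norm_hausdorff _ _) h2); congr (limn (hol_sums _ X)).
apply/funext => w; rewrite -[LHS]/(_ - _) /fps_mul -sumrB; apply: eq_bigr => k _.
by rewrite -[(_ - _) _]/(_ - _) mulrBl.
Qed.

Lemma hol_eval_hom : unital_alg_hom_on (Hol p m.+1) (fun F => har_eval X (hol_har F)).
Proof.
split=> [|a F G HF HG|F G HF HG]; rewrite !har_eval_hol.
- rewrite -monomial_nil (cvg_lim (@norm_hausdorff _ _) (@hol_sums_monomial _ _ _ X [::])).
  by rewrite /wprod big_nil.
- rewrite hol_sums_linear; apply: cvg_lim; first exact: norm_hausdorff.
  by apply: cvgD; [apply: cvgZl_tmp|]; exact: hol_sums_Hol_cvg.
- exact: hol_eval_mul.
Qed.

(** Half of [d] absorbs the radii of index at least [K]; for the finitely many others, the distance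
    to a truncation is the remainder of a convergent series. *)
Lemma har_metric_trunc F : Hol p m.+1 F -> forall d : R, 0 < d -> exists N0, forall N,
  (N0 <= N)%N -> har_metric p m.+1 r (hol_har F) (hol_har (fps_trunc F N)) < d.
Proof.
move=> HF d d0.
have distE k N : har_dist p m.+1 (r k) (hol_har F) (hol_har (fps_trunc F N)) =
    nr (limn (hol_sums F (scaledW (r k))) - hol_sums F (scaledW (r k)) N).
  rewrite /har_dist -nr_bop !har_eval_hol.
  by rewrite (cvg_lim (@norm_hausdorff _ _) (@hol_sums_trunc_cvg _ _ _ _ F N)).
have d2 : 0 < d / 2 by rewrite divr_gt0.
have [K Kd] : exists K, 2 ^- K < d / 2.
  have : (fun k => (2^-1 : R) ^+ k) @ \oo --> (0 : R).
    by apply: cvg_expr; rewrite ger0_norm ?invr_ge0// invf_lt1 ?ltr1n.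
  move=> /cvgrPdist_lt/(_ _ d2)[K _ /(_ K (leqnn K))]; rewrite sub0r normrN exprVn => h.
  by exists K; exact: le_lt_trans (ler_norm _) h.
have [N0 N0P] : exists N0, forall N k, (N0 <= N)%N -> (k < K)%N ->
    nr (limn (hol_sums F (scaledW (r k))) - hol_sums F (scaledW (r k)) N) <= d / 2.
  elim: {Kd} K => [|K [N1 N1P]]; first by exists 0.
  have /cvg_nrP/(_ _ d2)[N2 N2P] : hol_sums F (scaledW (r K)) @ \oo -->
    limn (hol_sums F (scaledW (r K))) by exact: HF _ _ (scaled_left_creation_rad K).
  exists (maxn N1 N2) => N k; rewrite geq_max => /andP[N1N N2N].
  by rewrite ltnS leq_eqVlt => /orP[/eqP ->|/N1P]; [exact: ltW (N2P N N2N)|exact].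
exists N0 => N /N0P NP.
rewrite (@le_lt_trans _ _ (d / 2 + 2 ^- K))//.
  apply: metric_le => [k||k kK]; [exact: har_dist_ge0|exact: ltW|].
  by rewrite distE NP.
by rewrite [ltRHS]splitr ltrD2l.
Qed.

Lemma hom_unique (Theta : fps R n -> 'B(H)) :
  unital_alg_hom_on (Hol p m.+1) Theta ->
  norm_continuous_on (Hol p m.+1)
    (fun F G => har_metric p m.+1 r (hol_har F) (hol_har G)) Theta ->
  (forall i, Theta (fps_var R i) = X i) ->
  forall F, Hol p m.+1 F -> Theta F = har_eval X (hol_har F).
Proof.
move=> Th Tc Tv F HF; rewrite har_eval_hol.
have FX : hol_sums F X @ \oo --> limn (hol_sums F X) by exact: hol_sums_Hol_cvg.
apply: (cvg_unique (@norm_hausdorff _ _) _ FX).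
apply/cvg_nrP => e e0; have [d d0 Td] := Tc F HF e e0.
have [N0 N0P] := har_metric_trunc HF d0.
exists N0 => N NN; rewrite -(hom_trunc Th Tv) nr_bop.
by apply: Td; [exact: Hol_trunc|exact: N0P].
Qed.

End functional_calculus.

Theorem theorem5p1 (R : realType) (n m : nat) (p : ncpoly R n)
    (H : hilbertType R) (X : 'I_n -> 'B(H)) (r : nat -> R)
    (n_gt0 : (0 < n)%N) (m_gt0 : (0 < m)%N) (p_reg : positive_regular p)
    (r_int : forall k, 0 < r k < 1) (r_incr : increasing_seq r)
    (r_lim : r @ \oo --> (1 : R))
    (X_radius : spectral_radius (reconstruction p m X) < 1) :
  [/\ forall G, Har p m G ->
        cvgn (antihol_sums G.1 X) /\ cvgn (hol_sums G.2 X),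
      norm_continuous_on (Har p m) (har_metric p m r) (har_eval X),
      unital_alg_hom_on (Hol p m) (fun F => har_eval X (hol_har F)) /\
      norm_continuous_on (Hol p m)
        (fun F G => har_metric p m r (hol_har F) (hol_har G))
        (fun F => har_eval X (hol_har F)) &
      forall Theta : fps R n -> 'B(H),
        unital_alg_hom_on (Hol p m) Theta ->
        norm_continuous_on (Hol p m)
          (fun F G => har_metric p m r (hol_har F) (hol_har G)) Theta ->
        (forall i, Theta (fps_var R i) = X i) ->
        forall F, Hol p m F -> Theta F = har_eval X (hol_har F)].
Proof.
case: m m_gt0 X_radius => // m' _ X_radius.
(* One index [k0] and one constant [M], depending on [X] but on no series, serve all four claims. *)
have [k0 k0P] := kernel_bound p_reg r_int r_lim X_radius.
have [M M0 kernelX] := k0P k0 (leqnn k0).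
split.
- by move=> G /(har_eval_bound p_reg r_int M0 kernelX)[].
- exact: (har_eval_continuous p_reg r_int M0 kernelX).
- split; first exact: (hol_eval_hom p_reg r_int M0 kernelX).
  move=> F HF e e0.
  have [d d0 Fd] := har_eval_continuous p_reg r_int M0 kernelX (Har_hol HF) e0.
  by exists d => // G HG; apply: Fd; exact: Har_hol.
- exact: (hom_unique p_reg r_int M0 kernelX).
Qed.
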